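(* There is a constant $C>0$ depending only on the nested fractal $\mathcal K$ such that for every $f\in\mathcal D(\mathcal E)$, every $m\ge 0$ and every $m$-simplex $\Delta$, $$\frac{1}{\mu(\Delta)}\int_\Delta |f(x)-f_\Delta|\,d\mu(x)\le C\,(\mathrm{diam}\,\Delta)^{d_w/2}\left(\frac{1}{\mu(\Delta^* )}\int_{\Delta^*}\langle\nabla f,Z\,\nabla f\rangle\,d\nu\right)^{1/2}$$ and (with a possibly larger constant $C$ depending only on $\mathcal K$) the right-hand side is in turn at most $$C\,L^{-md_w/2}\left(L^{-md}\Big/L^{-2md}\int_{\Delta^*}\langle\nabla f,Z\,\nabla f\rangle\,d\nu\right)^{1/2}=C\,L^{-md_w/2}\left(L^{md}\int_{\Delta^*}\langle\nabla f,Z\,\nabla f\rangle\,d\nu\right)^{1/2},$$ where $f_\Delta=\frac1{\mu(\Delta)}\int_\Delta f\,d\mu$ and $\Delta^*$ denotes the union of $\Delta$ and all $m$-simplices adjacent to $\Delta$.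
   Context: Nested fractal. Let $\phi_1,\dots,\phi_M$ ($M\ge2$) be similitudes of $\mathbb R^N$ with common scaling factor $L>1$, i.e. $|\phi_i(x)-\phi_i(y)|=L^{-1}|x-y|$. For $A\subset\mathbb R^N$ put $\Phi(A)=\bigcup_{i=1}^M\phi_i(A)$, and let $\Phi^m$ be its $m$-fold iterate. $\mathcal K$ is the unique nonempty compact set with $\mathcal K=\Phi(\mathcal K)$; it is normalized so that $\mathrm{diam}\,\mathcal K=1$. Let $v_i$ be the fixed point of $\phi_i$; $v_i$ is essential if there are another fixed point $v_j\ne v_i$ and $k,l$ with $\phi_k(v_i)=\phi_l(v_j)$. $V^{(0)}$ is the set of essential fixed points, $r=\#V^{(0)}\ge2$, $V^{(m)}=\Phi^m(V^{(0)})$, $V^{(\infty)}=\bigcup_{m\ge0}V^{(m)}$. $\mathcal W_m=\{1,\dots,M\}^m$; for $w=(w_1,\dots,w_m)\in\mathcal W_m$, $\phi_w=\phi_{w_1}\circ\cdots\circ\phi_{w_m}$ and $\mathcal K_w=\phi_w(\mathcal K)$. The sets $\mathcal K_w$, $w\in\mathcal W_m$, are the $m$-simplices (the $0$-simplex is $\mathcal K$), $\mathcal T_m$ is their collection, and $V(\mathcal K_w)=\phi_w(V^{(0)})$. $\mathcal K$ is a nested fractal, meaning: (open set condition) there is a nonempty open $U$ with $\Phi(U)\subset U$ and $\phi_i(U)\cap\phi_j(U)=\emptyset$ for $i\ne j$; (nesting) $S\cap T=V(S)\cap V(T)$ for distinct $S,T\in\mathcal T_m$, $m\ge1$; (connectivity)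 the graph on $V^{(1)}$ joining points of a common $\phi_i(V^{(0)})$ is connected; (symmetry) for $x\neq y$ in $V^{(0)}$, the reflection $R_{x,y}$ in the hyperplane bisecting $[x,y]$ maps each $\phi_i(V^{(0)})$ onto some $\phi_j(V^{(0)})$. $d=\log M/\log L$ is the Hausdorff dimension of $\mathcal K$, and $\mu$ is the $d$-dimensional Hausdorff measure on $\mathcal K$ normalized by $\mu(\mathcal K)=1$. Two distinct $m$-simplices are adjacent if they intersect. Harmonic structure and Dirichlet form. A conductivity matrix is a symmetric real $A=[a_{x,y}]_{x,y\in V^{(0)}}$ with nonnegative off-diagonal entries and zero row sums; $\mathcal E^{(0)}_A(f,f)=\frac12\sum_{x,y}a_{x,y}(f(x)-f(y))^2$. It is known that there are a unique number $\varrho>1$ and a unique, up to a multiplicative constant, irreducible $A$ invariant under the group generated by the $R_{x,y}$, $x\ne y\in V^{(0)}$, such that for all $f:V^{(0)}\to\mathbb R$, $\inf\{\sum_{i=1}^M\mathcal E^{(0)}_A(g\circ\phi_i,g\circ\phi_i): g:V^{(1)}\to\mathbb R,\ g|_{V^{(0)}}=f\}=\varrho^{-1}\mathcal E^{(0)}_A(f,f)$. Fix such $A$, write $\mathcal E^{(0)}=\mathcal E^{(0)}_A$. The walk dimension is $d_w=\log(M\varrho)/\log L$, so $\varrho=L^{d_w-d}$. For $f\in C(\mathcal K)$, $\mathcal E^{(m)}(f,f)=\varrho^m\sum_{w\in\mathcal W_m}\mathcal E^{(0)}(f\circ\phi_w,f\circ\phi_w)$ is nondecreasing in $m$; $\mathcal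 D(\mathcal E)=\{f\in C(\mathcal K):\sup_m\mathcal E^{(m)}(f,f)<\infty\}$ and $\mathcal E(f,f)=\lim_m\mathcal E^{(m)}(f,f)$. Kusuoka measure and gradient. For $f:V^{(0)}\to\mathbb R$ (or $f\in C(\mathcal K)$, restricted to $V^{(0)}$), $Hf$ is the unique minimizer of $\mathcal E(g,g)$ among $g\in\mathcal D(\mathcal E)$ with $g=f$ on $V^{(0)}$; such functions are called harmonic. $\mathcal H$ is the space of harmonic functions with norm $\|h\|_{\mathcal H}^2=\mathcal E(h,h)+(\sum_{x\in V^{(0)}}h(x))^2$; $\widetilde{\mathcal H}$ is the orthogonal complement of the constants in $\mathcal H$, with norm $\|h\|^2=\mathcal E(h,h)$ and scalar product $\langle\cdot,\cdot\rangle$; $\widetilde P:\mathcal H\to\widetilde{\mathcal H}$ is the orthogonal projection. $\widetilde M_ih=\widetilde P(h\circ\phi_i)$ for $h\in\widetilde{\mathcal H}$, and $\widetilde M_w=\widetilde M_{w_m}\circ\cdots\circ\widetilde M_{w_1}$. The harmonic structure is assumed nondegenerate: all $\widetilde M_i$ are invertible. The Kusuoka measure $\nu$ is the Borel measure on $\mathcal K$ (without atoms) with $\nu(\mathcal K_w)=\varrho^m\,\mathrm{Tr}(\widetilde M_w^*\widetilde M_w)$, $w\in\mathcal W_m$. For $x\in\mathcal K\setminus V^{(\infty)}$ with unique address $w=w_1w_2\cdots$ and $[w]_m=(w_1,\dots,w_m)$, put $Z_m(x)=\widetilde M_{[w]_m}^*\widetilde M_{[w]_m}/\mathrm{Tr}(\widetilde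 M_{[w]_m}^*\widetilde M_{[w]_m})$; then $Z=\lim_mZ_m$ exists $\nu$-a.e. Put $\nabla_mf(x)=\widetilde M_{[w]_m}^{-1}\widetilde PH(f\circ\phi_{[w]_m})\in\widetilde{\mathcal H}$. For $f\in\mathcal D(\mathcal E)$, $\nabla f:\mathcal K\to\widetilde{\mathcal H}$ denotes a measurable map, defined $\nu$-a.e., which is the limit of $\nabla_mf$ in the seminorm $F\mapsto(\int_{\mathcal K}\langle F,ZF\rangle\,d\nu)^{1/2}$; it satisfies $\mathcal E(f,f)=\int_{\mathcal K}\langle\nabla f,Z\nabla f\rangle\,d\nu$ (the function $\langle\nabla f,Z\nabla f\rangle$ is determined $\nu$-a.e.). *)

(* Defs.v *)
From HB Require Import structures.
From mathcomp Require Import all_boot all_order all_algebra finmap.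
From mathcomp Require Import all_classical all_reals all_analysis.
Set Implicit Arguments.
Unset Strict Implicit.
Unset Printing Implicit Defensive.
Import Order.TTheory GRing.Theory Num.Theory.
Import numFieldNormedType.Exports.
Local Open Scope classical_set_scope.
Local Open Scope ring_scope.

(* The library norm on row vectors is the sup norm, so the Euclidean structure
   of R^N is introduced here; both norms induce the library topology. *)
Section euclidean.
Context {R : realType} {N : nat}.
Implicit Types (x y z : 'rV[R]_N) (A : set 'rV[R]_N).

Definition edot x y : R := \sum_(i < N) x 0 i * y 0 i.

Definition enorm x : R := Num.sqrt (edot x x).

(* 0 is thrown in so that the empty set has diameter 0. *)
Definition diam A : \bar R :=
  ereal_sup (0%E |` [set z | exists x y, [/\ A x, A y & z = (enorm (x - y))%:E]]).

(* Reflection in the hyperplane bisecting the segment [x, y]. *)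
Definition reflection x y z : 'rV[R]_N :=
  z - (2 * edot (z - 2^-1 *: (x + y)) (x - y) / edot (x - y) (x - y)) *: (x - y).

Definition hausdorff_pre (s delta : R) A : \bar R :=
  ereal_inf [set u | exists U : nat -> set 'rV[R]_N,
    [/\ A `<=` \bigcup_i U i, forall i, (diam (U i) <= delta%:E)%E &
        u = (\sum_(0 <= i <oo) diam (U i) `^ s)%E]].

Definition hausdorff (s : R) A : \bar R :=
  ereal_sup [set hausdorff_pre s delta A | delta in [set delta | 0 < delta]].

End euclidean.

Definition borelRV (R : realType) (N : nat) :=
  g_sigma_algebraType (@open 'rV[R]_N).

Definition joined {T : Type} (E : T -> T -> Prop) (x y : T) : Prop :=
  exists s : seq T, path (fun a b => `[< E a b >]) x s /\ last x s = y.

Section iterated_function_system.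
Context {R : realType} {N M : nat}.
Variable phi : 'I_M -> 'rV[R]_N -> 'rV[R]_N.

Definition Phi (A : set 'rV[R]_N) : set 'rV[R]_N := \bigcup_i phi i @` A.

Definition essential_fixpoints : set 'rV[R]_N := [set x | exists i j k l y,
  [/\ phi i x = x, phi j y = y, y <> x & phi k x = phi l y]].

Fixpoint word_map (w : seq 'I_M) : 'rV[R]_N -> 'rV[R]_N :=
  if w is i :: w' then phi i \o word_map w' else id.

End iterated_function_system.

Record nestedFractal (R : realType) := NestedFractal {
  nfN : nat ;
  nfM : nat ;
  nfL : R ;
  nfphi : 'I_nfM -> 'rV[R]_nfN -> 'rV[R]_nfN ;
  nfK : set 'rV[R]_nfN ;
  nfV0 := essential_fixpoints nfphi ;
  nfM_ge2 : (2 <= nfM)%N ;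
  nfL_gt1 : 1 < nfL ;
  nf_similitude : forall i x y,
    enorm (nfphi i x - nfphi i y) = nfL^-1 * enorm (x - y) ;
  nf_compact : compact nfK ;
  nf_nonempty : nfK !=set0 ;
  nf_selfsimilar : nfK = Phi nfphi nfK ;
  nf_diam : diam nfK = 1%E ;
  nf_card_V0 : (2 <= #|` fset_set nfV0|)%N ;
  nf_open_set : exists U : set 'rV[R]_nfN,
    [/\ open U, U !=set0, Phi nfphi U `<=` U &
        forall i j, i <> j -> (nfphi i @` U) `&` (nfphi j @` U) = set0] ;
  nf_nesting : forall m (v w : m.-tuple 'I_nfM), (1 <= m)%N ->
    word_map nfphi v @` nfK <> word_map nfphi w @` nfK ->
    (word_map nfphi v @` nfK) `&` (word_map nfphi w @` nfK) =
    (word_map nfphi v @` nfV0) `&` (word_map nfphi w @` nfV0) ;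
  nf_connected : forall x y, Phi nfphi nfV0 x -> Phi nfphi nfV0 y ->
    joined (fun a b => exists i, (nfphi i @` nfV0) a /\ (nfphi i @` nfV0) b) x y ;
  nf_symmetry : forall x y, nfV0 x -> nfV0 y -> x <> y -> forall i, exists j,
    reflection x y @` (nfphi i @` nfV0) = nfphi j @` nfV0
}.

Arguments nfphi {R} F : rename.
Arguments nfK {R} F : rename.
Arguments nfV0 {R} F : rename.

Section fractal.
Context {R : realType}.
Variable F : nestedFractal R.
Local Notation T := 'rV[R]_(nfN F).
Local Notation K := (nfK F).
Local Notation V0 := (nfV0 F).
Local Notation phi_ := (word_map (nfphi F)).

Definition hdim : R := ln (nfM F)%:R / ln (nfL F).

Definition Vinf : set T := \bigcup_m iter m (Phi (nfphi F)) V0.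

Definition cell (w : seq 'I_(nfM F)) : set T := phi_ w @` K.

Definition simplices (m : nat) : set (set T) :=
  [set S | exists w : m.-tuple 'I_(nfM F), S = cell w].

Definition adjacent (S S' : set T) : Prop := S <> S' /\ S `&` S' !=set0.

(* The union of D and all m-simplices adjacent to D. *)
Definition star (m : nat) (D : set T) : set T :=
  D `|` \bigcup_(S in [set S | simplices m S /\ adjacent S D]) S.

Definition is_address (x : T) (w : nat -> 'I_(nfM F)) : Prop :=
  forall m, cell (mkseq w m) x.

(* For x in K outside Vinf the address is unique; any other value is irrelevant,
   Vinf being null for the measures considered below. *)
Definition address (x : T) : nat -> 'I_(nfM F) :=
  xget (fun=> Ordinal (ltnW (nfM_ge2 F))) [set w | is_address x w].

Definition address_prefix (x : T) (m : nat) : seq 'I_(nfM F) :=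
  mkseq (address x) m.

(* Measures on K are rendered as Borel measures on R^N carried by K. *)
Definition normalized_hausdorff
    (mu : {measure set (borelRV R (nfN F)) -> \bar R}) : Prop :=
  forall B, measurable B ->
    mu B = (hausdorff hdim (B `&` K) / hausdorff hdim K)%E.

(* Functions on V0, V1 or K (and matrices indexed by V0) are represented by
   functions on R^N of which only the values on V0, V1 or K are used. *)
Definition energy0 (a : T -> T -> R) (f : T -> R) : R :=
  2^-1 * \sum_(x \in V0) \sum_(y \in V0) a x y * (f x - f y) ^+ 2.

Inductive reflection_group : (T -> T) -> Prop :=
| reflection_group_id : reflection_group id
| reflection_group_comp x y g : V0 x -> V0 y -> x <> y ->
    reflection_group g -> reflection_group (reflection x y \o g).

End fractal.

Record harmonicStructure (R : realType) (F : nestedFractal R) :=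
  HarmonicStructure {
  hs_a : 'rV[R]_(nfN F) -> 'rV[R]_(nfN F) -> R ;
  hs_rho : R ;
  hs_sym : forall x y, nfV0 F x -> nfV0 F y -> hs_a x y = hs_a y x ;
  hs_ge0 : forall x y, nfV0 F x -> nfV0 F y -> x <> y -> 0 <= hs_a x y ;
  hs_row_sum : forall x, nfV0 F x -> \sum_(y \in nfV0 F) hs_a x y = 0 ;
  hs_irreducible : forall x y, nfV0 F x -> nfV0 F y ->
    joined (fun u v => [/\ nfV0 F u, nfV0 F v & 0 < hs_a u v]) x y ;
  hs_invariant : forall g, reflection_group g -> forall x y,
    nfV0 F x -> nfV0 F y -> hs_a (g x) (g y) = hs_a x y ;
  hs_rho_gt1 : 1 < hs_rho ;
  hs_renormalization : forall f : 'rV[R]_(nfN F) -> R,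
    inf [set e | exists g : 'rV[R]_(nfN F) -> R,
          (forall x, nfV0 F x -> g x = f x) /\
          e = \sum_(i < nfM F) energy0 hs_a (g \o nfphi F i)]
    = hs_rho^-1 * energy0 hs_a f
}.

Section dirichlet_form.
Context {R : realType} {F : nestedFractal R}.
Variable S : harmonicStructure F.
Local Notation T := 'rV[R]_(nfN F).
Local Notation K := (nfK F).
Local Notation V0 := (nfV0 F).
Local Notation phi_ := (word_map (nfphi F)).
Local Notation rho := (hs_rho S).

Definition walk_dim : R := ln ((nfM F)%:R * rho) / ln (nfL F).

Definition energy_ (m : nat) (f : T -> R) : R :=
  rho ^+ m * \sum_(w : m.-tuple 'I_(nfM F)) energy0 (hs_a S) (f \o phi_ w).

Definition energy_dom (f : T -> R) : Prop :=
  {within K, continuous f} /\ has_ubound (range (energy_^~ f)).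

Definition energy (f : T -> R) : R := lim (energy_ m f @[m --> \oo]).

Definition energy_form (f g : T -> R) : R :=
  4^-1 * (energy (f \+ g) - energy (f \- g)).

Definition is_harmonic_extension (f h : T -> R) : Prop :=
  [/\ energy_dom h, forall x, V0 x -> h x = f x &
      forall g, energy_dom g -> (forall x, V0 x -> g x = f x) ->
        energy h <= energy g].

(* H f; it is uniquely determined on K. *)
Definition harmonic_extension (f : T -> R) : T -> R :=
  xget (cst 0) [set h | is_harmonic_extension f h].

Definition is_harmonic (h : T -> R) : Prop := is_harmonic_extension h h.

Definition harmonic_dot (h k : T -> R) : R :=
  energy_form h k + (\sum_(x \in V0) h x) * (\sum_(x \in V0) k x).

Definition Htilde (h : T -> R) : Prop :=
  is_harmonic h /\ forall c : R, harmonic_dot h (cst c) = 0.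

Definition Ptilde (h : T -> R) : T -> R :=
  fun x => h x - harmonic_dot h (cst 1) / harmonic_dot (cst 1) (cst 1).

Definition Mtilde (i : 'I_(nfM F)) (h : T -> R) : T -> R :=
  Ptilde (h \o nfphi F i).

(* Each Mtilde i is a bijection of Htilde, functions being identified when they
   agree on K. *)
Definition nondegenerate_structure : Prop := forall i h, Htilde h ->
  exists g, [/\ Htilde g, {in K, Mtilde i g =1 h} &
    forall g', Htilde g' -> {in K, Mtilde i g' =1 h} -> {in K, g' =1 g}].

Section coordinates.
Variables (n : nat) (e : 'I_n -> T -> R).

(* An orthonormal basis identifies Htilde with R^n, so that adjoints become
   transposes and the scalar product becomes the dot product. *)
Definition orthonormal_basis : Prop :=
  [/\ forall k, Htilde (e k),
      forall k l, energy_form (e k) (e l) = (k == l)%:R &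
      forall h, Htilde h -> exists c : 'I_n -> R,
        {in K, h =1 fun x => \sum_(k < n) c k * e k x}].

Definition coord_tilde (h : T -> R) : 'cV[R]_n := \col_k energy_form h (e k).

Definition Mmat (i : 'I_(nfM F)) : 'M[R]_n :=
  \matrix_(k, l) coord_tilde (Mtilde i (e l)) k 0.

Fixpoint Mword (w : seq 'I_(nfM F)) : 'M[R]_n :=
  if w is i :: w' then Mword w' *m Mmat i else 1%:M.

Definition kusuoka_measure
    (nu : {measure set (borelRV R (nfN F)) -> \bar R}) : Prop :=
  [/\ nu (~` K) = 0%E, forall x, nu [set x] = 0%E &
      forall m (w : m.-tuple 'I_(nfM F)),
        nu (cell w) = (rho ^+ m * \tr ((Mword w)^T *m Mword w))%:E].

Definition Z_ (m : nat) (x : T) : 'M[R]_n :=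
  let A := Mword (address_prefix x m) in (\tr (A^T *m A))^-1 *: (A^T *m A).

Definition Z (x : T) : 'M[R]_n := lim (Z_ m x @[m --> \oo]).

Definition Zdot (G G' : T -> 'cV[R]_n) (x : T) : R :=
  ((G x)^T *m (Z x *m G' x)) 0 0.

Definition nabla_ (m : nat) (f : T -> R) (x : T) : 'cV[R]_n :=
  let w := address_prefix x m in
  invmx (Mword w) *m coord_tilde (Ptilde (harmonic_extension (f \o phi_ w))).

Definition is_gradient (nu : {measure set (borelRV R (nfN F)) -> \bar R})
    (f : T -> R) (G : T -> 'cV[R]_n) : Prop :=
  (forall k, measurable_fun (K : set (borelRV R (nfN F)))
     (fun x : borelRV R (nfN F) => G x k 0)) /\
  (((\int[nu]_(x in K) (Zdot (nabla_ m f \- G) (nabla_ m f \- G) x)%:E) `^ 2^-1)%E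
     @[m --> \oo] --> 0%E).

End coordinates.
End dirichlet_form.

Section averages.
Context {R : realType} {F : nestedFractal R}.
Variable mu : {measure set (borelRV R (nfN F)) -> \bar R}.

Definition mean_value (D : set 'rV[R]_(nfN F)) (f : 'rV[R]_(nfN F) -> R) : R :=
  (fine (mu D))^-1 * \int[mu]_(x in D) f x.

End averages.

(* Main.v *)
Require Import Defs.
From mathcomp Require Import all_boot all_order all_algebra finmap.
From mathcomp Require Import all_classical all_reals all_analysis.
From mathcomp Require Import measurable_realfun.
From mathcomp Require Import ring lra.
Set Implicit Arguments.
Unset Strict Implicit.
Unset Printing Implicit Defensive.
Import Order.TTheory GRing.Theory Num.Theory.
Import numFieldNormedType.Exports.
Local Open Scope classical_set_scope.
Local Open Scope ring_scope.

(** The mean oscillation of [f] on a cell is at most the largest difference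
    between two values of [f] there, and such differences are governed by energy
    alone. Two vertices of one generation in a common cell
    are joined by a chain of boundary pairs of positive conductance, so their
    values differ by at most a constant times the square root of the energy of
    the cell. Passing from a cell to its subcells divides the energy bound by
    the renormalization factor, which exceeds 1, so the increments along the
    generations form a geometric series: this is [oscillation_le].

    It remains to compare measures and energies with the integral of the
    gradient. For measures, the open set condition lets only boundedly many
    cells of generation [m] come near a given point [cell_packing]. Hence the
    Hausdorff measure of the fractal is positive [hausdorff_K_gt0], distinct
    words have distinct cells [cell_inj], all cells of one generation have equal
    measure [mu_cell], and a star has measure at most a constant times that of a
    cell [mu_star_le].

    For energies, the discrete gradient is constant on each cell of its
    generation, where the integral of [Z] is the Gram matrix of the word
    [integral_Z]. The integral of its square over a cell is therefore the
    discrete energy of the cell [integral_nabla], and a limit gives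
    [cell_energy_le].

    The integral of [Z] needs three ingredients. Harmonic functions have to
    exist: near-minimizers are glued over finitely many generations, a limit is
    extracted by compactness, and the oscillation estimate makes the limit
    continuous [optimal_extension]. Composition with the maps of the fractal has
    to preserve harmonicity [harmonic_phi]; this makes the Gram matrices of the
    subwords of a word add up [Mword_gram_split]. Finally, [Z] has to be the
    almost everywhere limit of the densities of these additive families with
    respect to the Kusuoka measure. The densities are a bounded martingale
    indexed by words, so Kolmogorov's maximal inequality [maximal_inequality]
    gives the convergence [martingale_cvg], and dominated convergence the
    value of the integral. *)

(** * Euclidean norm and similitudes *)

Section euclidean_norm.
Context {R : realType} {N : nat}.
Implicit Types x y z : 'rV[R]_N.

Lemma edotC x y : edot x y = edot y x.
Proof. by apply: eq_bigr => i _; rewrite mulrC. Qed.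

Lemma edotDl x y z : edot (x + y) z = edot x z + edot y z.
Proof. by rewrite /edot -big_split; apply: eq_bigr => i _; rewrite mxE mulrDl. Qed.

Lemma edotZl a x y : edot (a *: x) y = a * edot x y.
Proof. by rewrite /edot mulr_sumr; apply: eq_bigr => i _; rewrite mxE mulrA. Qed.

Lemma edotNl x y : edot (- x) y = - edot x y.
Proof. by rewrite -scaleN1r edotZl mulN1r. Qed.

Lemma edotDr x y z : edot x (y + z) = edot x y + edot x z.
Proof. by rewrite edotC edotDl !(edotC x). Qed.

Lemma edotZr a x y : edot x (a *: y) = a * edot x y.
Proof. by rewrite edotC edotZl edotC. Qed.

Lemma edotNr x y : edot x (- y) = - edot x y.
Proof. by rewrite edotC edotNl edotC. Qed.

Lemma edot_ge0 x : 0 <= edot x x.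
Proof. by apply: sumr_ge0 => i _; rewrite -expr2 sqr_ge0. Qed.

Lemma edot_eq0 x : edot x x = 0 -> x = 0.
Proof.
move=> /eqP; rewrite psumr_eq0; last by move=> i _; rewrite -expr2 sqr_ge0.
move=> /allP h; apply/rowP => i; rewrite mxE; apply/eqP.
by have := h i (mem_index_enum i); rewrite /= -expr2 sqrf_eq0.
Qed.

Lemma enorm_ge0 x : 0 <= enorm x.
Proof. exact: sqrtr_ge0. Qed.

Lemma enormK x : enorm x ^+ 2 = edot x x.
Proof. by rewrite sqr_sqrtr ?edot_ge0. Qed.

Lemma enorm_eq0 x : enorm x = 0 -> x = 0.
Proof. by move=> h; apply: edot_eq0; rewrite -enormK h expr0n. Qed.

Lemma enorm0 : enorm (0 : 'rV[R]_N) = 0.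
Proof. by rewrite /enorm /edot big1 ?sqrtr0 // => i _; rewrite mxE mul0r. Qed.

Lemma enorm_distC x y : enorm (x - y) = enorm (y - x).
Proof. by rewrite /enorm -opprB edotNl edotNr opprK. Qed.

Lemma edot_le_enorm x y : edot x y <= enorm x * enorm y.
Proof.
have h : edot x y ^+ 2 <= edot x x * edot y y.
  have [y0|y0] := eqVneq (edot y y) 0.
    by rewrite (edot_eq0 y0) -[0 : 'rV_N](scale0r 0) !edotZr mul0r expr0n /= !mul0r mulr0.
  have yp : 0 < edot y y by rewrite lt_def y0 edot_ge0.
  have := edot_ge0 (edot y y *: x - edot x y *: y).
  rewrite !(edotDl, edotDr, edotNl, edotNr, edotZl, edotZr) (edotC y x).
  set a := edot x x; set b := edot y y in yp *; set c := edot x y => h.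
  have : 0 <= b * (a * b - c ^+ 2) by move: h; congr (_ <= _); ring.
  by rewrite pmulr_rge0 // subr_ge0.
have [xy0|xy0] := leP (edot x y) 0.
  by apply: (le_trans xy0); rewrite mulr_ge0 ?enorm_ge0.
rewrite -(@ler_pXn2r _ 2) // ?nnegrE ?mulr_ge0 ?enorm_ge0 ?(ltW xy0) //.
by rewrite exprMn !enormK.
Qed.

Lemma ler_enormD x y : enorm (x + y) <= enorm x + enorm y.
Proof.
rewrite -(@ler_pXn2r _ 2) // ?nnegrE ?addr_ge0 ?enorm_ge0 //.
rewrite enormK sqrrD !enormK edotDl !edotDr (edotC y x).
have := edot_le_enorm x y; lra.
Qed.

Lemma ler_enorm_trans z x y : enorm (x - y) <= enorm (x - z) + enorm (z - y).
Proof. by rewrite -[x - y](subrKA z) ler_enormD. Qed.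

Lemma norm_le_enorm x : `|x| <= enorm x.
Proof.
rewrite /Num.norm /= mx_normrE; apply: bigmax_le; first exact: enorm_ge0.
move=> [i j] _ /=; rewrite (ord1 i) -(@ler_pXn2r _ 2) // ?nnegrE ?enorm_ge0 //.
rewrite enormK /edot (bigD1 j) //= real_normK ?num_real // expr2 lerDl.
by apply: sumr_ge0 => k _; rewrite -expr2 sqr_ge0.
Qed.

Lemma enorm_le_norm x : enorm x <= N%:R * `|x|.
Proof.
rewrite -(@ler_pXn2r _ 2) // ?nnegrE ?enorm_ge0 ?mulr_ge0 //.
rewrite enormK /edot exprMn; apply: (@le_trans _ _ (\sum_(i < N) `|x| ^+ 2)).
  apply: ler_sum => i _; rewrite -expr2 -[leLHS]real_normK ?num_real //.
  rewrite ler_pXn2r ?nnegrE //.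
  rewrite {2}/Num.norm /= mx_normrE; exact: (le_bigmax _ (fun ij => `|x ij.1 ij.2|) (0, i)).
rewrite sumr_const card_ord -[leLHS]mulr_natl ler_wpM2r ?sqr_ge0 //.
by rewrite -natrX ler_nat; case: (N) => // k; rewrite expnS expn1 leq_pmulr.
Qed.

(** Normalized to fix the origin and the distances, a similitude preserves dot
    products, so the images of the unit vectors form an orthogonal matrix, and
    the inverse matrix provides the preimages. *)
Lemma similitude_surjective (T : 'rV[R]_N -> 'rV[R]_N) (c : R) : 0 < c ->
  (forall x y, enorm (T x - T y) = c * enorm (x - y)) ->
  forall y, exists x, T x = y.
Proof.
move=> c0 hT y; pose U x := c^-1 *: (T x - T 0).
have UB x z : edot (U x - U z) (U x - U z) = edot (x - z) (x - z).
  rewrite /U -scalerBr opprB addrA subrK edotZl edotZr -!enormK hT.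
  by field; rewrite gt_eqF.
have U0 : U 0 = 0 by rewrite /U subrr scaler0.
have UU x : edot (U x) (U x) = edot x x by have := UB x 0; rewrite U0 !subr0.
have Udot x z : edot (U x) (U z) = edot x z.
  have := UB x z; rewrite !(edotDl, edotDr, edotNl, edotNr) !UU.
  by rewrite (edotC (U z)) (edotC z); lra.
have dotE (a b : 'rV[R]_N) : edot a b = (a *m b^T) 0 0.
  by rewrite mxE; apply: eq_bigr => i _; rewrite mxE.
pose O := \matrix_i U (delta_mx 0 i).
have UO x : U x *m O^T = x.
  apply/rowP => i; rewrite -[RHS]mulr1.
  transitivity (edot (U x) (U (delta_mx 0 i))).
    by rewrite dotE !mxE; apply: eq_bigr => k _; rewrite !mxE.
  rewrite Udot /edot (bigD1 i) //= mxE !eqxx big1 ?addr0 // => k ki.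
  by rewrite mxE (negPf ki) andbF mulr0.
have OO : O *m O^T = 1%:M.
  apply/row_matrixP => i; rewrite row_mul rowK UO.
  by rewrite rowE mulmx1.
exists (c^-1 *: (y - T 0) *m O^T).
set x := _ *m O^T.
have : U x = c^-1 *: (y - T 0).
  have /(congr1 (mulmx^~ O)) : U x *m O^T = c^-1 *: (y - T 0) *m O^T by rewrite UO.
  by rewrite -!mulmxA (mulmx1C OO) !mulmx1.
move/(scalerI _); rewrite invr_eq0 gt_eqF // => /(_ isT).
by move/addIr.
Qed.

(** The sup norm, which carries the topology, and the Euclidean norm bound each
    other. *)
Lemma nbhs_enorm x (A : set 'rV[R]_N) :
  nbhs x A <-> exists2 e : R, 0 < e & forall y, enorm (x - y) < e -> A y.
Proof.
split=> [/nbhs_ballP[e e0 he]|[e e0 he]].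
  exists e => // y xy; apply: he; rewrite -ball_normE /=.
  exact: le_lt_trans (norm_le_enorm _) xy.
have N0 : 0 < N.+1%:R :> R by rewrite ltr0n.
apply/nbhs_ballP; exists (e / N.+1%:R); first by rewrite /= divr_gt0.
move=> y; rewrite -ball_normE /= ltr_pdivlMr // => xy; apply: he.
apply: le_lt_trans (enorm_le_norm _) _; apply: le_lt_trans xy.
by rewrite mulrC ler_wpM2l // ler_nat.
Qed.

End euclidean_norm.

(** * Cells *)

Lemma expr_lt_eps (R : realType) (x e : R) : 0 <= x < 1 -> 0 < e ->
  exists n, forall m, (n <= m)%N -> x ^+ m < e.
Proof.
move=> /andP[x0 x1] e0.
have x1' : `|x| < 1 by rewrite ger0_norm.
have /cvgrPdist_lt/(_ _ e0)[n _ hn] := cvg_expr x1'.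
exists n => m nm; have := hn m nm.
by rewrite sub0r normrN ger0_norm ?exprn_ge0.
Qed.

Lemma closed_enorm (R : realType) N (A : set 'rV[R]_N) x : closed A ->
  (forall e, 0 < e -> exists2 y, A y & enorm (x - y) < e) -> A x.
Proof.
move=> cA h; apply: cA => B /nbhs_enorm[e e0 he].
by have [y Ay xy] := h e e0; exists y; split => //; exact: he.
Qed.

Lemma open_borel (R : realType) N (A : set 'rV[R]_N) :
  open A -> measurable (A : set (borelRV R N)).
Proof. by move=> oA; exact: sub_sigma_algebra. Qed.

Lemma closed_borel (R : realType) N (A : set 'rV[R]_N) :
  closed A -> measurable (A : set (borelRV R N)).
Proof.
move=> cA; rewrite -[A]setCK; apply: measurableC.
by apply: open_borel; exact: closed_openC.
Qed.

Lemma set1_borel (R : realType) N (x : 'rV[R]_N) :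
  measurable ([set x] : set (borelRV R N)).
Proof.
apply: closed_borel; apply: compact_closed; last exact: compact_set1.
exact: norm_hausdorff.
Qed.

Lemma countable_borel (R : realType) N (A : set 'rV[R]_N) :
  countable A -> measurable (A : set (borelRV R N)).
Proof.
by move=> cA; apply: countable_measurable => // x; exact: set1_borel.
Qed.

Section cells.
Context {R : realType}.
Variable F : nestedFractal R.
Local Notation T := 'rV[R]_(nfN F).
Local Notation M := (nfM F).
Local Notation K := (nfK F).
Local Notation V0 := (nfV0 F).
Local Notation phi_ := (word_map (nfphi F)).
Local Notation l := ((nfL F)^-1).
Implicit Types (u v w : seq 'I_M) (x y : T).

Lemma ratio_itv : 0 < l < 1.
Proof.
by rewrite invr_gt0 (lt_trans ltr01) ?nfL_gt1 //= invf_lt1 ?nfL_gt1 // (lt_trans ltr01) ?nfL_gt1.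
Qed.

Lemma ratio_gt0 : 0 < l. Proof. by case/andP: ratio_itv. Qed.

Lemma ratioX_gt0 m : 0 < l ^+ m. Proof. by rewrite exprn_gt0 ?ratio_gt0. Qed.

Lemma ratio_lt_eps e : 0 < e -> exists n, forall m, (n <= m)%N -> l ^+ m < e.
Proof. by apply: expr_lt_eps; case/andP: ratio_itv => /ltW-> ->. Qed.

Lemma word_map_cat u v x : phi_ (u ++ v) x = phi_ u (phi_ v x).
Proof. by elim: u => //= i u ->. Qed.

Lemma word_map_rcons u i x : phi_ (rcons u i) x = phi_ u (nfphi F i x).
Proof. by rewrite -cats1 word_map_cat. Qed.

Lemma word_map_dist w x y :
  enorm (phi_ w x - phi_ w y) = l ^+ size w * enorm (x - y).
Proof.
elim: w => [|i w IH] /=; first by rewrite expr0 mul1r.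
by rewrite nf_similitude IH mulrA -exprS.
Qed.

Lemma word_map_inj w : injective (phi_ w).
Proof.
move=> x y xy; apply/eqP; rewrite -subr_eq0; apply/eqP/enorm_eq0.
have := word_map_dist w x y; rewrite xy subrr enorm0 => /esym/eqP.
by rewrite mulf_eq0 gt_eqF ?ratioX_gt0 //= => /eqP.
Qed.

Lemma word_map_surj w y : exists x, phi_ w x = y.
Proof.
by apply: (similitude_surjective (ratioX_gt0 (size w))) => ? ?; exact: word_map_dist.
Qed.

Lemma word_map_continuous w : continuous (phi_ w).
Proof.
move=> x A /= /nbhs_enorm[e e0 he]; apply/nbhs_enorm.
exists (e / l ^+ size w); first by rewrite divr_gt0 ?ratioX_gt0.
move=> y; rewrite ltr_pdivlMr ?ratioX_gt0 // mulrC => xy.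
by apply: he; rewrite word_map_dist.
Qed.

Lemma cell_compact w : compact (cell w).
Proof.
apply: continuous_compact; last exact: nf_compact.
by apply: continuous_subspaceT => x; exact: word_map_continuous.
Qed.

Lemma cell_closed w : closed (cell w).
Proof. by apply: (compact_closed _ (@cell_compact w)); exact: norm_hausdorff. Qed.

Lemma cell_nil : cell [::] = K.
Proof. by rewrite /cell /= image_id. Qed.

Lemma K_closed : closed K.
Proof. by rewrite -cell_nil; exact: cell_closed. Qed.

Lemma measurable_cell w : measurable (cell w : set (borelRV R (nfN F))).
Proof. by apply: closed_borel; exact: cell_closed. Qed.

Lemma measurable_K : measurable (K : set (borelRV R (nfN F))).
Proof. by rewrite -cell_nil; exact: measurable_cell. Qed.

Lemma phi_K i x : K x -> K (nfphi F i x).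
Proof. by move=> Kx; rewrite nf_selfsimilar; exists i => //; exists x. Qed.

Lemma word_map_K w x : K x -> K (phi_ w x).
Proof. by elim: w => //= i w IH Kx; exact: phi_K (IH Kx). Qed.

Lemma cell_sub_K w : cell w `<=` K.
Proof. by move=> _ [x Kx <-]; exact: word_map_K. Qed.

Lemma cell_cat_sub u v : cell (u ++ v) `<=` cell u.
Proof.
by move=> _ [x Kx <-]; rewrite word_map_cat; exists (phi_ v x) => //; exact: word_map_K.
Qed.

Lemma cell_catP u v x : cell (u ++ v) (phi_ u x) <-> cell v x.
Proof.
split=> [[y Ky]|[y Ky <-]]; last by exists y; rewrite ?word_map_cat.
by rewrite word_map_cat => /word_map_inj <-; exists y.
Qed.

Lemma cell_split w x : cell w x -> exists i, cell (rcons w i) x.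
Proof.
move=> [y Ky <-]; move: Ky; rewrite {1}nf_selfsimilar => -[i _ [z Kz <-]].
by exists i; exists z; rewrite ?word_map_rcons.
Qed.

Lemma cell_refine w m x : cell w x -> exists u : m.-tuple 'I_M, cell (w ++ u) x.
Proof.
move=> wx; elim: m => [|m [u ux]]; first by exists [tuple]; rewrite cats0.
have [i ix] := cell_split ux; exists [tuple of rcons u i].
by rewrite /= -rcons_cat.
Qed.

Lemma K_cell m x : K x -> exists u : m.-tuple 'I_M, cell u x.
Proof. by rewrite -cell_nil => /(cell_refine m)[u]; exists u. Qed.

Lemma address_exists x : K x -> exists w : nat -> 'I_M, is_address x w.
Proof.
move=> Kx.
have /choice[f hf] : forall w, exists i, cell w x -> cell (rcons w i) x.
  move=> w; have [wx|nwx] := pselect (cell w x).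
    by have [i ix] := cell_split wx; exists i.
  by exists (Ordinal (ltnW (nfM_ge2 F))) => /nwx.
pose s := fix s n := if n is n'.+1 then rcons (s n') (f (s n')) else [::].
exists (fun n => f (s n)).
have sE m : mkseq (fun n => f (s n)) m = s m.
  by elim: m => [//|m IH]; rewrite mkseqS IH.
move=> m; rewrite sE; elim: m => [|m IH] /=; first by rewrite cell_nil.
exact: hf.
Qed.

Lemma K_dist x y : K x -> K y -> enorm (x - y) <= 1.
Proof.
move=> Kx Ky; rewrite -lee_fin -(nf_diam F).
by apply: ereal_sup_ubound; right; exists x, y.
Qed.

Lemma cell_dist w x y : cell w x -> cell w y -> enorm (x - y) <= l ^+ size w.
Proof.
move=> [a Ka <-] [b Kb <-]; rewrite word_map_dist ler_piMr ?(ltW (ratioX_gt0 _)) //.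
exact: K_dist.
Qed.

Lemma diam_image_word w (A : set T) :
  diam (phi_ w @` A) = ((l ^+ size w)%:E * diam A)%E.
Proof.
have l0 := ratioX_gt0 (size w).
apply/eqP; rewrite eq_le; apply/andP; split.
  apply: ge_ereal_sup => z [->|[_ [_ [[a Aa <-] [b Ab <-] ->]]]].
    rewrite mule_ge0 ?lee_fin ?(ltW l0) //.
    by apply: ereal_sup_ubound; left.
  rewrite word_map_dist EFinM lee_pmul2l ?lte_fin //.
  by apply: ereal_sup_ubound; right; exists a, b.
rewrite -lee_pdivlMl //; apply: ge_ereal_sup => z [->|[a [b [Aa Ab ->]]]].
  rewrite mule_ge0 ?lee_fin ?invr_ge0 ?(ltW l0) //.
  by apply: ereal_sup_ubound; left.
rewrite lee_pdivlMl // -EFinM -word_map_dist.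
apply: ereal_sup_ubound; right.
by exists (phi_ w a), (phi_ w b); split; [exists a|exists b|].
Qed.

Lemma diam_cell w : diam (cell w) = (l ^+ size w)%:E.
Proof. by rewrite diam_image_word nf_diam mule1. Qed.

(** Iterating a contraction from any point of the closed set [K] leads to its
    fixed point. *)
Lemma fixpoint_in_K i x : nfphi F i x = x -> K x.
Proof.
move=> ix; have [y Ky] := nf_nonempty F.
apply: (closed_enorm K_closed) => e e0.
have d0 : 0 < enorm (x - y) + 1 by rewrite ltr_pwDr ?enorm_ge0.
have [n hn] := ratio_lt_eps (divr_gt0 e0 d0).
exists (phi_ (nseq n i) y); first exact: word_map_K.
have {1}<- : phi_ (nseq n i) x = x by elim: n {hn} => //= n ->.
rewrite word_map_dist size_nseq.
apply: (@le_lt_trans _ _ (l ^+ n * (enorm (x - y) + 1))).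
  by rewrite ler_wpM2l ?(ltW (ratioX_gt0 _)) // lerDl.
by rewrite -ltr_pdivlMr // hn.
Qed.

Lemma V0_fixpoint x : V0 x -> exists i, nfphi F i x = x.
Proof. by move=> [i [j [k [m [y [ix _ _ _]]]]]]; exists i. Qed.

Lemma V0_sub_K : V0 `<=` K.
Proof. by move=> x /V0_fixpoint[i]; exact: fixpoint_in_K. Qed.

(** The enumeration of an infinite set is empty by convention, so a cardinality
    at least 2 forces finiteness. *)
Lemma V0_finite : finite_set V0.
Proof.
apply: contrapT => nf; have := nf_card_V0 F.
by rewrite /fset_set; case: pselect.
Qed.

Lemma V0_nonempty : V0 !=set0.
Proof.
have := nf_card_V0 F; case/boolP: (fset_set (nfV0 F) == fset0) => [/eqP->//|].
case/fset0Pn => x xV _; exists x.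
by move: xV; rewrite in_fset_set ?inE //; exact: V0_finite.
Qed.

End cells.

(** * Packing of cells *)

Section packing.
Context {R : realType}.
Variable F : nestedFractal R.
Local Notation T := 'rV[R]_(nfN F).
Local Notation M := (nfM F).
Local Notation K := (nfK F).
Local Notation phi_ := (word_map (nfphi F)).
Local Notation l := ((nfL F)^-1).
Implicit Types (u v w : seq 'I_M) (x y : T).

(** The open set condition extends from letters to words by peeling off the
    first letters one at a time. *)
Lemma open_set_words_disjoint (U : set T) :
    Phi (nfphi F) U `<=` U ->
    (forall i j, i <> j -> (nfphi F i @` U) `&` (nfphi F j @` U) = set0) ->
  forall v w p q, size v = size w -> U p -> U q -> phi_ v p = phi_ w q -> v = w.
Proof.
move=> US Udisj.
have wU w p : U p -> U (phi_ w p).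
  by move=> Up; elim: w => //= i w IH; apply: US; exists i => //; exists (phi_ w p).
elim=> [|i v IH] [|j w] //= p q [vw] Up Uq e.
have ij : i = j.
  apply: contrapT => ij; have := Udisj _ _ ij.
  rewrite -subset0 => /(_ (nfphi F i (phi_ v p))); apply; split.
    by exists (phi_ v p) => //; exact: wU.
  by rewrite e; exists (phi_ w q) => //; exact: wU.
subst j; congr cons; apply: (IH _ p q) => //.
exact: (@word_map_inj R F [:: i]).
Qed.

Definition near_words m x (n : nat) : pred (n.-tuple 'I_M) :=
  [pred w : n.-tuple 'I_M | `[< (exists2 y, cell w y & enorm (y - x) <= 2 * l ^+ m)%R >]].

(** The open set condition makes the images of one point of the open set
    under words of length [m] uniformly separated at scale [L^-m], so a grid of
    that scale bounds how many [m]-cells come near a given point. *)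
Lemma cell_packing : exists c : nat, forall m x0,
  (#|@near_words m x0 m| <= c)%N.
Proof.
have [U [oU [a Ua] US Udisj]] := nf_open_set F.
have [e e0 he] : exists2 e : R, 0 < e & forall y, enorm (a - y) < e -> U y.
  exact: (iffLR (nbhs_enorm a U) (open_nbhs_nbhs (conj oU Ua))).
have sep m (v w : m.-tuple 'I_M) :
    enorm (phi_ v a - phi_ w a) < e * l ^+ m -> v = w.
  have [q qE] := word_map_surj v (phi_ w a).
  rewrite -qE word_map_dist size_tuple mulrC ltr_pM2r ?ratioX_gt0 // => /he Uq.
  apply/val_inj/(open_set_words_disjoint US Udisj _ Uq Ua qE).
  by rewrite !size_tuple.
have [k0 Kk0] := nf_nonempty F.
(* 1 for the diameter of the fractal and 2 for the radius of the ball *)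
pose r := enorm (a - k0) + 3.
have r0 : 0 < r by rewrite ltr_wpDl ?enorm_ge0.
pose d := e / (nfN F).+1%:R.
have d0 : 0 < d by rewrite divr_gt0.
pose B := Num.truncn (2 * r / d).
exists #|{ffun 'I_(nfN F) -> 'I_B.+1}| => m x0.
set A := @near_words m x0 m.
have lm0 := ratioX_gt0 F m.
pose c (w : m.-tuple 'I_M) i := ((phi_ w a - x0) 0 i + r * l ^+ m) / (d * l ^+ m).
pose code (w : m.-tuple 'I_M) := [ffun i => inord (Num.truncn (c w i)) : 'I_B.+1].
have cbound (w : m.-tuple 'I_M) i : w \in A -> 0 <= c w i <= 2 * r / d.
  rewrite inE => -[y [k Kk <-] yx].
  have hE : enorm (phi_ w a - x0) <= r * l ^+ m.
    apply: (le_trans (ler_enorm_trans (phi_ w k) _ _)).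
    rewrite word_map_dist size_tuple.
    have : enorm (a - k) <= enorm (a - k0) + 1.
      apply: (le_trans (ler_enorm_trans k0 _ _)).
      by rewrite lerD2l; exact: K_dist.
    by rewrite -(ler_pM2l lm0) /r; move: yx; set z := l ^+ m; lra.
  have : `|(phi_ w a - x0) 0 i| <= r * l ^+ m.
    apply: le_trans hE; apply: le_trans (norm_le_enorm _).
    rewrite {2}/Num.norm /= mx_normrE.
    exact: (le_bigmax _ (fun ij => `|(phi_ w a - x0) ij.1 ij.2|) (0, i)).
  rewrite ler_norml /c; move: ((phi_ w a - x0) 0 i : R) => t /andP[t1 t2].
  apply/andP; split.
    by apply: divr_ge0; [lra|rewrite mulr_ge0 ?(ltW d0) ?(ltW lm0)].
  rewrite ler_pdivrMr ?mulr_gt0 //.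
  have -> : 2 * r / d * (d * l ^+ m) = 2 * (r * l ^+ m) by field; rewrite gt_eqF.
  lra.
apply: (@leq_card_in _ _ code) => v w vA wA vw; apply: sep.
have coord i : `|(phi_ v a - phi_ w a) 0 i| <= d * l ^+ m.
  have /andP[v0 v1] := cbound v i vA; have /andP[w0 w1] := cbound w i wA.
  have tvw : Num.truncn (c v i) = Num.truncn (c w i).
    have /(congr1 val) : code v i = code w i by rewrite vw.
    rewrite /code !ffunE /= !inordK // ltnS; exact: le_truncn.
  have /andP[v2 v3] := truncn_itv v0; have /andP[w2 w3] := truncn_itv w0.
  rewrite tvw in v2 v3.
  have dl : 0 < d * l ^+ m by rewrite mulr_gt0.
  have -> : (phi_ v a - phi_ w a) 0 i = (c v i - c w i) * (d * l ^+ m).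
    by rewrite /c !mxE; field; rewrite !gt_eqF.
  rewrite normrM (gtr0_norm dl) ler_piMl ?(ltW dl) //.
  by rewrite -natr1 in v3 w3; rewrite ler_norml; lra.
apply: (le_lt_trans (enorm_le_norm _)).
apply: (@le_lt_trans _ _ ((nfN F)%:R * (d * l ^+ m))).
  apply: ler_wpM2l => //; rewrite {1}/Num.norm /= mx_normrE.
  apply: bigmax_le => [|[j i] _]; first by rewrite mulr_ge0 ?ltW.
  by rewrite (ord1 j); exact: coord.
rewrite mulrA ltr_pM2r // /d mulrC -mulrA gtr_pMr //.
by rewrite ltr_pdivrMl // mulr1 ltr_nat.
Qed.

End packing.

(** * Hausdorff measure of the fractal *)

Section hausdorff_dimension.
Context {R : realType}.
Variable F : nestedFractal R.
Local Notation T := 'rV[R]_(nfN F).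
Local Notation M := (nfM F).
Local Notation K := (nfK F).
Local Notation phi_ := (word_map (nfphi F)).
Local Notation l := ((nfL F)^-1).
Local Notation d := (hdim F).
Implicit Types (u v w : seq 'I_M) (x y : T).

Lemma M_gt0 : 0 < M%:R :> R.
Proof. by rewrite ltr0n; exact: ltnW (nfM_ge2 F). Qed.

Lemma lnL_gt0 : 0 < ln (nfL F).
Proof. by rewrite ln_gt0 // nfL_gt1. Qed.

Lemma hdim_gt0 : 0 < d.
Proof. by rewrite divr_gt0 ?lnL_gt0 // ln_gt0 // ltr1n nfM_ge2. Qed.

Lemma L_powR_ln a : 0 < a -> nfL F `^ (ln a / ln (nfL F)) = a.
Proof.
move=> a0; have L0 : 0 < nfL F by rewrite (lt_trans ltr01) ?nfL_gt1.
by rewrite /powR gt_eqF // divfK ?gt_eqF ?lnL_gt0 // lnK.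
Qed.

Lemma ratioX_powR m a : (l ^+ m) `^ a = ((nfL F `^ a) ^+ m)^-1.
Proof.
have L0 : 0 < nfL F by rewrite (lt_trans ltr01) ?nfL_gt1.
rewrite exprVn -(powR_invn _ (ltW L0)) -(powR_invn _ (powR_ge0 _ _)).
by rewrite -!powRrM mulrC.
Qed.

Lemma ratioX_powR_hdim m : (l ^+ m) `^ d = (M%:R ^+ m)^-1.
Proof. by rewrite ratioX_powR L_powR_ln ?M_gt0. Qed.

(** A long word whose cell comes near a point starts with a shorter word with
    the same property. *)
Lemma card_near_words c m n x :
  (#|@near_words R F m x m| <= c)%N -> (m <= n)%N ->
  (#|@near_words R F m x n| <= c * M ^ (n - m))%N.
Proof.
move=> hc mn; have [k nk] : exists k, n = (m + k)%N by exists (n - m)%N; rewrite subnKC.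
subst n; rewrite addKn.
pose A := [predX @near_words R F m x m & {: k.-tuple 'I_M}].
apply: (@leq_trans #|A|); last first.
  by rewrite /A cardX leq_mul // cardT -cardE card_tuple card_ord.
apply: (@leq_trans #|[set cat_tuple p.1 p.2 | p in A]%SET|); last exact: leq_imset_card.
apply: subset_leq_card; apply/fintype.subsetP => w.
rewrite inE => -[y wy yx].
have s1 : size (take m w) == m by rewrite size_takel ?size_tuple ?leq_addr.
have s2 : size (drop m w) == k by rewrite size_drop size_tuple addKn.
apply/imsetP; exists (Tuple s1, Tuple s2); last first.
  by apply: val_inj; rewrite /= cat_take_drop.
rewrite inE andbT /= inE; exists y => //.
by move: wy; rewrite -{1}(cat_take_drop m w); exact: cell_cat_sub.
Qed.

(** Count the cells of a generation finer than all the radii: each of them comes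
    near the centre of some ball, and a ball accounts for at most a number of
    cells proportional to its [d]-dimensional content. *)
Lemma ball_cover_lower_bound c n (m : nat -> nat) (x : nat -> T) :
  (forall k z, (#|@near_words R F k z k| <= c)%N) ->
  (forall y, K y -> exists2 i, (i < n)%N & enorm (y - x i) <= 2 * l ^+ m i) ->
  1 <= c%:R * \sum_(i < n) (M%:R ^+ m i)^-1 :> R.
Proof.
move=> hc cover; pose N := \max_(i < n) m i.
have mN (i : 'I_n) : (m i <= N)%N by exact: (leq_bigmax i).
have : (M ^ N <= \sum_(i < n) #|@near_words R F (m i) (x i) N|)%N.
  have <- : #|{: N.-tuple 'I_M}| = (M ^ N)%N by rewrite card_tuple card_ord.
  rewrite -sum1_card.
  apply: (@leq_trans (\sum_(w : N.-tuple 'I_M) \sum_(i < n | w \in @near_words R F (m i) (x i) N) 1)%N).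
    apply: leq_sum => w _; have [k0 Kk0] := nf_nonempty F.
    have [i ni hi] := cover _ (word_map_K w Kk0).
    rewrite (bigD1 (Ordinal ni)) //= inE.
    by exists (phi_ w k0) => //; exists k0.
  rewrite (exchange_big_dep xpredT) //=; apply: leq_sum => i _.
  by rewrite sum1_card.
move=> hN; have {hN} : (M ^ N <= \sum_(i < n) c * M ^ (N - m i))%N.
  by apply: leq_trans hN _; apply: leq_sum => i _; exact: card_near_words.
rewrite -(@ler_nat R) natr_sum natrX.
have MN0 : 0 < M%:R ^+ N :> R by rewrite exprn_gt0 ?M_gt0.
rewrite -{1}[_ ^+ N]mulr1 -ler_pdivlMl //; congr (_ <= _).
rewrite !mulr_sumr; apply: eq_bigr => i _.
rewrite natrM natrX mulrCA; congr (_ * _).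
by rewrite -{1}(subnK (mN i)) exprD; field; rewrite !gt_eqF ?exprn_gt0 ?M_gt0.
Qed.

(** A set of diameter [t] is enclosed in a ball of radius comparable with [t];
    when [t] is 0 the radius is taken so small that its content is
    negligible. *)
Lemma scale_of_diam t e : 0 <= t <= l -> 0 < e ->
  exists m : nat, t < l ^+ m /\ (M%:R ^+ m)^-1 <= M%:R * t `^ d + e.
Proof.
move=> /andP[t0 tl] e0; have [t00|tn0] := eqVneq t 0.
  have M1 : 0 <= (M%:R^-1 : R) < 1.
    by rewrite invr_ge0 ler0n invf_lt1 ?M_gt0 // ltr1n nfM_ge2.
  have [n hn] := expr_lt_eps M1 e0.
  exists n; rewrite t00 ratioX_gt0; split=> //.
  by rewrite powR0 ?gt_eqF ?hdim_gt0 // mulr0 add0r -exprVn ltW // hn.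
have tp : 0 < t by rewrite lt_def tn0.
have ex : exists m, (l ^+ m.+1 <= t).
  have [n hn] := ratio_lt_eps F tp; exists n; rewrite ltW // hn //.
case: (ex_minnP ex) => m hm mmin; exists m; split.
  case: m hm mmin => [|m] hm mmin.
    by apply: le_lt_trans tl _; rewrite expr0; case/andP: (ratio_itv F).
  by rewrite ltNge; apply/negP => /mmin; rewrite ltnn.
apply: (@le_trans _ _ (M%:R * t `^ d)); last by rewrite lerDl ltW.
have -> : (M%:R ^+ m)^-1 = M%:R * (M%:R ^+ m.+1)^-1 :> R.
  by rewrite exprS; field; rewrite !gt_eqF ?exprn_gt0 ?M_gt0.
rewrite ler_wpM2l ?ler0n // -ratioX_powR_hdim ge0_ler_powR ?nnegrE ?(ltW hdim_gt0) //.
exact: ltW (ratioX_gt0 _ _).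
Qed.

Lemma diam_ge0 (A : set T) : (0 <= diam A)%E.
Proof. by apply: ereal_sup_ubound; left. Qed.

Lemma enorm_le_diam (A : set T) x y : A x -> A y -> ((enorm (x - y))%:E <= diam A)%E.
Proof. by move=> Ax Ay; apply: ereal_sup_ubound; right; exists x, y. Qed.

Lemma open_enorm_ball x (r : R) : open [set y | enorm (y - x) < r].
Proof.
rewrite openE => y /= yr; apply/nbhs_enorm; exists (r - enorm (y - x)).
  by rewrite subr_gt0.
move=> z yz /=; apply: le_lt_trans (ler_enorm_trans y _ _) _.
by rewrite (enorm_distC z); lra.
Qed.

Lemma sum_expr_half n : \sum_(i < n) 2^-1 ^+ i.+1 <= 1 :> R.
Proof.
suff -> : \sum_(i < n) 2^-1 ^+ i.+1 = 1 - 2^-1 ^+ n :> R.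
  by rewrite gerBl exprn_ge0.
by elim: n => [|n IH]; rewrite ?big_ord0 ?subrr // big_ord_recr /= IH exprS; lra.
Qed.

(** The sets of a cover are enlarged to open balls of comparable radii, so that
    compactness extracts a finite subcover, to which
    [ball_cover_lower_bound] applies. *)
Lemma hausdorff_K_gt0 : (0 < hausdorff d K)%E.
Proof.
have [c0 hc0] := cell_packing F.
pose c := c0.+1.
have hc k z : (#|@near_words R F k z k| <= c)%N by apply: leq_trans (hc0 k z) _; exact: leqnSn.
have c_gt0 : 0 < c%:R :> R by rewrite ltr0n.
have M0 := M_gt0.
pose b := (2 * c%:R * M%:R)^-1 : R.
have b0 : 0 < b by rewrite invr_gt0 !mulr_gt0.
have lgt0 := ratio_gt0 F.
apply: (@lt_le_trans _ _ b%:E); first by rewrite lte_fin.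
apply: (@le_trans _ _ (hausdorff_pre d l K)); last first.
  by apply: ereal_sup_ubound; exists l.
apply: le_ereal_inf_tmp => _ [U [KU Ul ->]].
have fU i : diam (U i) \is a fin_num.
  by rewrite ge0_fin_numE ?diam_ge0 // (le_lt_trans (Ul i)) ?ltry.
pose t i := fine (diam (U i)).
have tE i : diam (U i) = (t i)%:E by rewrite /t fineK.
(* the total error allowed to the sets of zero diameter: it uses up half of
   the lower bound [1 / c] *)
pose e := (2 * c%:R)^-1 : R.
have e0 : 0 < e by rewrite invr_gt0 mulr_gt0.
have /choice[m hm] : forall i, exists m,
    t i < l ^+ m /\ (M%:R ^+ m)^-1 <= M%:R * t i `^ d + e * 2^-1 ^+ i.+1.
  move=> i; apply: scale_of_diam; last by rewrite mulr_gt0 // exprn_gt0 // invr_gt0.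
  by rewrite -!lee_fin -tE diam_ge0 Ul.
have /choice[x hx] : forall i, exists x, U i !=set0 -> U i x.
  by move=> i; have [[x Ux]|n0] := pselect (U i !=set0); [exists x|exists 0].
have Uball i y : U i y -> enorm (y - x i) < 2 * l ^+ m i.
  move=> Uy; have Ux : U i (x i) by apply: hx; exists y.
  have := enorm_le_diam Uy Ux; rewrite tE lee_fin => /le_lt_trans; apply.
  have [+ _] := hm i => /lt_le_trans; apply.
  by rewrite mulr_natl mulr2n lerDl ltW // ratioX_gt0.
have [D DN Dcov] : finite_subset_cover [set: nat]
    (fun i => [set y | enorm (y - x i) < 2 * l ^+ m i]) K.
  have := @nf_compact _ F; rewrite compact_cover; apply.
    by move=> i _; exact: open_enorm_ball.
  by move=> y /KU[i _ Uy]; exists i => //; exact: Uball.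
pose n := (\max_(i <- enum_fset D) i).+1.
have := @ball_cover_lower_bound c n m x hc.
have cov y : K y -> exists2 i, (i < n)%N & enorm (y - x i) <= 2 * l ^+ m i.
  move=> /Dcov[i Di yi]; exists i; last exact: ltW.
  rewrite /n ltnS; apply: (leq_bigmax_seq i) => //.
move=> /(_ cov) h1.
have h2 : \sum_(i < n) (M%:R ^+ m i)^-1 <= M%:R * (\sum_(i < n) t i `^ d) + e.
  apply: (@le_trans _ _ (\sum_(i < n) (M%:R * t i `^ d + e * 2^-1 ^+ i.+1))).
    by apply: ler_sum => i _; have [_] := hm i.
  rewrite big_split /= -!mulr_sumr lerD2l ger_pMr //; exact: sum_expr_half.
apply: (@le_trans _ _ (\sum_(0 <= i < n) diam (U i) `^ d)%E); last first.
  by apply: nneseries_lim_ge => i _ _; exact: poweR_ge0.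
rewrite big_mkord (eq_bigr (fun i : 'I_n => (t i `^ d)%:E)); last by move=> i _; rewrite tE.
rewrite sumEFin lee_fin.
have h3 : 1 <= c%:R * (M%:R * (\sum_(i < n) t i `^ d) + e).
  by apply: le_trans h1 _; rewrite ler_pM2l.
rewrite /b; clear b b0.
have : c%:R * e = 2^-1 by rewrite /e; field; rewrite gt_eqF.
rewrite mulrDr in h3; set S := \sum_(_ < _) _ in h3 *.
move=> ce; rewrite ce in h3.
rewrite -[_^-1]mulr1 ler_pdivrMl ?mulr_gt0 // -!mulrA; lra.
Qed.

Lemma poweR_diam_image w (A : set T) :
  (diam (phi_ w @` A) `^ d = ((M%:R ^+ size w)^-1)%:E * diam A `^ d)%E.
Proof.
rewrite diam_image_word poweRM ?diam_ge0 ?lee_fin ?(ltW (ratioX_gt0 _ _)) //.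
by rewrite poweR_EFin ratioX_powR_hdim.
Qed.

Lemma hausdorff_image_le w (A : set T) :
  (hausdorff d (phi_ w @` A) <= ((M%:R ^+ size w)^-1)%:E * hausdorff d A)%E.
Proof.
have b0 : 0 < M%:R ^+ size w :> R by rewrite exprn_gt0 ?M_gt0.
apply: ge_ereal_sup => _ [e e0 <-]; rewrite -lee_pdivrMl ?invr_gt0 // invrK.
apply: (@le_trans _ _ (hausdorff_pre d (e / l ^+ size w) A)); last first.
  by apply: ereal_sup_ubound; exists (e / l ^+ size w) => //=; rewrite divr_gt0 ?ratioX_gt0.
apply: le_ereal_inf_tmp => _ [U [AU Ue ->]].
rewrite -lee_pdivlMl //.
apply: ereal_inf_lbound; exists (fun i => phi_ w @` U i); split.
- by move=> _ [a /AU[i _ Ui] <-]; exists i => //; exists a.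
- move=> i; rewrite diam_image_word.
  rewrite -lee_pdivlMl ?ratioX_gt0 //; apply: le_trans (Ue i) _.
  by rewrite -EFinM lee_fin mulrC.
rewrite -nneseriesZl; last by move=> i _; exact: poweR_ge0.
by apply: eq_eseriesr => i _; rewrite poweR_diam_image.
Qed.

(** The cells of one generation form a cover whose [d]-dimensional content is
    exactly 1. *)
Lemma hausdorff_K_le1 : (hausdorff d K <= 1)%E.
Proof.
apply: ge_ereal_sup => _ [e /= e0 <-]; have [m hm] := ratio_lt_eps F e0.
have {}hm := ltW (hm m (leqnn _)).
pose s := [seq cell w | w : m.-tuple 'I_M].
have ss : size s = (M ^ m)%N by rewrite size_map -cardE card_tuple card_ord.
have diam0 : diam (set0 : set T) = 0%E.
  apply/eqP; rewrite eq_le diam_ge0 andbT.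
  by apply: ge_ereal_sup => z [->|[a [b []]]].
have sdiam i : (i < M ^ m)%N -> diam (nth set0 s i) = (l ^+ m)%:E.
  rewrite -ss => si; have /mapP[w _ ->] := mem_nth set0 si.
  by rewrite diam_cell size_tuple.
apply: ereal_inf_lbound; exists (nth set0 s); split.
- move=> x /(K_cell m)[w wx].
  exists (index (cell w) s) => //; rewrite nth_index //.
  by apply/mapP; exists w => //; rewrite mem_enum.
- move=> i; have [im|im] := ltnP i (M ^ m); first by rewrite sdiam // lee_fin.
  by rewrite nth_default ?ss // diam0 lee_fin ltW.
rewrite (@nneseries_split _ _ 0 (M ^ m)); last by move=> k _; exact: poweR_ge0.
rewrite add0n eseries0 ?adde0; last first.
  by move=> i im _; rewrite nth_default ?ss // diam0 poweR0r // gt_eqF ?hdim_gt0.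
rewrite big_mkord (eq_bigr (fun=> ((M%:R ^+ m)^-1)%:E)); last first.
  by move=> i _; rewrite sdiam // poweR_EFin ratioX_powR_hdim.
rewrite sumEFin sumr_const card_ord; congr EFin.
by rewrite -[RHS]mulr_natl natrX divff // gt_eqF ?exprn_gt0 ?M_gt0.
Qed.

End hausdorff_dimension.

(** * Vertices and addresses *)

Section vertices.
Context {R : realType}.
Variable F : nestedFractal R.
Local Notation T := 'rV[R]_(nfN F).
Local Notation M := (nfM F).
Local Notation K := (nfK F).
Local Notation V0 := (nfV0 F).
Local Notation phi_ := (word_map (nfphi F)).
Local Notation l := ((nfL F)^-1).
Local Notation Vinf := (@Vinf R F).
Implicit Types (u v w : seq 'I_M) (x y : T).

(** Substituting a cover by cells into itself. *)
Lemma cover_words_pow (A : seq (seq 'I_M)) m :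
  (forall u, u \in A -> size u = m) ->
  (forall x, K x -> exists2 u, u \in A & cell u x) ->
  forall j, exists s : seq (seq 'I_M), [/\ size s = (size A ^ j)%N,
    forall u, u \in s -> size u = (j * m)%N &
    forall x, K x -> exists2 u, u \in s & cell u x].
Proof.
move=> Am Acov; elim=> [|j [s [ss sm scov]]].
  exists [:: [::]]; split=> // [u|x Kx]; first by rewrite inE => /eqP->.
  by exists [::]; rewrite ?inE // cell_nil.
exists [seq u ++ t | u <- s, t <- A]; split.
- by rewrite size_allpairs ss expnSr.
- move=> _ /allpairsP[[u t] /= [us tA ->]].
  by rewrite size_cat sm // Am // mulSn addnC.
- move=> x /scov[u us [y Ky <-]]; have [t tA yt] := Acov _ Ky.
  exists (u ++ t); last exact/cell_catP.
  by apply/allpairsP; exists (u, t).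
Qed.

(** If two words of the same length had the same cell, one of them could be
    dropped at each generation; the remaining cells would be too few to cover
    the fractal with positive [d]-dimensional content. *)
Lemma cell_inj v w : size v = size w -> cell v = cell w -> v = w.
Proof.
move=> vw cvw; apply: contrapT => nvw.
pose m := size v.
have M0 := M_gt0 F.
pose A := [seq tval t | t <- [seq t <- enum {: m.-tuple 'I_M} | tval t != v]].
have sA : size A = (M ^ m).-1.
  rewrite size_map size_filter.
  pose isv (t : m.-tuple 'I_M) := tval t == v.
  have := count_predC isv (enum {: m.-tuple 'I_M}).
  rewrite -cardE card_tuple card_ord => <-.
  rewrite (@eq_count _ isv (pred1 (in_tuple v))); last by move=> t; rewrite /= -val_eqE.
  by rewrite count_uniq_mem ?enum_uniq // mem_enum.
have Am u : u \in A -> size u = m by move=> /mapP[t _ ->]; rewrite size_tuple.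
have Acov x : K x -> exists2 u, u \in A & cell u x.
  move=> /(K_cell m)[u ux]; have [uv|uv] := eqVneq (tval u) v.
    exists w; last by rewrite -cvw -uv.
    apply/mapP; have sw : size w == m by rewrite -vw.
    exists (Tuple sw) => //; rewrite mem_filter mem_enum andbT /=.
    by apply/eqP => /esym.
  by exists (tval u) => //; apply/mapP; exists u => //; rewrite mem_filter uv mem_enum.
have [c hc] := cell_packing F.
pose q : R := (M ^ m).-1%:R / (M ^ m)%:R.
have Mm : (0 < M ^ m)%N by rewrite expn_gt0 (ltnW (nfM_ge2 F)).
have q01 : 0 <= q < 1.
  rewrite divr_ge0 // ltr_pdivrMr ?ltr0n // mul1r ltr_nat.
  by rewrite /= prednK.
have e0 : 0 < c.+1%:R^-1 :> R by rewrite invr_gt0.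
have [j hj] := expr_lt_eps q01 e0; have {}hj := hj j (leqnn j).
have [s [ss sm scov]] := cover_words_pow Am Acov j.
have [k0 Kk0] := nf_nonempty F.
have near_cell y : K y ->
    exists2 i, (i < size s)%N & enorm (y - phi_ (nth [::] s i) k0) <= 2 * l ^+ (j * m).
  move=> /scov[u us uy]; exists (index u s); first by rewrite index_mem.
  rewrite nth_index //; have := @cell_dist _ _ u y (phi_ u k0) uy.
  move=> /(_ (ex_intro2 _ _ k0 Kk0 erefl)); rewrite sm // => /le_trans; apply.
  by rewrite mulr_natl mulr2n lerDl ltW // ratioX_gt0.
have := @ball_cover_lower_bound R F c (size s) (fun=> j * m)%N
  (fun i => phi_ (nth [::] s i) k0) (fun k z => hc k z) near_cell.
apply/negP; rewrite -ltNge sumr_const card_ord -[X in _ * X]mulr_natl ss sA.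
have -> : ((M ^ m).-1 ^ j)%:R * (M%:R ^+ (j * m))^-1 = q ^+ j :> R.
  by rewrite /q expr_div_n natrX natrX -exprM mulnC.
apply: (@le_lt_trans _ _ (c.+1%:R * q ^+ j)).
  by rewrite ler_wpM2r ?exprn_ge0 ?ler_nat //; case/andP: q01.
by rewrite -ltr_pdivlMl // mulr1.
Qed.

(** Two words give two cells [cell_inj], and distinct cells are subject to the
    nesting axiom. *)
Lemma cell_meet_vertex v w x : size v = size w -> v <> w -> cell v x -> cell w x ->
  exists2 a, V0 a & phi_ v a = x.
Proof.
move=> svw vw vx wx.
have v0 : (1 <= size v)%N by case: (v) svw vw => // /esym/size0nil->.
pose w' := tcast (esym svw) (in_tuple w).
have w'E : tval w' = w by rewrite val_tcast.
have ncell : cell (in_tuple v) <> cell w'.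
  by rewrite w'E => /cell_inj h; apply: vw; exact: h.
have := nf_nesting v0 ncell; rewrite w'E => h.
have : (cell v `&` cell w) x by [].
by rewrite /cell h => -[].
Qed.

Lemma word_map_Vinf w x : V0 x -> Vinf (phi_ w x).
Proof.
move=> V0x; exists (size w) => //; elim: w => //= i w IH.
by exists i => //; exists (phi_ w x).
Qed.

Lemma countable_Vinf : countable (Vinf).
Proof.
apply: bigcup_countable => // m _; apply: finite_set_countable.
elim: m => [|m IH] /=; first exact: V0_finite.
by apply: bigcup_finite => // i _; exact: finite_image.
Qed.

Lemma address_prefix_cell x m : K x -> cell (address_prefix x m) x.
Proof.
move=> Kx; rewrite /address_prefix /address; case: xgetP => [w _ hw|hn].
  exact: hw.
by have [w hw] := address_exists Kx; have := hn w.
Qed.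

Lemma size_address_prefix x m : size (address_prefix x m) = m.
Proof. by rewrite size_mkseq. Qed.

Lemma address_prefixE v x : ~ Vinf x -> cell v x -> address_prefix x (size v) = v.
Proof.
move=> nVx vx; apply: contrapT => h; apply: nVx.
have Kx : K x by exact: cell_sub_K vx.
have svx : size (address_prefix x (size v)) = size v by rewrite size_address_prefix.
have [a V0a <-] := cell_meet_vertex svx h (address_prefix_cell _ Kx) vx.
exact: word_map_Vinf.
Qed.

Lemma take_address_prefix x m n : (m <= n)%N ->
  take m (address_prefix x n) = address_prefix x m.
Proof. by move=> mn; rewrite /address_prefix /mkseq -map_take take_iota (minn_idPl mn). Qed.

(** The cells of a generation that avoid a point form a closed set, so the other
    ones make up a neighbourhood in the fractal. *)
Lemma oscillation_continuous (g : T -> R) :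
  (forall e, 0 < e -> exists m, forall w x y, size w = m ->
     cell w x -> cell w y -> `|g x - g y| <= e) ->
  {within K, continuous g}.
Proof.
move=> osc; apply/subspace_continuousP => x Kx.
apply/cvgrPdist_le => e e0; have [m hm] := osc e e0.
pose B := \bigcup_(w in [set w : m.-tuple 'I_M | ~ cell w x]) cell w.
have cB : closed B by apply: closed_bigcup => [|w _]; [exact: finite_finset|exact: cell_closed].
have nBx : nbhs x (~` B).
  apply: open_nbhs_nbhs; split; first exact: closed_openC.
  by move=> [w /= nwx].
apply: filterS nBx => y nBy Ky; have [w wy] := K_cell m Ky.
have wx : cell w x by apply: contrapT => nwx; apply: nBy; exists w.
by apply: hm wx wy; rewrite size_tuple.
Qed.

End vertices.

(** * The normalized Hausdorff measure *)

Lemma measure_bigsetU_le d (T : measurableType d) (R : realType)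
    (mu : {measure set T -> \bar R}) (I : Type) (s : seq I) (P : pred I)
    (A : I -> set T) : (forall i, measurable (A i)) ->
  (mu (\big[setU/set0]_(i <- s | P i) A i) <= \sum_(i <- s | P i) mu (A i))%E.
Proof.
move=> mA; elim: s => [|i s IH]; first by rewrite !big_nil measure0.
rewrite !big_cons; case: ifP => // _.
apply: (le_trans (measureU2 _ _ _)) => //; last by rewrite leeD2l.
by apply: bigsetU_measurable => j _.
Qed.

Section normalized_measure.
Context {R : realType}.
Variable F : nestedFractal R.
Local Notation T := 'rV[R]_(nfN F).
Local Notation M := (nfM F).
Local Notation K := (nfK F).
Local Notation phi_ := (word_map (nfphi F)).
Local Notation l := ((nfL F)^-1).
Implicit Types (u v w : seq 'I_M) (x y : T).

Definition star_words m w : pred (m.-tuple 'I_M) :=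
  [pred t : m.-tuple 'I_M | `[< cell t `&` cell w !=set0 >]].

Lemma cell_nonempty w : cell w !=set0.
Proof. by have [k0 Kk0] := nf_nonempty F; exists (phi_ w k0); exists k0. Qed.

Lemma starE m (w : m.-tuple 'I_M) :
  star m (cell w) = \big[setU/set0]_(t : m.-tuple 'I_M | star_words w t) cell t.
Proof.
rewrite -bigcup_seq_cond /star; apply/seteqP; split => x.
  case=> [wx|[S [[t ->] [_ tw]] tx]].
    by exists w => //; rewrite /= mem_index_enum /=; apply/asboolP; exists x.
  by exists t => //; rewrite /= mem_index_enum /=; apply/asboolP.
move=> [t /= /andP[_ /asboolP tw] tx].
have [ctw|ctw] := pselect (cell t = cell w); first by left; rewrite -ctw.
by right; exists (cell t) => //; split; [exists t|].
Qed.

Variable mu : {measure set (borelRV R (nfN F)) -> \bar R}.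
Hypothesis hmu : normalized_hausdorff mu.

Lemma mu_K : mu K = 1%E.
Proof.
rewrite hmu; last exact: measurable_K.
rewrite setIid divee ?gt_eqF ?hausdorff_K_gt0 //.
rewrite ge0_fin_numE ?(ltW (hausdorff_K_gt0 _)) //.
exact: le_lt_trans (hausdorff_K_le1 F) (ltry _).
Qed.

Lemma mu_cell_le w : (mu (cell w) <= ((M%:R ^+ size w)^-1)%:E)%E.
Proof.
have := mu_K; rewrite !hmu; [|exact: measurable_cell|exact: measurable_K].
rewrite setIid => KK; rewrite setIidl; last exact: cell_sub_K.
apply: (@le_trans _ _ (((M%:R ^+ size w)^-1)%:E * hausdorff (hdim F) K / hausdorff (hdim F) K)%E).
  rewrite lee_wpmul2r ?hausdorff_image_le //.
  by rewrite inve_ge0 (ltW (hausdorff_K_gt0 _)).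
by rewrite -muleA KK mule1.
Qed.

(** The cells of a generation cover the fractal, so the upper bounds on their
    measures add up to at most the total mass and must all be equalities. *)
Lemma mu_cell w : mu (cell w) = ((M%:R ^+ size w)^-1)%:E.
Proof.
apply/eqP; rewrite eq_le mu_cell_le /=.
pose m := size w; pose b : R := (M%:R ^+ m)^-1.
have b_gt0 : 0 < M%:R ^+ m :> R by rewrite exprn_gt0 ?M_gt0.
have fin_cell u : mu (cell u) \is a fin_num.
  rewrite ge0_fin_numE //; exact: le_lt_trans (mu_cell_le u) (ltry _).
have h1 : (1 <= \sum_(t : m.-tuple 'I_M) mu (cell t))%E.
  rewrite -mu_K; apply: le_trans (measure_bigsetU_le _ _ _ _); last first.
    by move=> t; exact: measurable_cell.
  apply: le_measure; rewrite ?inE //; first exact: measurable_K.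
    by apply: bigsetU_measurable => t _; exact: measurable_cell.
  move=> x /(K_cell m)[t tx]; rewrite -bigcup_seq.
  by exists t => //; rewrite /= mem_index_enum.
rewrite (bigD1 (in_tuple w)) //= in h1.
have h2 : (\sum_(t : m.-tuple 'I_M | t != in_tuple w) mu (cell t) <= (1 - b)%:E)%E.
  apply: (@le_trans _ _ (\sum_(t : m.-tuple 'I_M | t != in_tuple w) b%:E)%E).
    by apply: lee_sum => t _; apply: le_trans (mu_cell_le t) _; rewrite size_tuple.
  rewrite sumEFin lee_fin.
  have bE : \sum_(t : m.-tuple 'I_M) b = 1.
    rewrite sumr_const card_tuple card_ord -[LHS]mulr_natl natrX /b divff //.
    by rewrite gt_eqF.
  by rewrite lerBrDl -bE [leRHS](bigD1 (in_tuple w)).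
move: h1; rewrite -(fineK (fin_cell w)) => h1.
have {h1 h2} := le_trans h1 (leeD2l _ h2).
by rewrite -EFinD !lee_fin -/m -/b; lra.
Qed.

Lemma measurable_star m (w : m.-tuple 'I_M) :
  measurable (star m (cell w) : set (borelRV R (nfN F))).
Proof. by rewrite starE; apply: bigsetU_measurable => t _; exact: measurable_cell. Qed.

Lemma mu_star_le c m (w : m.-tuple 'I_M) :
    (forall k z, (#|@near_words R F k z k| <= c)%N) ->
  (mu (star m (cell w)) <= (c%:R * (M%:R ^+ m)^-1)%:E)%E.
Proof.
move=> hc; rewrite starE; apply: le_trans (measure_bigsetU_le _ _ _ _) _.
  by move=> t; exact: measurable_cell.
have [x wx] := cell_nonempty w.
have b_gt0 : 0 < M%:R ^+ m :> R by rewrite exprn_gt0 ?M_gt0.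
apply: (@le_trans _ _ (\sum_(t | star_words w t) ((M%:R ^+ m)^-1)%:E)%E).
  by apply: lee_sum => t _; rewrite mu_cell size_tuple.
rewrite sumEFin sumr_const lee_fin -[leLHS]mulr_natl ler_pM2r ?invr_gt0 // ler_nat.
apply: leq_trans (hc m x); apply: subset_leq_card; apply/fintype.subsetP => t.
rewrite !inE => -[y [ty wy]]; exists y => //.
apply: le_trans (cell_dist wy wx) _; rewrite size_tuple mulr_natl mulr2n lerDl.
exact: ltW (ratioX_gt0 _ _).
Qed.

Lemma cell_sub_star m (w : m.-tuple 'I_M) : cell w `<=` star m (cell w).
Proof. by move=> x wx; left. Qed.

Lemma mu_star_ge m (w : m.-tuple 'I_M) :
  (((M%:R ^+ m)^-1)%:E <= mu (star m (cell w)))%E.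
Proof.
have -> : ((M%:R ^+ m)^-1)%:E = mu (cell w) by rewrite mu_cell size_tuple.
apply: le_measure; rewrite ?inE; [exact: measurable_cell|exact: measurable_star|].
exact: cell_sub_star.
Qed.

End normalized_measure.

(** * Discrete energies and oscillation *)

Lemma sum_tuple_cons (V : nmodType) n (I : finType) (G : seq I -> V) :
  \sum_(t : n.+1.-tuple I) G t = \sum_i \sum_(t : n.-tuple I) G (i :: t).
Proof.
rewrite pair_big /= (reindex (fun p : I * n.-tuple I => [tuple of p.1 :: p.2])) //=.
exists (fun t => (thead t, [tuple of behead t])) => [[i t] _|t _] /=.
  by congr pair; apply: val_inj.
by rewrite -tuple_eta.
Qed.

Lemma sum_tuple0 (V : nmodType) (I : finType) (G : seq I -> V) :
  \sum_(t : 0.-tuple I) G t = G [::].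
Proof.
rewrite (bigD1 [tuple]) //= big1 ?addr0 // => t.
by move=> /negP[]; apply/eqP/val_inj; rewrite [RHS]/=; case: t => -[].
Qed.

Lemma sum_tuple_cat (V : nmodType) m n (I : finType) (G : seq I -> V) :
  \sum_(t : (m + n).-tuple I) G t =
  \sum_(u : m.-tuple I) \sum_(t : n.-tuple I) G (u ++ t).
Proof.
elim: m G => [|m IH] G.
  by rewrite (sum_tuple0 (fun u => \sum_(t : n.-tuple I) G (u ++ t))).
rewrite addSn sum_tuple_cons.
rewrite (sum_tuple_cons _ (fun u => \sum_(t : n.-tuple I) G (u ++ t))).
by apply: eq_bigr => i _; exact: (IH (fun u => G (i :: u))).
Qed.

Lemma ler_term_sum (R : numDomainType) (I : eqType) (s : seq I) (G : I -> R) i :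
  i \in s -> (forall j, j \in s -> 0 <= G j) -> G i <= \sum_(j <- s) G j.
Proof.
move=> is_ G_ge0; rewrite (big_rem i) //= lerDl big_seq sumr_ge0 // => j /mem_rem.
exact: G_ge0.
Qed.

Section energy.
Context {R : realType} {F : nestedFractal R}.
Variable S : harmonicStructure F.
Local Notation T := 'rV[R]_(nfN F).
Local Notation M := (nfM F).
Local Notation K := (nfK F).
Local Notation V0 := (nfV0 F).
Local Notation phi_ := (word_map (nfphi F)).
Local Notation rho := (hs_rho S).
Local Notation vs := (fset_set V0).
Implicit Types (f g h : T -> R) (w : seq 'I_M) (x y : T).

Lemma mem_vs x : x \in vs -> V0 x.
Proof. by rewrite in_fset_set ?inE //; exact: V0_finite. Qed.

Lemma vs_mem x : V0 x -> x \in vs.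
Proof. by rewrite in_fset_set ?inE //; exact: V0_finite. Qed.

Lemma rho_gt0 : 0 < rho. Proof. exact: lt_trans ltr01 (hs_rho_gt1 S). Qed.

(** The polarization of [energy0], summed over an enumeration of the boundary. *)
Definition eform0 f g : R :=
  2^-1 * \sum_(x <- vs) \sum_(y <- vs) hs_a S x y * ((f x - f y) * (g x - g y)).

Definition eform_ m f g : R :=
  rho ^+ m * \sum_(w : m.-tuple 'I_M) eform0 (f \o phi_ w) (g \o phi_ w).

Lemma energy0E f : energy0 (hs_a S) f = eform0 f f.
Proof.
rewrite /energy0 /eform0 (fsbig_finite _ _ (@V0_finite R F)); congr (_ * _).
by apply: eq_bigr => x _; rewrite (fsbig_finite _ _ (@V0_finite R F)).
Qed.

Lemma energyE m f : energy_ S m f = eform_ m f f.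
Proof. by rewrite /energy_; congr (_ * _); apply: eq_bigr => w _; exact: energy0E. Qed.

Lemma eform0C f g : eform0 f g = eform0 g f.
Proof.
by congr (_ * _); apply: eq_bigr => x _; apply: eq_bigr => y _; rewrite (mulrC (f x - _)).
Qed.

Lemma eform0P a f g h : eform0 (fun x => a * f x + g x) h = a * eform0 f h + eform0 g h.
Proof.
rewrite /eform0 mulrCA -mulrDr; congr (_ * _).
rewrite mulr_sumr -big_split /=; apply: eq_bigr => x _.
rewrite mulr_sumr -big_split /=; apply: eq_bigr => y _; ring.
Qed.

Lemma eq_eform0 f f' g g' : (forall x, V0 x -> f x = f' x) ->
  (forall x, V0 x -> g x = g' x) -> eform0 f g = eform0 f' g'.
Proof.
move=> ff gg; congr (_ * _); apply: eq_big_seq => x /mem_vs Vx.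
by apply: eq_big_seq => y /mem_vs Vy; rewrite !ff ?gg.
Qed.

Lemma eform_C m f g : eform_ m f g = eform_ m g f.
Proof. by congr (_ * _); apply: eq_bigr => w _; exact: eform0C. Qed.

Lemma eform_P m a f g h :
  eform_ m (fun x => a * f x + g x) h = a * eform_ m f h + eform_ m g h.
Proof.
rewrite /eform_ mulrCA -mulrDr; congr (_ * _).
rewrite mulr_sumr -big_split /=; apply: eq_bigr => w _.
exact: (eform0P a (f \o phi_ w) (g \o phi_ w)).
Qed.

Lemma eq_eform_ m f f' g g' : (forall x, K x -> f x = f' x) ->
  (forall x, K x -> g x = g' x) -> eform_ m f g = eform_ m f' g'.
Proof.
move=> ff gg; congr (_ * _); apply: eq_bigr => w _.
by apply: eq_eform0 => x Vx; [apply: ff|apply: gg]; apply: word_map_K; exact: V0_sub_K.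
Qed.

Lemma eform0_ge0 f : 0 <= eform0 f f.
Proof.
rewrite mulr_ge0 ?invr_ge0 //.
rewrite big_seq sumr_ge0 // => x /mem_vs Vx; rewrite big_seq sumr_ge0 // => y /mem_vs Vy.
have [->|xy] := eqVneq x y; first by rewrite !subrr !mulr0.
by rewrite mulr_ge0 ?hs_ge0 //; [exact/eqP|rewrite -expr2 sqr_ge0].
Qed.

Lemma eform_ge0 m f : 0 <= eform_ m f f.
Proof.
rewrite mulr_ge0 ?exprn_ge0 ?(ltW rho_gt0) //.
by apply: sumr_ge0 => w _; exact: eform0_ge0.
Qed.

Lemma eform_00 f g : eform_ 0 f g = eform0 f g.
Proof.
rewrite /eform_ expr0 mul1r (sum_tuple0 (fun w => eform0 (f \o phi_ w) (g \o phi_ w))).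
by [].
Qed.

Lemma eform_S m f g :
  eform_ m.+1 f g = rho * \sum_i eform_ m (f \o nfphi F i) (g \o nfphi F i).
Proof.
rewrite /eform_ (sum_tuple_cons _ (fun w => eform0 (f \o phi_ w) (g \o phi_ w))).
by rewrite exprS -mulrA -mulr_sumr.
Qed.

Lemma eform_add k m f g :
  eform_ (k + m) f g =
  rho ^+ k * \sum_(w : k.-tuple 'I_M) eform_ m (f \o phi_ w) (g \o phi_ w).
Proof.
rewrite /eform_ (sum_tuple_cat _ _ (fun w => eform0 (f \o phi_ w) (g \o phi_ w))).
rewrite exprD -mulrA; congr (_ * _); rewrite mulr_sumr.
apply: eq_bigr => u _; congr (_ * _); apply: eq_bigr => t _.
by apply: eq_eform0 => x _ /=; rewrite word_map_cat.
Qed.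

Lemma eform_cell_le m (w : seq 'I_M) f :
  rho ^+ size w * eform_ m (f \o phi_ w) (f \o phi_ w) <= eform_ (size w + m) f f.
Proof.
rewrite eform_add ler_pM2l ?exprn_gt0 ?rho_gt0 //.
rewrite (bigD1 (in_tuple w)) //= lerDl; apply: sumr_ge0 => t _; exact: eform_ge0.
Qed.

Lemma renormalization_set_lbound f : has_lbound [set e | exists g : T -> R,
  (forall x, V0 x -> g x = f x) /\
  e = \sum_(i < nfM F) energy0 (hs_a S) (g \o nfphi F i)].
Proof.
exists 0 => _ [g [_ ->]]; apply: sumr_ge0 => i _.
by rewrite energy0E eform0_ge0.
Qed.

(** The function itself competes in the minimization that defines the
    renormalization factor. *)
Lemma eform0_le_eform1 f : eform0 f f <= eform_ 1 f f.
Proof.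
rewrite eform_S -ler_pdivrMl ?rho_gt0 // -energy0E -hs_renormalization.
apply: ge_inf; first exact: renormalization_set_lbound.
exists f; split=> //; apply: eq_bigr => i _.
by rewrite eform_00 energy0E.
Qed.

Lemma eform_leS m f : eform_ m f f <= eform_ m.+1 f f.
Proof.
elim: m f => [|m IH] f; first by rewrite eform_00 eform0_le_eform1.
rewrite eform_S (eform_S m.+1) ler_pM2l ?rho_gt0 //.
by apply: ler_sum => i _; exact: IH.
Qed.

Lemma eform_le m n f : (m <= n)%N -> eform_ m f f <= eform_ n f f.
Proof.
move=> mn; have := @homo_leq _ (fun k => eform_ k f f) <=%R.
by apply=> //; [exact: le_trans|move=> k; exact: eform_leS].
Qed.

Lemma near_minimizer f e : 0 < e -> exists2 g,
  forall x, V0 x -> g x = f x & eform_ 1 g g < eform0 f f + e.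
Proof.
move=> e0; have e0' : 0 < rho^-1 * e by rewrite mulr_gt0 ?invr_gt0 ?rho_gt0.
have hi : has_inf [set e | exists g : T -> R, (forall x, V0 x -> g x = f x) /\
    e = \sum_(i < nfM F) energy0 (hs_a S) (g \o nfphi F i)].
  split; last exact: renormalization_set_lbound.
  by exists (\sum_(i < M) energy0 (hs_a S) (f \o nfphi F i)); exists f.
have [_ [g [gf ->]]] := inf_adherent e0' hi.
rewrite hs_renormalization -mulrDr energy0E => h; exists g => //.
rewrite eform_S -ltr_pdivlMl ?rho_gt0 //; apply: le_lt_trans h.
by apply: ler_sum => i _; rewrite eform_00 energy0E.
Qed.

(** With the square root of [E], which is homogeneous of degree 1, such bounds
    add up along chains of points. *)
Definition controls (E : (T -> R) -> R) x y : Prop :=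
  exists2 c : R, 0 <= c & forall g, `|g x - g y| <= c * Num.sqrt (E g).

Lemma controls_refl E x : controls E x x.
Proof. by exists 0 => // g; rewrite subrr normr0 mul0r. Qed.

Lemma controls_trans E y x z : controls E x y -> controls E y z -> controls E x z.
Proof.
move=> [c c0 hc] [c' c'0 hc']; exists (c + c'); first exact: addr_ge0.
by move=> g; rewrite (le_trans (ler_distD (g y) _ _)) // mulrDl lerD.
Qed.

Lemma controls_joined (e : T -> T -> Prop) E x y :
  (forall u v, e u v -> controls E u v) -> joined e x y -> controls E x y.
Proof.
move=> h [s [+ <-]]; elim: s x => [|z s IH] x /=; first by move=> _; exact: controls_refl.
by move=> /andP[/asboolP/h xz /IH]; exact: controls_trans.
Qed.

Lemma controls_eform0 x y : V0 x -> V0 y -> controls (fun g => eform0 g g) x y.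
Proof.
move=> Vx Vy; apply: controls_joined (hs_irreducible S Vx Vy) => u v [Vu Vv uv].
exists (Num.sqrt (2 / hs_a S u v)); first exact: sqrtr_ge0.
move=> g; rewrite -sqrtrM ?divr_ge0 ?(ltW uv) // -sqrtr_sqr.
have a_ge0 : 0 <= 2 / hs_a S u v * eform0 g g.
  by rewrite mulr_ge0 ?eform0_ge0 // divr_ge0 // ltW.
rewrite ler_sqrt // -mulrA [_^-1 * _]mulrC mulrA ler_pdivlMr //.
rewrite /eform0 mulVKf ?pnatr_eq0 // mulrC expr2.
pose G x0 y0 := hs_a S x0 y0 * ((g x0 - g y0) * (g x0 - g y0)).
have G_ge0 x0 y0 : x0 \in vs -> y0 \in vs -> 0 <= G x0 y0.
  move=> /mem_vs Vx0 /mem_vs Vy0; have [e|ne] := eqVneq x0 y0.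
    by rewrite /G e !subrr !mulr0.
  by rewrite mulr_ge0 ?hs_ge0 //; [exact/eqP|rewrite -expr2 sqr_ge0].
apply: (@le_trans _ _ (\sum_(y0 <- vs) G u y0)).
  by apply: (@ler_term_sum _ _ _ (G u)); [exact: vs_mem|move=> y0; apply: G_ge0; exact: vs_mem].
apply: (@ler_term_sum _ _ _ (fun x0 => \sum_(y0 <- vs) G x0 y0)); first exact: vs_mem.
by move=> x0 x0s; rewrite big_seq sumr_ge0 // => y0 y0s; exact: G_ge0.
Qed.

Lemma controls_eform1 x y : Phi (nfphi F) V0 x -> Phi (nfphi F) V0 y ->
  controls (fun g => eform_ 1 g g) x y.
Proof.
move=> Vx Vy; apply: controls_joined (nf_connected Vx Vy).
move=> _ _ [i [[a Va <-] [b Vb <-]]].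
have [c c0 hc] := controls_eform0 Va Vb.
exists c => // g; apply: le_trans (hc (g \o nfphi F i)) _.
rewrite ler_wpM2l // ler_wsqrtr // eform_S.
rewrite (bigD1 i) //= eform_00 mulrDr.
apply: (@le_trans _ _ (rho * eform0 (g \o nfphi F i) (g \o nfphi F i))).
  by rewrite ler_peMl ?eform0_ge0 // ltW // hs_rho_gt1.
rewrite lerDl mulr_ge0 ?(ltW rho_gt0) //.
by apply: sumr_ge0 => j _; exact: eform_ge0.
Qed.

Lemma controls_uniform E (A : set T) : finite_set A ->
  (forall x y, A x -> A y -> controls E x y) ->
  exists2 c : R, 0 <= c & forall x y, A x -> A y ->
    forall g, `|g x - g y| <= c * Num.sqrt (E g).
Proof.
move=> fA hA.
have /choice[c hc] : forall p : T * T, exists c : R,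
    0 <= c /\ (A p.1 -> A p.2 -> forall g, `|g p.1 - g p.2| <= c * Num.sqrt (E g)).
  move=> [x y] /=; have [Ax|nAx] := pselect (A x); last by exists 0.
  have [Ay|nAy] := pselect (A y); last by exists 0.
  by have [c c0 hc] := hA x y Ax Ay; exists c.
pose s := fset_set A.
have c_ge0 x y : 0 <= c (x, y) by case: (hc (x, y)).
exists (\sum_(x <- s) \sum_(y <- s) c (x, y)).
  by apply: sumr_ge0 => x _; apply: sumr_ge0 => y _.
move=> x y Ax Ay g; have [_ /(_ Ax Ay g) h] := hc (x, y).
apply: (le_trans h); rewrite ler_wpM2r ?sqrtr_ge0 //=.
have xs : x \in s by rewrite in_fset_set ?inE.
have ys : y \in s by rewrite in_fset_set ?inE.
apply: (@le_trans _ _ (\sum_(y <- s) c (x, y))).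
  exact: (@ler_term_sum _ _ _ (fun y => c (x, y))).
apply: (@ler_term_sum _ _ _ (fun x => \sum_(y <- s) c (x, y))) => // z _.
by apply: sumr_ge0.
Qed.

Lemma V0_sub_V1 x : V0 x -> Phi (nfphi F) V0 x.
Proof. by move=> Vx; have [i ix] := V0_fixpoint Vx; exists i => //; exists x. Qed.

(** Descending from the boundary to a vertex of generation [n], each step is
    controlled by the energy of one cell, which loses a factor [rho] per
    generation, so the differences add up to a geometric series. *)
Lemma vertex_oscillation : exists2 C : R, 0 < C & forall n g w x y,
  size w = n -> V0 x -> V0 y ->
  `|g (phi_ w x) - g y| <= C * Num.sqrt (eform_ n g g).
Proof.
have [c0 c0_ge0 hc0] := controls_uniform (@V0_finite R F) controls_eform0.
have V1fin : finite_set (Phi (nfphi F) V0).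
  by apply: bigcup_finite => [|i _]; [exact: finite_finset|apply: finite_image; exact: V0_finite].
have [c1 c1_ge0 hc1] := controls_uniform V1fin controls_eform1.
pose q := Num.sqrt (rho^-1).
have q_ge0 : 0 <= q by exact: sqrtr_ge0.
have q_lt1 : q < 1.
  by rewrite -[X in _ < X]sqrtr1 ltr_sqrt // invf_lt1 ?rho_gt0 // hs_rho_gt1.
(* the solution of the recursion [C = c0 + c1 + 1 + q * C], where [q] is the
   gain per generation; the summand 1 makes it positive *)
pose C := (c0 + c1 + 1) / (1 - q).
have q1 : 0 < 1 - q by rewrite subr_gt0.
have C_gt0 : 0 < C by rewrite divr_gt0 // ltr_wpDl ?addr_ge0.
have CE : C = c0 + c1 + 1 + q * C by rewrite /C; field; rewrite gt_eqF.
have qC : 0 <= q * C by rewrite mulr_ge0 // ltW.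
exists C => //; elim=> [|n IH] g [|i w] // x y sw Vx Vy.
  rewrite eform_00; apply: le_trans (hc0 _ _ Vx Vy g) _.
  by rewrite ler_wpM2r ?sqrtr_ge0 // CE; lra.
case: sw => sw.
apply: (le_trans (ler_distD (g (nfphi F i y)) _ _)).
have h1 := IH (g \o nfphi F i) w x y sw Vx Vy.
have h2 := hc1 (nfphi F i y) y (ex_intro2 _ _ i I (ex_intro2 _ _ y Vy erefl)) (V0_sub_V1 Vy) g.
have h3 : Num.sqrt (eform_ 1 g g) <= Num.sqrt (eform_ n.+1 g g).
  by rewrite ler_wsqrtr // eform_le.
have h4 : Num.sqrt (eform_ n (g \o nfphi F i) (g \o nfphi F i)) <=
          q * Num.sqrt (eform_ n.+1 g g).
  rewrite -sqrtrM ?invr_ge0 ?(ltW rho_gt0) // ler_wsqrtr // ler_pdivlMl ?rho_gt0 //.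
  exact: (eform_cell_le n [:: i] g).
have h5 : C * Num.sqrt (eform_ n (g \o nfphi F i) (g \o nfphi F i)) <=
   C * (q * Num.sqrt (eform_ n.+1 g g)) by rewrite ler_pM2l.
have h6 := ler_wpM2l c1_ge0 h3.
have := sqrtr_ge0 (eform_ n.+1 g g).
move: h1 h2 h5 h6; rewrite /=.
set s := Num.sqrt (eform_ n.+1 g g); set s1 := Num.sqrt (eform_ 1 g g).
set s2 := Num.sqrt (eform_ n _ _) => h1 h2 h5 h6 s0.
rewrite CE; have : 0 <= (c0 + 1) * s by rewrite mulr_ge0 // addr_ge0.
lra.
Qed.

(** A Morrey-type inequality: every point is a limit of vertices, to which
    [vertex_oscillation] applies. *)
Lemma oscillation_le : exists2 C : R, 0 < C & forall g B,
  {within K, continuous g} -> (forall m, energy_ S m g <= B) ->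
  forall x y, K x -> K y -> `|g x - g y| <= C * Num.sqrt B.
Proof.
have [C C_gt0 hC] := vertex_oscillation.
have [v Vv] := V0_nonempty F.
exists (2 * C); first by rewrite mulr_gt0.
move=> g B cg hB.
have hv x : K x -> `|g x - g v| <= C * Num.sqrt B.
  move=> Kx; apply/ler_addgt0Pr => e e0.
  have /subspace_continuousP/(_ x Kx)/cvgrPdist_le/(_ e e0) := cg.
  move=> /nbhs_enorm[r r0 hr]; have [n hn] := ratio_lt_eps F r0.
  pose w := address_prefix x n.
  have Kw : K (phi_ w v) by apply: word_map_K; exact: V0_sub_K.
  have h1 : `|g x - g (phi_ w v)| <= e.
    apply: hr => //; apply: le_lt_trans (hn n (leqnn n)).
    rewrite -(size_address_prefix x n); apply: cell_dist; first exact: address_prefix_cell.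
    by exists v => //; exact: V0_sub_K.
  have h2 : `|g (phi_ w v) - g v| <= C * Num.sqrt B.
    apply: le_trans (hC n g w v v _ Vv Vv) _; first exact: size_address_prefix.
    by rewrite ler_pM2l // ler_wsqrtr // -energyE.
  by apply: (le_trans (ler_distD (g (phi_ w v)) _ _)); rewrite addrC lerD.
move=> x y Kx Ky; apply: (le_trans (ler_distD (g v) _ _)).
rewrite (distrC (g v)); have := hv x Kx; have := hv y Ky; lra.
Qed.

End energy.

(** * Existence of harmonic extensions *)

(** Tychonoff's theorem, with the cluster point presented as the pointwise limit
    along a filter that contains every eventual property of the sequence. *)
Lemma bounded_functions_cluster (R : realType) (X : eqType) (u : nat -> X -> R) b :
  (forall n x, `|u n x| <= b) ->
  exists (h : X -> R) (G : set_system (X -> R)), [/\ ProperFilter G,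
    forall x, g x @[g --> G] --> h x &
    forall P : set (X -> R), (exists N, forall n, (N <= n)%N -> P (u n)) -> G P].
Proof.
move=> hb.
have cA : forall x : X, compact [set t : R | `|t| <= b].
  move=> _; have -> : [set t : R | `|t| <= b] = [set` `[- b, b]].
    by apply/seteqP; split => t /=; rewrite in_itv /= ler_norml.
  exact: segment_compact.
have FF : ProperFilter (u n @[n --> \oo]) by exact: fmap_proper_filter.
have /(tychonoff cA FF)[h [_ hcl]] :
    (u n @[n --> \oo]) [set f | forall x : X, [set t : R | `|t| <= b] (f x)].
  by exists 0%N => // n _ x; exact: hb.
move: hcl; rewrite cluster_cvgE => -[G pG [Gh uG]].
exists h, G; split=> [|x|P [N hN]]; first exact: pG.
- have hc := @proj_continuous X (fun=> R : topologicalType) x h.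
  exact: cvg_comp Gh hc.
- by apply: uG; exists N => // n; exact: hN.
Qed.

Lemma filter_limit_le (R : realType) (X : Type) (G : set_system X) (k : X -> R) a c :
  ProperFilter G -> k g @[g --> G] --> a -> G [set g | k g <= c] -> a <= c.
Proof. by move=> pG ka kc; apply: (closed_cvg _ (@closed_le R c) kc). Qed.

Lemma cvg_sumr (R : realType) (X : Type) (G : set_system X) (I : Type) (s : seq I)
    (k : I -> X -> R) (a : I -> R) : Filter G ->
  (forall i, k i g @[g --> G] --> a i) ->
  \sum_(i <- s) k i g @[g --> G] --> \sum_(i <- s) a i.
Proof. by move=> FG h; apply: cvg_big => // p; exact: add_continuous. Qed.

Section harmonic_extensions.
Context {R : realType} {F : nestedFractal R}.
Variable S : harmonicStructure F.
Local Notation T := 'rV[R]_(nfN F).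
Local Notation M := (nfM F).
Local Notation K := (nfK F).
Local Notation V0 := (nfV0 F).
Local Notation phi_ := (word_map (nfphi F)).
Local Notation rho := (hs_rho S).
Implicit Types (f g h : T -> R) (w : seq 'I_M) (x y : T).

(** The cells of the first generation meet at vertices only, where [u] makes the
    functions compatible. *)
Lemma glue_cells (u : T -> R) (gi : 'I_M -> T -> R) :
  (forall i a, V0 a -> gi i a = u (nfphi F i a)) ->
  exists g, forall i x, K x -> g (nfphi F i x) = gi i x.
Proof.
move=> hu.
have /choice[g hg] : forall x, exists r, forall i y, K y -> nfphi F i y = x -> r = gi i y.
  move=> x; have [[i [y [Ky yx]]]|no] := pselect (exists i y, K y /\ nfphi F i y = x); last first.
    by exists 0 => i y Ky yx; exfalso; apply: no; exists i, y.
  exists (gi i y) => j z Kz zx.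
  have inj k : injective (nfphi F k) by exact: (@word_map_inj R F [:: k]).
  have [ij|ij] := eqVneq i j.
    by subst j; congr (gi i _); apply: (inj i); rewrite yx zx.
  have ix : cell [:: i] x by exists y.
  have jx : cell [:: j] x by exists z.
  have [a Va ax] : exists2 a, V0 a & phi_ [:: i] a = x.
    by apply: cell_meet_vertex ix jx => // -[] /eqP; exact/negP.
  have [c Vc cx] : exists2 c, V0 c & phi_ [:: j] c = x.
    by apply: cell_meet_vertex jx ix => // -[] /esym/eqP; exact/negP.
  have ay : a = y by apply: (inj i); rewrite yx -ax.
  have cz : c = z by apply: (inj j); rewrite zx -cx.
  by rewrite -ay -cz !hu //; congr u; rewrite -[LHS]/(phi_ [:: i] a) ax -cx.
by exists g => i x Kx; exact: hg.
Qed.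

(** Near-minimizers of the renormalization problem are taken in every cell and
    glued; the errors of all generations are kept below a prescribed total. *)
Lemma finite_extension n f e : 0 < e -> exists2 g,
  forall x, V0 x -> g x = f x & eform_ S n g g <= eform0 S f f + e.
Proof.
elim: n f e => [|n IH] f e e0.
  by exists f => //; rewrite eform_00 lerDl ltW.
have e20 : 0 < e / 2 by rewrite divr_gt0.
have [u uf hu] := near_minimizer S f e20.
pose e' := e / 2 / (rho * M%:R).
have rM : 0 < rho * M%:R by rewrite mulr_gt0 ?rho_gt0 ?M_gt0.
have e'0 : 0 < e' by rewrite divr_gt0.
have /choice[gi hgi] : forall i : 'I_M, exists g, (forall x, V0 x -> g x = u (nfphi F i x)) /\
    eform_ S n g g <= eform0 S (u \o nfphi F i) (u \o nfphi F i) + e'.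
  by move=> i; have [g g1 g2] := IH (u \o nfphi F i) e' e'0; exists g.
have [g hg] : exists g, forall i x, K x -> g (nfphi F i x) = gi i x.
  by apply: (@glue_cells u) => i a Va; case: (hgi i) => ->.
exists g => [x Vx|].
  have [i ix] := V0_fixpoint Vx; rewrite -{1}ix hg; last exact: V0_sub_K.
  by case: (hgi i) => -> // _; rewrite ix uf.
rewrite eform_S.
have -> : eform0 S f f + e = eform0 S f f + e / 2 + e / 2 by field.
apply: le_trans (lerD (ltW hu) (lexx _)).
rewrite eform_S; have -> : e / 2 = rho * \sum_(i < M) e'.
  rewrite sumr_const card_ord -mulr_natl /e'.
  by field; rewrite !gt_eqF ?rho_gt0 ?M_gt0.
rewrite -mulrDr ler_pM2l ?rho_gt0 // -big_split /=; apply: ler_sum => i _.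
rewrite eform_00; case: (hgi i) => _; apply: le_trans.
rewrite le_eqVlt; apply/orP; left; apply/eqP.
by apply: eq_eform_ => x Kx; rewrite /= hg.
Qed.

(** Replaces a function by its values at vertices of generation [n], which makes
    it continuous up to the scale of that generation. *)
Lemma vertex_sampling n g : exists gs : T -> R, [/\
  forall w a, size w = n -> V0 a -> gs (phi_ w a) = g (phi_ w a),
  forall w x, (size w <= n)%N -> cell w x -> exists u a,
    [/\ size u = (n - size w)%N, V0 a & gs x = g (phi_ w (phi_ u a))] &
  forall x, ~ K x -> gs x = 0].
Proof.
have [v Vv] := V0_nonempty F.
pose Vn x := exists w a, [/\ size w = n, V0 a & phi_ w a = x].
pose gs x := if pselect (Vn x) then g x else
  if pselect (K x) then g (phi_ (address_prefix x n) v) else 0.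
exists gs; split.
- by move=> w a sw Va; rewrite /gs; case: pselect => // -[]; exists w, a.
- move=> w x sw wx; have [u ux] := cell_refine (n - size w) wx.
  have su : size u = (n - size w)%N by rewrite size_tuple.
  have swu : size (w ++ u) = n by rewrite size_cat su subnKC.
  have Kx : K x by exact: cell_sub_K wx.
  rewrite /gs; case: pselect => [/= [w' [a [sw' Va ax]]]|nVn /=].
    have [e|ne] := eqVneq (w ++ u) w'.
      by exists u, a; rewrite -word_map_cat e ax.
    have w'x : cell w' x by rewrite -ax; exists a => //; exact: V0_sub_K.
    have [b Vb bx] : exists2 b, V0 b & phi_ (w ++ u) b = x.
      by apply: (cell_meet_vertex _ _ ux w'x); [rewrite swu|exact/eqP].
    by exists u, b; rewrite -word_map_cat bx.
  case: pselect => //= _; exists u, v; split=> //; rewrite -word_map_cat.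
  congr (g (phi_ _ v)); apply: contrapT => ne; apply: nVn.
  have [b Vb bx] : exists2 b, V0 b & phi_ (w ++ u) b = x.
    apply: (cell_meet_vertex _ _ ux (address_prefix_cell n Kx)).
      by rewrite swu size_address_prefix.
    by move=> e; apply: ne.
  by exists (w ++ u), b.
- move=> x nKx; rewrite /gs; case: pselect => /= [[w [a [_ Va ax]]]|_].
    by exfalso; apply: nKx; rewrite -ax; apply: word_map_K; exact: V0_sub_K.
  by case: pselect.
Qed.

(** A boundary point is fixed by one of the maps, so a vertex reappears in all
    later generations. *)
Lemma vertex_up w a n : (size w <= n)%N -> V0 a -> exists2 u, size u = n &
  phi_ u a = phi_ w a.
Proof.
move=> wn Va; have [i ia] := V0_fixpoint Va.
exists (w ++ nseq (n - size w) i); first by rewrite size_cat size_nseq subnKC.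
rewrite word_map_cat; congr phi_.
by elim: (n - _)%N => //= k ->.
Qed.

Lemma cvg_eform (G : set_system (T -> R)) h m : Filter G ->
  (forall x, g x @[g --> G] --> h x) ->
  eform_ S m g g @[g --> G] --> eform_ S m h h.
Proof.
move=> FG hx; apply: cvgM; first exact: cvg_cst.
apply: cvg_sumr => w; apply: cvgM; first exact: cvg_cst.
apply: cvg_sumr => x; apply: cvg_sumr => y.
apply: cvgM; first exact: cvg_cst.
by apply: cvgM; apply: cvgB; exact: hx.
Qed.

(** A cluster point, for pointwise convergence, of nearly optimal extensions to
    the vertices of generation [n]: the energy bounds hold at finitely many
    points and the moduli of continuity at two points, so both survive. *)
Lemma optimal_extension f : exists h, [/\ energy_dom S h,
  forall x, V0 x -> h x = f x & forall m, energy_ S m h <= eform0 S f f].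
Proof.
have [C C_gt0 hC] := vertex_oscillation S.
have [v Vv] := V0_nonempty F.
have /choice[g hg] : forall n : nat, exists g : T -> R,
    (forall x, V0 x -> g x = f x) /\ eform_ S n g g <= eform0 S f f + n.+1%:R^-1.
  by move=> n; have [|g g1 g2] := @finite_extension n f n.+1%:R^-1 _; [rewrite invr_gt0|exists g].
have /choice[gs hgs] := fun n => vertex_sampling n (g n).
pose B := eform0 S f f + 1.
have B_ge0 : 0 <= B by rewrite addr_ge0 ?eform0_ge0.
have hB n : eform_ S n (g n) (g n) <= B.
  case: (hg n) => _ /le_trans; apply; rewrite lerD2l invf_le1 ?ltr0n //.
  by rewrite ler1n.
pose q := Num.sqrt (rho^-1).
have osc n w x : (size w <= n)%N -> cell w x ->
    `|gs n x - g n (phi_ w v)| <= C * (q ^+ size w * Num.sqrt B).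
  move=> wn wx; have [_ /(_ w x wn wx)[u [a [su Va ->]]] _] := hgs n.
  apply: le_trans (hC (n - size w)%N (g n \o phi_ w) u a v su Va Vv) _.
  rewrite ler_pM2l //.
  have -> : q ^+ size w = Num.sqrt (rho^-1 ^+ size w).
    by rewrite /q; elim: (size w) => [|k IH]; rewrite ?expr0 ?sqrtr1 // !exprS IH sqrtrM // invr_ge0 ltW ?rho_gt0.
  rewrite -sqrtrM ?exprn_ge0 ?invr_ge0 ?(ltW (rho_gt0 _)) // ler_wsqrtr //.
  rewrite exprVn ler_pdivlMl ?exprn_gt0 ?rho_gt0 //.
  by apply: le_trans (eform_cell_le _ _ _ _) _; rewrite subnKC.
have osc2 n w x y : (size w <= n)%N -> cell w x -> cell w y ->
    `|gs n x - gs n y| <= 2 * C * (q ^+ size w * Num.sqrt B).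
  move=> wn wx wy; apply: (le_trans (ler_distD (g n (phi_ w v)) _ _)).
  rewrite (distrC _ (gs n y)); have := osc n w x wn wx; have := osc n w y wn wy; lra.
pose b := `|f v| + C * Num.sqrt B.
have gsb n x : `|gs n x| <= b.
  have [Kx|nKx] := pselect (K x); last first.
    by have [_ _ ->//] := hgs n; rewrite normr0 addr_ge0 // mulr_ge0 ?sqrtr_ge0 // ltW.
  have := osc n [::] x isT; rewrite cell_nil => /(_ Kx) /=.
  case: (hg n) => -> // _; rewrite expr0 mul1r => h.
  by rewrite -[gs n x](subrK (f v)) (le_trans (ler_normD _ _)) // addrC lerD2l.
have [h [G [pG Gh hG]]] := bounded_functions_cluster gsb.
have FG : Filter G by exact: pG.
have gsV n m w a : (m <= n)%N -> size w = m -> V0 a -> gs n (phi_ w a) = g n (phi_ w a).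
  move=> mn sw Va; have [|u su <-] := @vertex_up w a n _ Va; first by rewrite sw.
  by have [-> //] := hgs n.
have hV x : V0 x -> h x = f x.
  move=> Vx; have GE : G [set k : T -> R | k x = f x].
    apply: hG; exists 0%N => n _ /=; rewrite (gsV n 0%N [::] x) //=.
    by case: (hg n) => ->.
  apply/eqP; rewrite eq_le; apply/andP; split.
    by apply: filter_limit_le (Gh x) _; apply: filterS GE => k /= ->.
  rewrite -lerN2; apply: (@filter_limit_le _ _ G (fun k => - k x)) => //.
    exact: cvgN.
  by apply: filterS GE => k /= ->.
have henergy m : energy_ S m h <= eform0 S f f.
  apply/ler_addgt0Pr => e e0; rewrite energyE.
  apply: (@filter_limit_le _ _ G (fun k => eform_ S m k k)) => //.
    exact: cvg_eform.
  have [N0 hN0] : exists N, forall n, (N <= n)%N -> n.+1%:R^-1 <= e.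
    exists (Num.truncn e^-1) => n hn; rewrite -[e]invrK lef_pV2 ?posrE ?invr_gt0 // ltW //.
    have e10 : 0 <= e^-1 by rewrite invr_ge0 ltW.
    have /andP[_ /lt_le_trans] := truncn_itv e10; apply.
    by rewrite ler_nat.
  apply: hG; exists (maxn m N0) => n; rewrite geq_max => /andP[mn Nn] /=.
  have -> : eform_ S m (gs n) (gs n) = eform_ S m (g n) (g n).
    congr (_ * _); apply: eq_bigr => w _.
    by apply: eq_eform0 => x Vx /=; rewrite (gsV n m) // size_tuple.
  apply: le_trans (eform_le _ _ mn) _; case: (hg n) => _ /le_trans; apply.
  by rewrite lerD2l hN0.
exists h; split=> //; split; last by exists (eform0 S f f) => _ [m _ <-].
apply: oscillation_continuous => e e0.
have q01 : 0 <= q < 1.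
  rewrite sqrtr_ge0 -[X in _ < X]sqrtr1 ltr_sqrt // invf_lt1 ?rho_gt0 //.
  exact: hs_rho_gt1.
have D0 : 0 < 2 * C * Num.sqrt B + 1 by rewrite ltr_wpDl // mulr_ge0 ?sqrtr_ge0 // mulr_ge0 // ltW.
have [k hk] := expr_lt_eps q01 (divr_gt0 e0 D0); have {}hk := hk k (leqnn k).
exists k => w x y sw wx wy.
apply: (@filter_limit_le _ _ G (fun k => `|k x - k y|)) => //.
  by apply: cvg_norm; apply: cvgB.
apply: hG; exists k => n kn /=; rewrite -sw in kn.
apply: le_trans (osc2 n w x y kn wx wy) _; rewrite sw.
rewrite ltr_pdivlMr // in hk; apply: le_trans (ltW hk).
have : 0 <= q ^+ k by rewrite exprn_ge0 //; case/andP: q01.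
set s := Num.sqrt B; set t := q ^+ k; lra.
Qed.

End harmonic_extensions.

(** * The energy form on its domain *)

Section energy_form_domain.
Context {R : realType} {F : nestedFractal R}.
Variable S : harmonicStructure F.
Local Notation T := 'rV[R]_(nfN F).
Local Notation M := (nfM F).
Local Notation K := (nfK F).
Local Notation V0 := (nfV0 F).
Local Notation phi_ := (word_map (nfphi F)).
Local Notation rho := (hs_rho S).
Local Notation vs := (fset_set V0).
Local Notation dom := (energy_dom S).
Local Notation form := (energy_form S).
Implicit Types (f g h : T -> R) (w : seq 'I_M) (x y : T).

Lemma energy_cvg f : dom f -> eform_ S m f f @[m --> \oo] --> energy S f.
Proof.
move=> [_ ub]; rewrite /energy.
have -> : energy_ S ^~ f = fun m => eform_ S m f f by apply/funext => m; rewrite energyE.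
apply: nondecreasing_is_cvgn => [m n|]; first exact: eform_le.
by case: ub => B hB; exists B => _ [m _ <-]; rewrite -energyE; apply: hB; exists m.
Qed.

Lemma eform_le_energy m f : dom f -> eform_ S m f f <= energy S f.
Proof.
move=> df; have c := energy_cvg df; rewrite -(cvg_lim _ c) //.
apply: nondecreasing_cvgn_le; last by apply/cvg_ex; exists (energy S f).
by move=> i j; exact: eform_le.
Qed.

Lemma energy_le f B : dom f -> (forall m, eform_ S m f f <= B) -> energy S f <= B.
Proof.
move=> df hB; apply: filter_limit_le (energy_cvg df) _.
by exists 0%N => // m _; exact: hB.
Qed.

Lemma eform_expand m a f g :
  eform_ S m (fun x => a * f x + g x) (fun x => a * f x + g x) =
  a ^+ 2 * eform_ S m f f + 2 * a * eform_ S m f g + eform_ S m g g.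
Proof.
have l h : eform_ S m (fun x => a * f x + g x) h =
    a * eform_ S m f h + eform_ S m g h by exact: eform_P.
have r h : eform_ S m h (fun x => a * f x + g x) =
    a * eform_ S m h f + eform_ S m h g.
  by rewrite eform_C l (eform_C S m f) (eform_C S m g).
rewrite l !r (eform_C S m g f); ring.
Qed.

Lemma dom_comb a f g : dom f -> dom g -> dom (fun x => a * f x + g x).
Proof.
move=> df dg; split.
  move=> x; apply: cvgD; last exact: (proj1 dg).
  by apply: cvgM; [exact: cvg_cst|exact: (proj1 df)].
exists (2 * (a ^+ 2 * energy S f + energy S g)) => _ [m _ <-].
rewrite energyE; apply: (@le_trans _ _ (2 * (a ^+ 2 * eform_ S m f f + eform_ S m g g))).
  have := eform_ge0 S m (fun x => (- a) * f x + g x).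
  by rewrite !eform_expand sqrrN; lra.
rewrite ler_pM2l // lerD ?eform_le_energy //.
by rewrite ler_wpM2l ?sqr_ge0 // eform_le_energy.
Qed.

Lemma eform_cst m c g : eform_ S m (cst c) g = 0.
Proof.
rewrite /eform_ big1 ?mulr0 // => w _; rewrite /eform0 big1 ?mulr0 // => x _.
by rewrite big1 // => y _; rewrite /= subrr mul0r mulr0.
Qed.

Lemma dom_cst c : dom (cst c).
Proof.
split; first by move=> x; exact: cvg_cst.
by exists 0 => _ [m _ <-]; rewrite energyE eform_cst.
Qed.

Lemma dom_ext f g : (forall x, K x -> f x = g x) -> dom f -> dom g.
Proof.
move=> fg [cf [B hB]]; split; last first.
  exists B => _ [m _ <-]; rewrite energyE -(eq_eform_ S m fg fg) -energyE.
  by apply: hB; exists m.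
move/subspace_continuousP : cf => cf; apply/subspace_continuousP => x Kx.
have cfx : f y @[y --> within K (nbhs x)] --> f x := cf x Kx.
suff : g y @[y --> within K (nbhs x)] --> g x by [].
rewrite -fg //; apply: cvg_trans cfx; apply: near_eq_cvg.
by rewrite near_withinE; apply: nearW => y; exact: fg.
Qed.

Lemma eq_energy f g : (forall x, K x -> f x = g x) -> energy S f = energy S g.
Proof.
move=> fg; rewrite /energy; have -> // : energy_ S ^~ f = energy_ S ^~ g.
by apply/funext => m; rewrite !energyE; exact: eq_eform_.
Qed.

Lemma eq_form f f' g g' : (forall x, K x -> f x = f' x) ->
  (forall x, K x -> g x = g' x) -> form f g = form f' g'.
Proof.
move=> ff gg; rewrite /energy_form; congr (_ * (_ - _)); apply: eq_energy => x Kx /=.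
  by rewrite ff ?gg.
by rewrite ff ?gg.
Qed.

(** Bilinearity is obtained in this way from the discrete forms. *)
Lemma form_cvg f g : dom f -> dom g -> eform_ S m f g @[m --> \oo] --> form f g.
Proof.
move=> df dg.
have dD : dom (f \+ g).
  by apply: dom_ext (dom_comb 1 df dg) => x _; rewrite mul1r.
have dB : dom (f \- g).
  by apply: dom_ext (dom_comb (-1) dg df) => x _ /=; rewrite mulN1r addrC.
have -> : (fun m => eform_ S m f g) = (fun m =>
    4^-1 * (eform_ S m (f \+ g) (f \+ g) - eform_ S m (f \- g) (f \- g))).
  apply/funext => m.
  rewrite (@eq_eform_ _ _ S m (f \+ g) (fun x => 1 * f x + g x) (f \+ g) (fun x => 1 * f x + g x));
    [|by move=> x _ /=; rewrite mul1r|by move=> x _ /=; rewrite mul1r].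
  rewrite (@eq_eform_ _ _ S m (f \- g) (fun x => -1 * g x + f x) (f \- g) (fun x => -1 * g x + f x));
    [|by move=> x _ /=; rewrite mulN1r addrC|by move=> x _ /=; rewrite mulN1r addrC].
  by rewrite !eform_expand (eform_C S m g f); field.
apply: cvgM; first exact: cvg_cst.
by apply: cvgB; exact: energy_cvg.
Qed.

Lemma form_unique f g (u : nat -> R) a : dom f -> dom g ->
  (forall m, eform_ S m f g = u m) -> u m @[m --> \oo] --> a -> form f g = a.
Proof.
move=> df dg uE ua; have := form_cvg df dg.
have -> : (fun m => eform_ S m f g) = u by apply/funext.
by move=> fu; exact: (cvg_unique (@Rhausdorff R) fu ua).
Qed.

Lemma formC f g : dom f -> dom g -> form f g = form g f.
Proof.
move=> df dg; apply: (form_unique df dg (fun m => eform_C S m f g)).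
exact: form_cvg.
Qed.

Lemma form_comb a f g h : dom f -> dom g -> dom h ->
  form (fun x => a * f x + g x) h = a * form f h + form g h.
Proof.
move=> df dg dh; apply: (form_unique (dom_comb a df dg) dh (fun m => eform_P S m a f g h)).
apply: cvgD; last exact: form_cvg.
by apply: cvgM; [exact: cvg_cst|exact: form_cvg].
Qed.

Lemma form_cst c g : dom g -> form (cst c) g = 0.
Proof.
by move=> dg; apply: (form_unique (dom_cst c) dg (fun m => eform_cst m c g)); exact: cvg_cst.
Qed.

Lemma form_self f : dom f -> form f f = energy S f.
Proof. by move=> df; apply: (form_unique df df (fun=> erefl)); exact: energy_cvg. Qed.

Lemma dom_sum n (c : 'I_n -> R) (e : 'I_n -> T -> R) (s : seq 'I_n) :
  (forall k, dom (e k)) -> dom (fun x => \sum_(k <- s) c k * e k x).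
Proof.
move=> de; elim: s => [|k s IH].
  by apply: dom_ext (dom_cst 0) => x _; rewrite big_nil.
by apply: dom_ext (dom_comb (c k) (de k) IH) => x _; rewrite big_cons.
Qed.

Lemma form_sum n (c : 'I_n -> R) (e : 'I_n -> T -> R) (s : seq 'I_n) g :
  (forall k, dom (e k)) -> dom g ->
  form (fun x => \sum_(k <- s) c k * e k x) g = \sum_(k <- s) c k * form (e k) g.
Proof.
move=> de dg; elim: s => [|k s IH].
  rewrite big_nil -[RHS](form_cst 0 dg).
  by apply: eq_form => // x _; rewrite big_nil.
rewrite big_cons -IH -form_comb //; last exact: dom_sum.
by apply: eq_form => // x _; rewrite big_cons.
Qed.

Lemma dom_word w f : dom f -> dom (f \o phi_ w).
Proof.
move=> df; split.
  apply/subspace_continuousP => x Kx.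
  have Kwx : K (phi_ w x) by exact: word_map_K.
  have /subspace_continuousP/(_ _ Kwx) cf := proj1 df.
  apply: cvg_comp cf => A hA.
  have := @word_map_continuous R F w x _ (hA : nbhs _ (fun y => K y -> A y)).
  move=> hx; have {}hx : nbhs x (fun y => K (phi_ w y) -> A (phi_ w y)) by [].
  suff : nbhs x (fun y => K y -> A (phi_ w y)) by [].
  by apply: filterS hx => y /= hy Ky; apply: hy; exact: word_map_K.
exists ((rho ^+ size w)^-1 * energy S f) => _ [m _ <-].
rewrite energyE ler_pdivlMl ?exprn_gt0 ?rho_gt0 //.
apply: le_trans (eform_cell_le S m w f) _; exact: eform_le_energy.
Qed.

Lemma dom_phi i f : dom f -> dom (f \o nfphi F i).
Proof. exact: (@dom_word [:: i]). Qed.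

Lemma form_cells f g : dom f -> dom g ->
  form f g = rho * \sum_i form (f \o nfphi F i) (g \o nfphi F i).
Proof.
move=> df dg; have fS : eform_ S m.+1 f g @[m --> \oo] --> form f g.
  by rewrite (cvg_shiftS (fun m => eform_ S m f g)); exact: form_cvg.
apply: (cvg_unique (@Rhausdorff R) fS).
have -> : (fun m => eform_ S m.+1 f g) = fun m =>
    rho * \sum_i eform_ S m (f \o nfphi F i) (g \o nfphi F i).
  by apply/funext => m; exact: eform_S.
apply: cvgM; first exact: cvg_cst.
by apply: cvg_sumr => i; apply: form_cvg; exact: dom_phi.
Qed.

(** The optimal extension has no more energy than the boundary values, and
    energies increase with the generation, so no function has less. *)
Lemma harmonic_extension_energy f h : is_harmonic_extension S f h ->
  energy S h = eform0 S f f.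
Proof.
move=> [dh hf hmin]; apply/eqP; rewrite eq_le; apply/andP; split.
  have [g [dg gf hg]] := optimal_extension S f.
  apply: le_trans (hmin g dg gf) _; apply: energy_le => // m.
  by rewrite -energyE.
apply: le_trans (eform_le_energy 0 dh); rewrite eform_00.
by rewrite (eq_eform0 S hf hf).
Qed.

Lemma harmonicP h : dom h -> energy S h = eform0 S h h -> is_harmonic S h.
Proof.
move=> dh hE; split=> // g dg gh; rewrite hE -(eq_eform0 S gh gh) -eform_00.
exact: eform_le_energy.
Qed.

Lemma harmonic_extensionP f : is_harmonic_extension S f (harmonic_extension S f).
Proof.
have [h [dh hf hE]] := optimal_extension S f.
apply: (@xgetPex _ (cst 0) [set h | is_harmonic_extension S f h]).
exists h; split=> // g dg gf; apply: (@le_trans _ _ (eform0 S f f)).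
  by apply: energy_le => // m; rewrite -energyE.
by rewrite -(eq_eform0 S gf gf) -eform_00; exact: eform_le_energy.
Qed.

Lemma harmonic_extension_harmonic f : is_harmonic S (harmonic_extension S f).
Proof.
have hP := harmonic_extensionP f; have [dh hf _] := hP.
by apply: harmonicP => //; rewrite (harmonic_extension_energy hP) (eq_eform0 S hf hf).
Qed.

Lemma harmonic_dom h : is_harmonic S h -> dom h. Proof. by case. Qed.

(** Harmonicity is the vanishing of a nonnegative quadratic form, the energy minus
    the energy of the boundary values, and the null vectors of such a form make
    up a linear space. *)
Lemma harmonic_comb a g h : is_harmonic S g -> is_harmonic S h ->
  is_harmonic S (fun x => a * g x + h x).
Proof.
move=> hg hh; have dg := harmonic_dom hg; have dh := harmonic_dom hh.
have Eg := harmonic_extension_energy hg; have Eh := harmonic_extension_energy hh.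
have expand c : energy S (fun x => c * g x + h x) =
    c ^+ 2 * energy S g + 2 * c * form g h + energy S h.
  have dc := dom_comb c dg dh; rewrite -!form_self //.
  have l k : dom k -> form (fun x => c * g x + h x) k = c * form g k + form h k.
    by move=> dk; exact: form_comb.
  by rewrite l // (formC dg dc) (formC dh dc) !l // (formC dh dg); ring.
have expand0 c : eform0 S (fun x => c * g x + h x) (fun x => c * g x + h x) =
    c ^+ 2 * eform0 S g g + 2 * c * eform0 S g h + eform0 S h h.
  by rewrite -!eform_00 eform_expand.
have dom_c c := dom_comb c dg dh.
apply: harmonicP => //; apply/eqP; rewrite eq_le; apply/andP; split.
  have := eform_le_energy 0 (dom_c (- a)).
  by rewrite eform_00 expand expand0 expand expand0 Eg Eh; lra.
by rewrite -eform_00; exact: eform_le_energy.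
Qed.

Lemma harmonic_cst c : is_harmonic S (cst c).
Proof.
apply: harmonicP; first exact: dom_cst.
by rewrite -form_self ?form_cst -?eform_00 ?eform_cst //; exact: dom_cst.
Qed.

(** The energy is the sum of the rescaled energies over the cells, and for a
    harmonic function every term has to be as small as its boundary values
    allow. *)
Lemma harmonic_phi i h : is_harmonic S h -> is_harmonic S (h \o nfphi F i).
Proof.
move=> hh; have dh := harmonic_dom hh; have dj j := dom_phi j dh.
apply: harmonicP => //.
have hE := harmonic_extension_energy hh.
have le j : eform0 S (h \o nfphi F j) (h \o nfphi F j) <= energy S (h \o nfphi F j).
  by rewrite -eform_00; exact: eform_le_energy.
have sum0 : \sum_j (energy S (h \o nfphi F j) - eform0 S (h \o nfphi F j) (h \o nfphi F j)) = 0.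
  apply/eqP; rewrite eq_le; apply/andP; split; last first.
    by apply: sumr_ge0 => j _; rewrite subr_ge0.
  rewrite sumrB subr_le0 -(ler_pM2l (rho_gt0 S)).
  have -> : rho * \sum_j energy S (h \o nfphi F j) = eform0 S h h.
    rewrite -hE -form_self // form_cells //; congr (_ * _).
    by apply: eq_bigr => j _; rewrite form_self.
  have -> : rho * \sum_j eform0 S (h \o nfphi F j) (h \o nfphi F j) = eform_ S 1 h h.
    by rewrite eform_S; congr (_ * _); apply: eq_bigr => j _; rewrite eform_00.
  exact: eform0_le_eform1.
apply/eqP; rewrite -subr_eq0.
have := psumr_eq0P _ sum0; move=> /(_ (fun j _ => _)) ->//.
by move=> j; rewrite subr_ge0; exact: le.
Qed.

End energy_form_domain.

(** * Coordinates of harmonic functions *)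

Section harmonic_coordinates.
Context {R : realType} {F : nestedFractal R}.
Variable S : harmonicStructure F.
Local Notation T := 'rV[R]_(nfN F).
Local Notation M := (nfM F).
Local Notation K := (nfK F).
Local Notation V0 := (nfV0 F).
Local Notation phi_ := (word_map (nfphi F)).
Local Notation rho := (hs_rho S).
Local Notation vs := (fset_set V0).
Local Notation dom := (energy_dom S).
Local Notation form := (energy_form S).
Implicit Types (f g h : T -> R) (w : seq 'I_M) (x y : T).

Definition boundary_sum f : R := \sum_(x <- vs) f x.
Local Notation nV := ((size vs)%:R : R).

Lemma nV_gt0 : 0 < nV.
Proof. by rewrite ltr0n; apply: leq_trans (nf_card_V0 F). Qed.

Lemma boundary_sumE f : \sum_(x \in V0) f x = boundary_sum f.
Proof. by rewrite (fsbig_finite _ _ (@V0_finite R F)). Qed.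

Lemma boundary_sum_cst c : boundary_sum (cst c) = c * nV.
Proof. by rewrite /boundary_sum big_const_seq count_predT iter_addr_0 mulr_natr. Qed.

Lemma harmonic_dot_cst f c : dom f -> harmonic_dot S f (cst c) = boundary_sum f * (c * nV).
Proof.
move=> df; rewrite /harmonic_dot formC ?form_cst ?add0r //; last exact: dom_cst.
by rewrite !boundary_sumE boundary_sum_cst.
Qed.

Lemma HtildeP h : Htilde S h <-> is_harmonic S h /\ boundary_sum h = 0.
Proof.
split=> -[hh h0]; split=> //.
  have := h0 1; rewrite harmonic_dot_cst ?mul1r; last exact: harmonic_dom.
  by move/eqP; rewrite mulf_eq0 (gt_eqF nV_gt0) orbF => /eqP.
by move=> c; rewrite harmonic_dot_cst ?h0 ?mul0r //; exact: harmonic_dom.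
Qed.

Lemma PtildeE h : dom h -> Ptilde S h = fun x => h x - boundary_sum h / nV.
Proof.
move=> dh; apply/funext => x; rewrite /Ptilde !harmonic_dot_cst //; last exact: dom_cst.
rewrite boundary_sum_cst !mul1r; congr (_ - _).
by field; rewrite gt_eqF ?nV_gt0.
Qed.

Lemma Ptilde_comb h : dom h ->
  Ptilde S h = fun x => 1 * h x + cst (- (boundary_sum h / nV)) x.
Proof. by move=> dh; rewrite PtildeE //; apply/funext => x; rewrite mul1r. Qed.

Lemma dom_Ptilde h : dom h -> dom (Ptilde S h).
Proof. by move=> dh; rewrite Ptilde_comb //; apply: dom_comb => //; exact: dom_cst. Qed.

Lemma form_Ptilde h g : dom h -> dom g -> form (Ptilde S h) g = form h g.
Proof.
move=> dh dg; rewrite Ptilde_comb // form_comb // ?form_cst ?addr0 ?mul1r //.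
exact: dom_cst.
Qed.

Lemma Htilde_Ptilde h : is_harmonic S h -> Htilde S (Ptilde S h).
Proof.
move=> hh; have dh := harmonic_dom hh; apply/HtildeP; split.
  by rewrite Ptilde_comb //; apply: harmonic_comb => //; exact: harmonic_cst.
rewrite PtildeE // /boundary_sum sumrB big_const_seq count_predT iter_addr_0.
by rewrite -[X in _ - X]mulr_natr divfK ?subrr // gt_eqF // nV_gt0.
Qed.

Lemma Htilde_dom h : Htilde S h -> dom h.
Proof. by case=> /harmonic_dom. Qed.

Lemma Htilde_Mtilde i h : Htilde S h -> Htilde S (Mtilde S i h).
Proof. by case=> hh _; apply: Htilde_Ptilde; exact: harmonic_phi. Qed.

Section basis.
Variables (n : nat) (e : 'I_n -> T -> R).
Hypothesis he : orthonormal_basis S e.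

Lemma basis_Htilde k : Htilde S (e k). Proof. by case: he. Qed.

Lemma basis_dom k : dom (e k). Proof. exact: Htilde_dom (basis_Htilde k). Qed.

Lemma basis_form k l : form (e k) (e l) = (k == l)%:R. Proof. by case: he. Qed.

Lemma basis_expand h : Htilde S h -> forall x, K x ->
  h x = \sum_(k < n) form h (e k) * e k x.
Proof.
move=> hh x Kx; case: he => _ _ /(_ h hh)[c hc].
have hK y : K y -> h y = \sum_(k < n) c k * e k y by move=> Ky; apply: hc; rewrite inE.
have cE k : form h (e k) = c k.
  have ee : forall y, K y -> e k y = e k y by [].
  rewrite (eq_form S hK ee) form_sum //; [|by move=> j; exact: basis_dom|exact: basis_dom].
  rewrite (bigD1 k) //= basis_form eqxx mulr1 big1 ?addr0 // => j jk.
  by rewrite basis_form (negPf jk) mulr0.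
by rewrite hK //; apply: eq_bigr => k _; rewrite cE.
Qed.

Lemma basis_parseval h g : Htilde S h -> dom g ->
  form h g = \sum_(k < n) form h (e k) * form g (e k).
Proof.
move=> hh dg; rewrite (eq_form S (basis_expand hh) (fun y (_ : K y) => erefl (g y))).
rewrite form_sum //; last by move=> j; exact: basis_dom.
by apply: eq_bigr => k _; rewrite (formC dg (basis_dom k)).
Qed.

Lemma coord_tilde_sqr h : Htilde S h ->
  ((coord_tilde S e h)^T *m coord_tilde S e h) 0 0 = energy S h.
Proof.
move=> hh; rewrite -form_self; last exact: Htilde_dom.
rewrite (basis_parseval hh); last exact: Htilde_dom.
by rewrite mxE; apply: eq_bigr => k _; rewrite !mxE.
Qed.

(** The matrix form of the self-similarity of the energy. *)
Lemma Mmat_sum : rho *: \sum_i (Mmat S e i)^T *m Mmat S e i = 1%:M.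
Proof.
apply/matrixP => k l; rewrite mxE summxE mxE -basis_form.
rewrite form_cells; [|exact: basis_dom|exact: basis_dom].
congr (_ * _); apply: eq_bigr => i _.
have hk j : is_harmonic S (e j \o nfphi F i).
  by apply: harmonic_phi; case: (basis_Htilde j).
have dk j := harmonic_dom (hk j).
transitivity (form (Mtilde S i (e k)) (Mtilde S i (e l))); last first.
  rewrite form_Ptilde // ?(formC _ (dom_Ptilde _)) ?form_Ptilde // 1?formC //.
  exact: dom_Ptilde.
have hM j : Htilde S (Mtilde S i (e j)) by exact: Htilde_Mtilde (basis_Htilde j).
rewrite (basis_parseval (hM k)); last exact: Htilde_dom.
by rewrite mxE; apply: eq_bigr => j _; rewrite !mxE.
Qed.

Hypothesis nd : nondegenerate_structure S.

(** Preimages of the basis functions are the columns of a right inverse. *)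
Lemma Mmat_unit i : Mmat S e i \in unitmx.
Proof.
have /choice[g hg] : forall k, exists g, Htilde S g /\
    (forall x, K x -> Mtilde S i g x = e k x).
  move=> k; have [g [gH gk _]] := nd i (basis_Htilde k).
  by exists g; split=> // x Kx; apply: gk; rewrite inE.
have dphi l : dom (e l \o nfphi F i) by apply: dom_phi; exact: basis_dom.
pose B := \matrix_(l, k) form (g k) (e l).
have MB : Mmat S e i *m B = 1%:M.
  apply/matrixP => j k; rewrite !mxE.
  have [gH gk] := hg k; have dg := Htilde_dom gH.
  transitivity (form (e k) (e j)); last by rewrite basis_form eq_sym.
  have ee : forall y, K y -> e j y = e j y by [].
  rewrite -(eq_form S gk ee) form_Ptilde; [|exact: dom_phi|exact: basis_dom].
  have gE y : K y -> (g k \o nfphi F i) y = \sum_(l < n) form (g k) (e l) * (e l \o nfphi F i) y.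
    by move=> Ky; rewrite /= (basis_expand gH) //; exact: phi_K.
  rewrite (eq_form S gE ee) form_sum //; last exact: basis_dom.
  apply: eq_bigr => l _; rewrite !mxE mulrC; congr (_ * _).
  by rewrite form_Ptilde //; exact: basis_dom.
by case/mulmx1_unit: MB.
Qed.

Lemma Mword_unit w : Mword S e w \in unitmx.
Proof.
by elim: w => [|i w IH] /=; rewrite ?unitmx1 // unitmx_mul IH Mmat_unit.
Qed.

Lemma Mword_cat u w : Mword S e (u ++ w) = Mword S e w *m Mword S e u.
Proof. by elim: u => [|i u IH] /=; rewrite ?mulmx1 // IH mulmxA. Qed.

(** The identity [Mmat_sum] conjugated by the matrix of a word; this is the
    martingale property of the Gram matrices. *)
Lemma Mword_gram_split w :
  (Mword S e w)^T *m Mword S e w =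
  rho *: \sum_i (Mword S e (rcons w i))^T *m Mword S e (rcons w i).
Proof.
have E i : (Mword S e (rcons w i))^T *m Mword S e (rcons w i) =
    (Mword S e w)^T *m ((Mmat S e i)^T *m Mmat S e i) *m Mword S e w.
  by rewrite -cats1 Mword_cat /= mul1mx trmx_mul !mulmxA.
under eq_bigr do rewrite E.
by rewrite -mulmx_suml -mulmx_sumr scalemxAl scalemxAr Mmat_sum mulmx1.
Qed.

(** Projecting off the constants and passing to coordinates preserve the energy,
    which for a harmonic extension is that of the boundary values. *)
Lemma gradient_coord_sqr f :
  let u := coord_tilde S e (Ptilde S (harmonic_extension S f)) in
  (u^T *m u) 0 0 = eform0 S f f.
Proof.
move=> u; have hh := harmonic_extension_harmonic S f.
rewrite coord_tilde_sqr; last exact: Htilde_Ptilde.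
have dh := harmonic_dom hh.
rewrite -form_self ?form_Ptilde ?(formC dh) ?form_Ptilde //; try exact: dom_Ptilde.
by rewrite form_self //; apply: harmonic_extension_energy; exact: harmonic_extensionP.
Qed.

End basis.
End harmonic_coordinates.

(** * Martingales on the tree of words *)

Section regular_points.
Context {R : realType}.
Variable F : nestedFractal R.
Local Notation T := 'rV[R]_(nfN F).
Local Notation M := (nfM F).
Local Notation K := (nfK F).
Local Notation Vinf := (@Vinf R F).
Local Notation BT := (borelRV R (nfN F)).
Implicit Types (u v w : seq 'I_M) (x y : T).

(** The points of a cell that have a single address. *)
Definition rcell w : set T := cell w `\` Vinf.

Lemma measurable_Vinf : measurable (Vinf : set BT).
Proof. by apply: countable_borel; exact: countable_Vinf. Qed.

Lemma measurable_rcell w : measurable (rcell w : set BT).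
Proof. by apply: measurableD; [exact: measurable_cell|exact: measurable_Vinf]. Qed.

Lemma rcell_prefix w x : rcell w x -> address_prefix x (size w) = w.
Proof. by case=> wx nV; exact: address_prefixE. Qed.

Lemma prefix_rcell x m : rcell [::] x -> rcell (address_prefix x m) x.
Proof. by rewrite /rcell cell_nil => -[Kx nV]; split=> //; exact: address_prefix_cell. Qed.

Lemma rcell_nil_sub w : rcell w `<=` rcell [::].
Proof. by move=> x [wx nV]; split=> //; rewrite cell_nil; exact: cell_sub_K wx. Qed.

Lemma rcell_disjoint u v : size u = size v -> u <> v -> rcell u `&` rcell v = set0.
Proof.
move=> suv uv; rewrite -subset0 => x [/rcell_prefix ux /rcell_prefix vx].
by apply: uv; rewrite -ux -vx suv.
Qed.

Lemma measurable_prefix_set m (P : seq 'I_M -> Prop) :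
  measurable ([set x | rcell [::] x /\ P (address_prefix x m)] : set BT).
Proof.
have -> : [set x | rcell [::] x /\ P (address_prefix x m)] =
    \bigcup_(t in [set t : m.-tuple 'I_M | P t]) rcell t.
  apply/seteqP; split => x.
    move=> [xK Px]; have sp : size (address_prefix x m) == m by rewrite size_address_prefix.
    by exists (Tuple sp) => //; exact: prefix_rcell.
  move=> [t /= Pt tx]; split; first exact: rcell_nil_sub tx.
  by rewrite -(rcell_prefix tx) size_tuple in Pt.
apply: fin_bigcup_measurable => [|t _]; [exact: finite_finset|exact: measurable_rcell].
Qed.

Lemma measurable_prefix_fun d (Y : measurableType d) m (G : seq 'I_M -> Y) :
  measurable_fun (rcell [::] : set BT) (fun x : BT => G (address_prefix x m)).
Proof.
move=> _ B mB; have := measurable_prefix_set m (fun w => B (G w)).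
by congr (measurable _); apply/seteqP; split.
Qed.

Section no_atoms.
Variable nu : {measure set (borelRV R (nfN F)) -> \bar R}.
Hypothesis nu_atomless : forall x, nu [set x] = 0%E.

Lemma atomless_countable (A : set T) : countable A -> nu A = 0%E.
Proof.
move=> cA; have [->|/set0P[r Ar]] := eqVneq A set0; first exact: measure0.
have /pfcard_geP[A0|[f]] := cA; first by rewrite A0 in Ar.
apply/eqP; rewrite eq_le measure_ge0 andbT.
apply: (@le_trans _ _ (\sum_(0 <= i <oo) nu [set f i])%E); last first.
  by rewrite eseries0.
apply: measure_sigma_subadditive => [i||x Ax].
- exact: set1_borel.
- exact: countable_borel.
by have [i _ <-] := @surj _ _ _ _ f x Ax; exists i.
Qed.

Lemma nu_rcell w : nu (rcell w) = nu (cell w).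
Proof.
have mc := measurable_cell w; have mV := measurable_Vinf.
rewrite -[in RHS](setDUK (_ : cell w `&` Vinf `<=` cell w)); last exact: subIsetl.
have e : cell w `\` (cell w `&` Vinf) = rcell w.
  by rewrite setDIr setDv set0U.
rewrite e measureU; [|exact: measurableI|exact: measurable_rcell|].
  rewrite [X in (_ = X + _)%E](_ : _ = 0%E) ?add0e //.
  by apply: atomless_countable; apply: sub_countable (@countable_Vinf R F); exact: subset_card_le.
by rewrite -subset0 => x [[_ xV] [_ nxV]].
Qed.

End no_atoms.
End regular_points.

(** A bounded martingale for the filtration given by the generations of cells:
    an additive function [s] of words dominated by the masses [p]. *)
Section tree_martingale.
Context {R : realType}.
Variable F : nestedFractal R.
Local Notation T := 'rV[R]_(nfN F).
Local Notation M := (nfM F).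
Local Notation K := (nfK F).
Local Notation BT := (borelRV R (nfN F)).
Implicit Types (u v w : seq 'I_M) (y : T).
Variable nu : {measure set (borelRV R (nfN F)) -> \bar R}.
Hypothesis nu_atomless : forall y, nu [set y] = 0%E.
Variables p s : seq 'I_M -> R.
Hypothesis nu_p : forall w, nu (cell w) = (p w)%:E.
Hypothesis p_add : forall w, p w = \sum_i p (rcons w i).
Hypothesis s_add : forall w, s w = \sum_i s (rcons w i).
Hypothesis s_le : forall w, `|s w| <= p w.

Definition density w : R := s w / p w.
Local Notation X := density.

Lemma mass_ge0 w : 0 <= p w.
Proof. exact: le_trans (normr_ge0 _) (s_le w). Qed.

(** Where the mass vanishes so does [s], and the conventional value of the
    quotient does no harm. *)
Lemma mass_density w : p w * X w = s w.
Proof.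
have [p0|p0] := eqVneq (p w) 0; last by rewrite /X mulrC divfK.
have := s_le w; rewrite p0 normr_le0 => /eqP->.
by rewrite mul0r.
Qed.

Lemma additive_cat (a : seq 'I_M -> R) : (forall w, a w = \sum_i a (rcons w i)) ->
  forall n w, a w = \sum_(t : n.-tuple 'I_M) a (w ++ t).
Proof.
move=> aS; elim=> [|n IH] w.
  by rewrite (sum_tuple0 (fun t => a (w ++ t))) cats0.
rewrite (sum_tuple_cons _ (fun t => a (w ++ t))) aS; apply: eq_bigr => i _.
by rewrite IH; apply: eq_bigr => t _; rewrite cat_rcons.
Qed.

Definition spread n w c : R :=
  \sum_(t : n.-tuple 'I_M) p (w ++ t) * (X (w ++ t) - c) ^+ 2.

Lemma spreadS n w c : spread n.+1 w c = \sum_i spread n (rcons w i) c.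
Proof.
rewrite /spread (sum_tuple_cons _ (fun t => p (w ++ t) * (X (w ++ t) - c) ^+ 2)).
by apply: eq_bigr => i _; apply: eq_bigr => t _; rewrite cat_rcons.
Qed.

Lemma spread_ge0 n w c : 0 <= spread n w c.
Proof. by apply: sumr_ge0 => t _; rewrite mulr_ge0 ?mass_ge0 ?sqr_ge0. Qed.

(** The identity of Huygens: the mean square deviation from [c] is the one from
    the mean, [X w], plus the squared distance of [c] to the mean. *)
Lemma spread_center n w c : spread n w c = spread n w (X w) + p w * (X w - c) ^+ 2.
Proof.
have E c' : spread n w c' =
    \sum_(t : n.-tuple 'I_M) p (w ++ t) * X (w ++ t) ^+ 2 - 2 * c' * s w + c' ^+ 2 * p w.
  rewrite (additive_cat s_add n w) (additive_cat p_add n w) !mulr_sumr -sumrB -big_split /=.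
  by apply: eq_bigr => t _; rewrite -(mass_density (w ++ t)); ring.
by rewrite !E -(mass_density w); ring.
Qed.

Definition deviates lambda n w c : set T := [set y | rcell w y /\
  exists2 j, (j <= n)%N & lambda < `|X (address_prefix y (size w + j)) - c|].

Lemma measurable_deviates lambda n w c : measurable (deviates lambda n w c : set BT).
Proof.
pose P v := take (size w) v = w /\
  exists2 j, (j <= n)%N & lambda < `|X (take (size w + j) v) - c|.
have := measurable_prefix_set (size w + n) P.
congr (measurable _); apply/seteqP; split => y.
- move=> [y0 [yw [j jn hj]]]; rewrite take_address_prefix ?leq_addr // in yw.
  rewrite take_address_prefix ?leq_add2l // in hj.
  split; last by exists j.
  by rewrite -yw; exact: prefix_rcell.
- move=> [wy [j jn hj]]; split; first exact: rcell_nil_sub wy.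
  split; first by rewrite take_address_prefix ?leq_addr // rcell_prefix.
  by exists j => //; rewrite take_address_prefix ?leq_add2l.
Qed.

(** Kolmogorov's maximal inequality, by induction on the number of generations:
    either the root already deviates, and convexity bounds its mass, or the
    deviation occurs inside one of the children. *)
Lemma maximal_inequality lambda n w c : 0 < lambda ->
  ((lambda ^+ 2)%:E * nu (deviates lambda n w c) <= (spread n w c)%:E)%E.
Proof.
move=> l0; have l20 : 0 < lambda ^+ 2 by rewrite exprn_gt0.
have root k v : lambda < `|X v - c| ->
    ((lambda ^+ 2)%:E * nu (deviates lambda k v c) <= (spread k v c)%:E)%E.
  move=> dev; apply: (@le_trans _ _ ((lambda ^+ 2)%:E * nu (rcell v))%E).
    rewrite lee_pmul2l ?lte_fin //; apply: le_measure; rewrite ?inE.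
    - exact: measurable_deviates.
    - exact: measurable_rcell.
    - by move=> y [].
  rewrite nu_rcell // nu_p -EFinM lee_fin spread_center.
  apply: (@le_trans _ _ (p v * (X v - c) ^+ 2)); last by rewrite lerDr spread_ge0.
  rewrite mulrC ler_wpM2l ?mass_ge0 // -[leRHS]real_normK ?num_real //.
  by rewrite ler_pXn2r ?nnegrE ?(ltW l0) // ltW.
elim: n w => [|n IH] w; (have [dev|ndev] := ltP lambda `|X w - c|; first exact: root).
  have -> : deviates lambda 0 w c = set0.
    rewrite -subset0 => y [wy [j]]; rewrite leqn0 => /eqP->.
    by rewrite addn0 rcell_prefix // => /(le_lt_trans ndev); rewrite ltxx.
  by rewrite measure0 mule0 lee_fin spread_ge0.
rewrite spreadS -sumEFin.
apply: (@le_trans _ _ (\sum_i (lambda ^+ 2)%:E * nu (deviates lambda n (rcons w i) c))%E); last first.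
  by apply: lee_sum => i _; exact: IH.
rewrite -ge0_sume_distrr ?lee_pmul2l ?lte_fin //.
apply: le_trans (measure_bigsetU_le _ _ _ _); last first.
  by move=> i; exact: measurable_deviates.
apply: le_measure; rewrite ?inE; first exact: measurable_deviates.
  by apply: bigsetU_measurable => i _; exact: measurable_deviates.
move=> y [wy [[|j] jn hj]].
  by exfalso; move: hj; rewrite addn0 rcell_prefix // => /(le_lt_trans ndev); rewrite ltxx.
rewrite -bigcup_seq; have [wy1 nVy] := wy; have [i iy] := cell_split wy1.
exists i; first by rewrite /= mem_index_enum.
split=> //; exists j => //.
by rewrite size_rcons addSnnS.
Qed.

Definition square_level n : R := \sum_(t : n.-tuple 'I_M) p t * X t ^+ 2.

Lemma sum_spread N n :
  \sum_(w : N.-tuple 'I_M) spread n w (X w) = square_level (N + n) - square_level N.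
Proof.
rewrite /square_level (sum_tuple_cat _ _ (fun t => p t * X t ^+ 2)) -sumrB.
apply: eq_bigr => w _.
have := spread_center n w 0; rewrite subr0 => h.
apply: (addIr (p w * X w ^+ 2)); rewrite -h subrK.
by apply: eq_bigr => t _; rewrite subr0.
Qed.

Lemma square_level_le N n : (N <= n)%N -> square_level N <= square_level n.
Proof.
move=> Nn; rewrite -(subnKC Nn) -subr_ge0 -sum_spread.
by apply: sumr_ge0 => w _; exact: spread_ge0.
Qed.

Lemma square_level_ub n : square_level n <= p [::].
Proof.
rewrite (additive_cat p_add n [::]); apply: ler_sum => t _ /=.
have [p0|p0] := eqVneq (p t) 0; first by rewrite p0 mul0r.
have pp : 0 < p t by rewrite lt_def p0 mass_ge0.
rewrite ler_piMr ?mass_ge0 // -[leLHS]real_normK ?num_real // exprn_ile1 //.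
by rewrite /X normrM normfV (gtr0_norm pp) ler_pdivrMr // mul1r.
Qed.

Definition oscillates lambda N : set T := [set y | rcell [::] y /\
  exists j, lambda < `|X (address_prefix y (N + j)) - X (address_prefix y N)|].

Lemma oscillatesE lambda N : oscillates lambda N =
  \bigcup_n \big[setU/set0]_(w : N.-tuple 'I_M) deviates lambda n w (X w).
Proof.
apply/seteqP; split => y.
  move=> [y0 [j hj]]; exists j => //; rewrite -bigcup_seq.
  have sp : size (address_prefix y N) == N by rewrite size_address_prefix.
  exists (Tuple sp); first by rewrite /= mem_index_enum.
  split; first exact: prefix_rcell.
  by exists j => //=; rewrite size_address_prefix.
move=> [n _]; rewrite -bigcup_seq => -[w _ [wy [j jn hj]]].
split; first exact: rcell_nil_sub wy.
have e := rcell_prefix wy; rewrite size_tuple in e hj.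
by exists j; rewrite e.
Qed.

Lemma measurable_oscillates lambda N : measurable (oscillates lambda N : set BT).
Proof.
rewrite oscillatesE; apply: bigcup_measurable => n _.
by apply: bigsetU_measurable => w _; exact: measurable_deviates.
Qed.

Lemma nu_oscillates lambda N a : 0 < lambda -> (forall n, square_level n <= a) ->
  ((lambda ^+ 2)%:E * nu (oscillates lambda N) <= (a - square_level N)%:E)%E.
Proof.
move=> l0 ha; have l20 : 0 < lambda ^+ 2 by rewrite exprn_gt0.
rewrite -lee_pdivlMl // oscillatesE.
pose A n := \big[setU/set0]_(w : N.-tuple 'I_M) deviates lambda n w (X w).
have mA n : measurable (A n : set BT).
  by apply: bigsetU_measurable => w _; exact: measurable_deviates.
have ndA : nondecreasing_seq A.
  move=> n n' nn; apply/subsetPset => y; rewrite /A -!bigcup_seq => -[w wi [wy [j jn hj]]].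
  by exists w => //; split=> //; exists j => //; exact: leq_trans jn nn.
have cA := @nondecreasing_cvg_mu _ _ _ nu A mA (bigcup_measurable (fun n _ => mA n)) ndA.
rewrite -(cvg_lim _ cA) //; apply: lime_le.
  by apply: ereal_nondecreasing_is_cvgn => i j ij; apply: le_measure; rewrite ?inE //; apply/subsetPset/ndA.
apply: nearW => n /=; rewrite lee_pdivlMl //.
apply: (@le_trans _ _ (\sum_(w : N.-tuple 'I_M) (lambda ^+ 2)%:E * nu (deviates lambda n w (X w)))%E).
  rewrite -ge0_sume_distrr ?lee_pmul2l ?lte_fin //.
  by apply: measure_bigsetU_le => w; exact: measurable_deviates.
apply: (@le_trans _ _ (\sum_(w : N.-tuple 'I_M) (spread n w (X w))%:E)%E).
  by apply: lee_sum => w _; exact: maximal_inequality.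
by rewrite sumEFin lee_fin sum_spread lerD2r.
Qed.

(** The mean squares of the generations increase and are bounded, so their
    increments beyond generation [N], which bound the oscillation, tend
    to 0. *)
Lemma nu_always_oscillates lambda : 0 < lambda ->
  nu (\bigcap_N oscillates lambda N) = 0%E.
Proof.
move=> l0; have l20 : 0 < lambda ^+ 2 by rewrite exprn_gt0.
have ub : has_ubound (range square_level).
  by exists (p [::]) => _ [n _ <-]; exact: square_level_ub.
have cv := nondecreasing_cvgn square_level_le ub.
set a := sup _ in cv.
have ha n : square_level n <= a by apply: sup_upper_bound => //; split=> //; exists (square_level 0), 0%N.
apply/eqP; rewrite eq_le measure_ge0 andbT.
apply/lee_addgt0Pr => e e0; rewrite add0e.
have /cvgrPdist_le/(_ _ (mulr_gt0 l20 e0))[N _ hN] := cv.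
apply: (@le_trans _ _ (nu (oscillates lambda N))).
  apply: le_measure; rewrite ?inE; last exact: bigcap_inf.
    by apply: bigcap_measurable => // k _; exact: measurable_oscillates.
  exact: measurable_oscillates.
rewrite -(@lee_pmul2l _ (lambda ^+ 2)%:E) ?lte_fin //.
apply: le_trans (nu_oscillates N l0 ha) _; rewrite -EFinM lee_fin.
exact: le_trans (ler_norm _) (hN N (leqnn N)).
Qed.

(** Off a null set and for every [j], some density is approximated within
    [1 / (j + 1)] by all the later ones, so the densities form a Cauchy
    sequence. *)
Lemma martingale_cvg : exists A : set T, [/\ measurable (A : set BT), nu A = 0%E &
  forall y, rcell [::] y -> ~ A y -> cvgn (fun m => X (address_prefix y m))].
Proof.
pose lam (j : nat) : R := j.+1%:R^-1.
have lam0 j : 0 < lam j by rewrite invr_gt0.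
pose B j := \bigcap_N oscillates (lam j) N.
have mB j : measurable (B j : set BT).
  by apply: bigcap_measurable => // k _; exact: measurable_oscillates.
exists (\bigcup_j B j); split.
- exact: bigcup_measurable.
- apply/eqP; rewrite eq_le measure_ge0 andbT.
  apply: (@le_trans _ _ (\sum_(0 <= j <oo) nu (B j))%E).
    by apply: measure_sigma_subadditive => //; exact: bigcup_measurable.
  by rewrite eseries0 // => j _ _; exact: nu_always_oscillates.
move=> y y0 nBy; apply/cauchy_cvgP; apply: cauchy_exP => e e0.
have [j hj] : exists j, lam j < e.
  exists (Num.truncn e^-1); rewrite /lam -[e]invrK ltf_pV2 ?posrE ?invr_gt0 //.
  have e10 : 0 <= e^-1 by rewrite invr_ge0 ltW.
  by have /andP[] := truncn_itv e10; rewrite invrK.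
have [N hN] : exists N, ~ oscillates (lam j) N y.
  apply: contrapT => h; apply: nBy; exists j => // N _.
  by apply: contrapT => h'; apply: h; exists N.
exists (X (address_prefix y N)); exists N => // m /= Nm.
rewrite /ball /= distrC; apply: le_lt_trans hj; rewrite leNgt; apply/negP => hm.
by apply: hN; split=> //; exists (m - N)%N; rewrite subnKC.
Qed.

End tree_martingale.

(** * The Kusuoka measure and its matrix density *)

(** The integral of a nonnegative function is a supremum over the simple
    functions below it, hence monotone even for a nonmeasurable integrand. *)
Lemma ge0_subset_integral_nomeas d (T : measurableType d) (R : realType)
    (mu : {measure set T -> \bar R}) (A B : set T) (f : T -> \bar R) :
  (forall x, B x -> (0 <= f x)%E) -> A `<=` B ->
  (\int[mu]_(x in A) f x <= \int[mu]_(x in B) f x)%E.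
Proof.
move=> f0 AB; rewrite !ge0_integralE //; last by move=> x /AB; exact: f0.
apply: ereal_sup_le => _ [h hf <-]; exists h => // x.
apply: le_trans (hf x) _; exact: restrict_lee.
Qed.

Section quadratic_forms.
Context {R : realType} {n : nat}.
Implicit Types (A B : 'M[R]_n) (a b c : 'cV[R]_n).

Definition qform A a b : R := (a^T *m (A *m b)) 0 0.

Lemma qformE A a b : qform A a b = \sum_k \sum_l a k 0 * A k l * b l 0.
Proof.
rewrite /qform mxE; apply: eq_bigr => k _; rewrite !mxE mulr_sumr.
by apply: eq_bigr => l _; rewrite mulrA.
Qed.

Lemma qformZ t A a b : qform (t *: A) a b = t * qform A a b.
Proof. by rewrite /qform -scalemxAl -scalemxAr mxE. Qed.

Lemma qform_sum (I : finType) (A : I -> 'M[R]_n) a b :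
  qform (\sum_i A i) a b = \sum_i qform (A i) a b.
Proof. by rewrite /qform mulmx_suml mulmx_sumr summxE. Qed.

Lemma gram_qform m (B : 'M[R]_(m, n)) a : qform (B^T *m B) a a = ((B *m a)^T *m (B *m a)) 0 0.
Proof. by rewrite /qform trmx_mul !mulmxA. Qed.

Lemma col_sqr_ge0 m (a : 'cV[R]_m) : 0 <= (a^T *m a) 0 0.
Proof. by rewrite mxE; apply: sumr_ge0 => k _; rewrite mxE -expr2 sqr_ge0. Qed.

Lemma gram_trace m (B : 'M[R]_(m, n)) : \tr (B^T *m B) = \sum_k \sum_j B j k ^+ 2.
Proof.
by apply: eq_bigr => k _; rewrite mxE; apply: eq_bigr => j _; rewrite mxE expr2.
Qed.

Lemma gram_trace_ge0 m (B : 'M[R]_(m, n)) : 0 <= \tr (B^T *m B).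
Proof.
by rewrite gram_trace; apply: sumr_ge0 => k _; apply: sumr_ge0 => j _; rewrite sqr_ge0.
Qed.

(** The inequality between geometric and arithmetic means, applied to the entries
    of two columns. *)
Lemma gram_entry_le m (B : 'M[R]_(m, n)) k l : `|(B^T *m B) k l| <= \tr (B^T *m B).
Proof.
have col_le i : \sum_j B j i ^+ 2 <= \tr (B^T *m B).
  rewrite gram_trace (bigD1 i) //= lerDl; apply: sumr_ge0 => i' _.
  by apply: sumr_ge0 => j _; rewrite sqr_ge0.
rewrite mxE; apply: (le_trans (ler_norm_sum _ _ _)).
apply: (@le_trans _ _ (\sum_j (B j k ^+ 2 + B j l ^+ 2) / 2)).
  apply: ler_sum => j _; rewrite mxE normrM -(real_normK (num_real (B j k))).
  rewrite -(real_normK (num_real (B j l))).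
  by have := sqr_ge0 (`|B j k| - `|B j l|); rewrite sqrrB; lra.
rewrite -mulr_suml big_split /=; have := col_le k; have := col_le l; lra.
Qed.

Lemma qform_parallelogram A a b :
  qform A b b = 2 * qform A a a + 2 * qform A (b - a) (b - a) - qform A (b - 2 *: a) (b - 2 *: a).
Proof.
rewrite !qformE !mulr_sumr -big_split -sumrB /=; apply: eq_bigr => k _.
rewrite !mulr_sumr -big_split -sumrB /=; apply: eq_bigr => l _; rewrite !mxE; ring.
Qed.

Lemma mx_cvg (u : nat -> 'M[R]_n) A :
  (forall k l, u m k l @[m --> \oo] --> A k l) -> u m @[m --> \oo] --> A.
Proof.
move=> h B [P PA PB].
have : \forall m \near \oo, forall kl : 'I_n * 'I_n, P kl.1 kl.2 (u m kl.1 kl.2).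
  by apply: filter_forall => -[k l] /=; apply: h; exact: PA.
by apply: filterS => m hm; apply: PB => k l; exact: (hm (k, l)).
Qed.

Lemma mx_cvg_entry (u : nat -> 'M[R]_n) A : u m @[m --> \oo] --> A ->
  forall k l, u m k l @[m --> \oo] --> A k l.
Proof.
move=> h k l B hB; apply: (h [set N | B (N k l)]).
exists (fun k' l' => if (k' == k) && (l' == l) then B else setT).
  move=> k' l'; case: ifP => [/andP[/eqP-> /eqP->] //|_]; exact: filterT.
by move=> N /= /(_ k l); rewrite !eqxx.
Qed.

Lemma qform_cvg (u : nat -> 'M[R]_n) A a b :
  (forall k l, u m k l @[m --> \oo] --> A k l) ->
  qform (u m) a b @[m --> \oo] --> qform A a b.
Proof.
move=> h; have -> : (fun m => qform (u m) a b) =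
    fun m => \sum_k \sum_l a k 0 * u m k l * b l 0.
  by apply/funext => m; exact: qformE.
rewrite qformE; apply: cvg_sumr => k; apply: cvg_sumr => l.
by apply: cvgM; [apply: cvgM|]; [exact: cvg_cst|exact: h|exact: cvg_cst].
Qed.

End quadratic_forms.

Section kusuoka.
Context {R : realType} {F : nestedFractal R}.
Variable S : harmonicStructure F.
Local Notation T := 'rV[R]_(nfN F).
Local Notation M := (nfM F).
Local Notation K := (nfK F).
Local Notation V0 := (nfV0 F).
Local Notation phi_ := (word_map (nfphi F)).
Local Notation rho := (hs_rho S).
Local Notation BT := (borelRV R (nfN F)).
Implicit Types (f g h : T -> R) (u v w : seq 'I_M) (x y : T).
Variables (n : nat) (e : 'I_n -> T -> R).
Hypothesis he : orthonormal_basis S e.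
Variable nu : {measure set (borelRV R (nfN F)) -> \bar R}.
Hypothesis hnu : kusuoka_measure S e nu.

Local Notation Mw := (Mword S e).
Local Notation gram w := ((Mw w)^T *m Mw w).

Definition cell_mass w : R := rho ^+ size w * \tr (gram w).

Lemma nu_cell w : nu (cell w) = (cell_mass w)%:E.
Proof. by case: hnu => _ _ /(_ _ (in_tuple w)). Qed.

Lemma nu_atomless x : nu [set x] = 0%E. Proof. by case: hnu. Qed.

Lemma gram_additive (L : 'M[R]_n -> R) :
    (forall t A, L (t *: A) = t * L A) ->
    (forall (I : finType) (A : I -> 'M[R]_n), L (\sum_i A i) = \sum_i L (A i)) ->
  forall w, rho ^+ size w * L (gram w) =
    \sum_i rho ^+ size (rcons w i) * L (gram (rcons w i)).
Proof.
move=> LZ LS w; rewrite (Mword_gram_split he) LZ LS mulrA -exprSr mulr_sumr.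
by apply: eq_bigr => i _; rewrite size_rcons.
Qed.

Lemma cell_mass_add w : cell_mass w = \sum_i cell_mass (rcons w i).
Proof.
apply: (gram_additive (L := fun A => \tr A)) => [t A|I A]; first exact: mxtraceZ.
exact: raddf_sum.
Qed.

Definition cell_entry k l w : R := rho ^+ size w * gram w k l.

Lemma cell_entry_add k l w : cell_entry k l w = \sum_i cell_entry k l (rcons w i).
Proof.
by apply: (gram_additive (L := fun A => A k l)) => [t A|I A]; rewrite ?mxE ?summxE.
Qed.

Lemma rhoX_gt0 m : 0 < rho ^+ m. Proof. by rewrite exprn_gt0 ?rho_gt0. Qed.

Lemma cell_entry_le k l w : `|cell_entry k l w| <= cell_mass w.
Proof.
by rewrite normrM gtr0_norm ?rhoX_gt0 // ler_pM2l ?rhoX_gt0 // gram_entry_le.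
Qed.

Lemma Z_entry m x k l :
  Z_ S e m x k l = density cell_mass (cell_entry k l) (address_prefix x m).
Proof.
rewrite /Z_ /density mxE invfM mulrACA divff ?gt_eqF ?rhoX_gt0 // mul1r.
by rewrite mulrC.
Qed.

(** Every entry is a bounded martingale, since the entries of a Gram matrix are
    dominated by its trace. *)
Lemma Z_converges : exists good : set T, [/\ measurable (good : set BT),
  good `<=` rcell [::], nu (rcell [::] `\` good) = 0%E &
  forall x, good x -> forall k l, cvgn (fun m => Z_ S e m x k l)].
Proof.
have /choice[A hA] := fun kl : 'I_n * 'I_n =>
  martingale_cvg nu_atomless nu_cell cell_mass_add (cell_entry_add kl.1 kl.2)
    (cell_entry_le kl.1 kl.2).
pose B := \big[setU/set0]_kl A kl.
have mB : measurable (B : set BT).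
  by apply: bigsetU_measurable => kl _; case: (hA kl).
have nuB : nu B = 0%E.
  apply/eqP; rewrite eq_le measure_ge0 andbT.
  apply: (le_trans (measure_bigsetU_le _ _ _ _)) => [kl|]; first by case: (hA kl).
  by rewrite big1 // => kl _; case: (hA kl).
have mK : measurable (rcell [::] : set BT) by exact: measurable_rcell.
exists (rcell [::] `\` B); split.
- exact: measurableD.
- by move=> x [].
- apply/eqP; rewrite eq_le measure_ge0 andbT -nuB.
  apply: le_measure; rewrite ?inE //; first by do 2 apply: measurableD => //.
  by move=> x [x0 nx]; apply: contrapT => nB; apply: nx.
move=> x [x0 nBx] k l.
have -> : (fun m => Z_ S e m x k l) =
    fun m => density cell_mass (cell_entry k l) (address_prefix x m).
  by apply/funext => m; exact: Z_entry.
case: (hA (k, l)) => _ _; apply=> // Ax; apply: nBx.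
by rewrite /B -bigcup_seq; exists (k, l) => //; rewrite /= mem_index_enum.
Qed.

Lemma Z__qform_ge0 m x a : 0 <= qform (Z_ S e m x) a a.
Proof.
rewrite /Z_ qformZ mulr_ge0 ?invr_ge0 ?gram_trace_ge0 //.
by rewrite gram_qform col_sqr_ge0.
Qed.

Lemma Z_qform_ge0 x a : 0 <= qform (Z S e x) a a.
Proof.
rewrite /Z; have [c|nc] := pselect (cvg (Z_ S e m x @[m --> \oo])).
  have qc := @qform_cvg R n _ _ a a (mx_cvg_entry c).
  apply: (closed_cvg _ (@closed_ge R 0) _ _ qc).
  by exists 0%N => // m _ /=; exact: Z__qform_ge0.
(* where the densities diverge, their limit is the zero matrix by convention *)
rewrite (dvgP nc) qformE; apply: sumr_ge0 => k _; apply: sumr_ge0 => l _.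
by rewrite /point /= mxE mulr0 mul0r.
Qed.

Lemma Zdot_qform (G G' : T -> 'cV[R]_n) x : Zdot S e G G' x = qform (Z S e x) (G x) (G' x).
Proof. by []. Qed.

Lemma Zdot_ge0 (G : T -> 'cV[R]_n) x : 0 <= Zdot S e G G x.
Proof. exact: Z_qform_ge0. Qed.

(** The parallelogram identity for a positive semidefinite form gives a triangle
    inequality for squares. *)
Lemma Zdot_triangle (G H : T -> 'cV[R]_n) x :
  Zdot S e H H x <= 2 * Zdot S e G G x + 2 * Zdot S e (H \- G) (H \- G) x.
Proof.
rewrite !Zdot_qform /= (qform_parallelogram _ (G x)).
by rewrite lerBlDr lerDl Z_qform_ge0.
Qed.

Section good_points.
Variable good : set T.
Hypothesis measurable_good : measurable (good : set BT).
Hypothesis good_rcell : good `<=` rcell [::].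
Hypothesis good_full : nu (rcell [::] `\` good) = 0%E.
Hypothesis good_cvg : forall x, good x -> forall k l, cvgn (fun m => Z_ S e m x k l).
Definition gcell w : set T := cell w `&` good.

Lemma measurable_gcell w : measurable (gcell w : set BT).
Proof. by apply: measurableI => //; exact: measurable_cell. Qed.

Lemma gcell_good w : gcell w `<=` good. Proof. by move=> x []. Qed.

Lemma gcell_rcell w : gcell w `<=` rcell w.
Proof. by move=> x [wx /good_rcell[_ nV]]. Qed.

Lemma nu_gcell w : nu (gcell w) = (cell_mass w)%:E.
Proof.
rewrite -nu_cell -(nu_rcell nu_atomless).
have -> : gcell w = rcell w `\` (rcell w `\` good).
  apply/seteqP; split => x; first by move=> gx; split; [exact: gcell_rcell|case=> _; apply; case: gx].
  by move=> [wx h]; split; [case: wx|apply: contrapT => ng; apply: h].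
have mr := measurable_rcell w.
have m1 : measurable (rcell w `\` good : set BT) by exact: measurableD.
have z : nu (rcell w `\` good) = 0%E.
  apply/eqP; rewrite eq_le measure_ge0 andbT -good_full.
  apply: le_measure; rewrite ?inE //; first by apply: measurableD => //; exact: measurable_rcell.
  by move=> x [/rcell_nil_sub x0 ng].
rewrite -[in RHS](setDUK (_ : rcell w `\` good `<=` rcell w)); last by move=> x [].
rewrite measureU //; last 2 first.
- exact: measurableD.
- by rewrite -subset0 => x [[wx ng] [_ h]]; apply: h.
by rewrite [X in (X + _)%E]z add0e.
Qed.

Lemma gcell_split w j : gcell w = \big[setU/set0]_(t : j.-tuple 'I_M) gcell (w ++ t).
Proof.
rewrite -bigcup_seq; apply/seteqP; split => x.
  by move=> [/(cell_refine j)[t tx] gx]; exists t => //=; rewrite mem_index_enum.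
by move=> [t _ [tx gx]]; split=> //; exact: cell_cat_sub tx.
Qed.

Lemma gcell_trivIset w j (D : set (j.-tuple 'I_M)) :
  trivIset D (fun t : j.-tuple 'I_M => gcell (w ++ t)).
Proof.
move=> t t' _ _ [x [/gcell_rcell tx /gcell_rcell t'x]].
apply/val_inj; apply: contrapT => ne.
have : (rcell (w ++ t) `&` rcell (w ++ t')) x by [].
rewrite rcell_disjoint ?size_cat ?size_tuple // => /eqP.
by rewrite eqseq_cat // eqxx /= => /eqP.
Qed.

Lemma integral_gcell_split w j (f : T -> R) :
    measurable_fun (good : set BT) (f : BT -> R) -> (forall x, 0 <= f x) ->
  (\int[nu]_(x in gcell w) (f x)%:E =
   \sum_(t : j.-tuple 'I_M) \int[nu]_(x in gcell (w ++ t)) (f x)%:E)%E.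
Proof.
move=> mf f0; rewrite {1}(gcell_split w j) ge0_integral_bigsetU //.
- by move=> t; exact: measurable_gcell.
- exact: index_enum_uniq.
- exact: gcell_trivIset.
- apply/measurable_EFinP; rewrite -gcell_split.
  apply: measurable_funS mf => //; exact: gcell_good.
- by move=> x _; rewrite lee_fin.
Qed.

Lemma integral_gcell_cst w r (f : T -> R) : (forall x, gcell w x -> f x = r) ->
  (\int[nu]_(x in gcell w) (f x)%:E = (r * cell_mass w)%:E)%E.
Proof.
move=> fr; rewrite EFinM -nu_gcell -integral_cst; last exact: measurable_gcell.
by apply: eq_integral => x; rewrite inE => wx; rewrite fr.
Qed.

Lemma good_prefix_measurable m (G : seq 'I_M -> R) :
  measurable_fun (good : set BT) (fun x : BT => G (address_prefix x m)).
Proof.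
apply: measurable_funS (@measurable_prefix_fun R F _ R m G) => //.
exact: measurable_rcell.
Qed.

Lemma Z_cvg x : good x -> forall k l, Z_ S e m x k l @[m --> \oo] --> Z S e x k l.
Proof.
move=> gx; apply: mx_cvg_entry.
have c : Z_ S e m x @[m --> \oo] --> \matrix_(k, l) lim (Z_ S e m x k l @[m --> \oo]).
  by apply: mx_cvg => k l; rewrite mxE; exact: good_cvg.
suff : cvgn (fun m => Z_ S e m x) by [].
by apply/cvg_ex; exists (\matrix_(k, l) lim (Z_ S e m x k l @[m --> \oo])).
Qed.

Lemma Z_entry_measurable k l :
  measurable_fun (good : set BT) (fun x : BT => Z S e x k l).
Proof.
apply: (@measurable_fun_cvg _ _ _ _ (fun m (x : BT) => Z_ S e m x k l)).
  move=> m; pose G w := density cell_mass (cell_entry k l) w.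
  have -> : (fun x : BT => Z_ S e m x k l) = fun x : BT => G (address_prefix x m).
    by apply/funext => x; exact: Z_entry.
  exact: good_prefix_measurable.
by move=> x gx; exact: Z_cvg.
Qed.

Lemma Zdot_measurable (G G' : T -> 'cV[R]_n) :
    (forall k, measurable_fun (good : set BT) (fun x : BT => G x k 0)) ->
    (forall k, measurable_fun (good : set BT) (fun x : BT => G' x k 0)) ->
  measurable_fun (good : set BT) (fun x : BT => Zdot S e G G' x).
Proof.
move=> mG mG'.
have -> : (fun x : BT => Zdot S e G G' x) =
    fun x : BT => \sum_k \sum_l G x k 0 * Z S e x k l * G' x l 0.
  by apply/funext => x; exact: qformE.
apply: measurable_sum => k; apply: measurable_sum => l.
apply: measurable_funM => //; apply: measurable_funM => //.
exact: Z_entry_measurable.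
Qed.

(** The densities of all finer generations satisfy the identity exactly, by the
    additivity of the Gram matrices, and it passes to the limit by dominated
    convergence. *)
Lemma integral_Z v (c : 'cV[R]_n) :
  (\int[nu]_(x in gcell v) (qform (Z S e x) c c)%:E =
   (rho ^+ size v * qform (gram v) c c)%:E)%E.
Proof.
have qadd := gram_additive (L := fun A => qform A c c)
  (fun t A => qformZ t A c c) (fun I A => qform_sum A c c).
have exactm j : (\int[nu]_(x in gcell v) (qform (Z_ S e (size v + j) x) c c)%:E =
    (rho ^+ size v * qform (gram v) c c)%:E)%E.
  pose G w := qform ((\tr (gram w))^-1 *: gram w) c c.
  rewrite (@integral_gcell_split v j (fun x => qform (Z_ S e (size v + j) x) c c)); last 2 first.
  - exact: (good_prefix_measurable (size v + j) G).
  - by move=> x; exact: Z__qform_ge0.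
  rewrite (additive_cat (a := fun w => rho ^+ size w * qform (gram w) c c) qadd j) -sumEFin.
  apply: eq_bigr => t _; rewrite (@integral_gcell_cst _ (G (v ++ t))); last first.
    move=> x /gcell_rcell/rcell_prefix; rewrite size_cat size_tuple => xE.
    by rewrite /G /Z_ xE.
  congr EFin; rewrite /G qformZ /cell_mass.
  have [t0|t0] := eqVneq (\tr (gram (v ++ t))) 0; last by field.
  have g0 : gram (v ++ t) = 0.
    apply/matrixP => k l; have := gram_entry_le (Mw (v ++ t)) k l.
    by rewrite t0 normr_le0 [RHS]mxE => /eqP.
  by rewrite g0 mxtrace0 !mulr0 /qform mul0mx mulmx0 mxE mulr0.
pose C := \sum_k \sum_l `|c k 0| * `|c l 0|.
have C0 : 0 <= C by apply: sumr_ge0 => k _; apply: sumr_ge0 => l _; rewrite mulr_ge0.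
have Zle m x k l : `|Z_ S e m x k l| <= 1.
  rewrite /Z_ mxE normrM normfV (ger0_norm (gram_trace_ge0 _)).
  have := gram_entry_le (Mw (address_prefix x m)) k l; set A := gram _.
  have [t0|t0] := eqVneq (\tr A) 0; first by rewrite t0 invr0 mul0r.
  by rewrite mulrC ler_pdivrMr ?mul1r // lt_def t0 gram_trace_ge0.
have mq m : measurable_fun (gcell v : set BT)
    (fun x : BT => (qform (Z_ S e m x) c c)%:E).
  apply/measurable_EFinP.
  apply: measurable_funS (good_prefix_measurable m (fun w => qform ((\tr (gram w))^-1 *: gram w) c c)) => //.
  exact: gcell_good.
have mqZ : measurable_fun (gcell v : set BT) (fun x : BT => (qform (Z S e x) c c)%:E).
  apply/measurable_EFinP.
  apply: measurable_funS (@Zdot_measurable (cst c) (cst c) _ _) => //.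
  exact: gcell_good.
have [|||] := @dominated_convergence _ BT R nu (gcell v) (measurable_gcell v)
  (fun m x => (qform (Z_ S e m x) c c)%:E) (fun x => (qform (Z S e x) c c)%:E) (cst C%:E) mq mqZ.
- apply: aeW => x gx; apply/fine_cvgP; split; first exact: nearW.
  by apply: qform_cvg; apply: Z_cvg; exact: gcell_good gx.
- apply/integrableP; split; first exact: measurable_cst.
  under eq_integral do rewrite /= ger0_norm //.
  rewrite integral_cst; last exact: measurable_gcell.
  by rewrite [X in (_ * X)%E]nu_gcell -EFinM ltry.
- apply: aeW => x m gx; rewrite lee_fin qformE.
  apply: (le_trans (ler_norm_sum _ _ _)); apply: ler_sum => k _.
  apply: (le_trans (ler_norm_sum _ _ _)); apply: ler_sum => l _.
  by rewrite !normrM mulrAC ler_piMr ?mulr_ge0.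
move=> _ _ cv; apply: (cvg_unique (@ereal_hausdorff R) cv).
move=> B hB; exists (size v) => // m /= vm.
by rewrite -(subnKC vm) exactm; exact: nbhs_singleton hB.
Qed.

End good_points.
End kusuoka.

(** * Gradients and mean oscillation *)

Section gradient.
Context {R : realType} {F : nestedFractal R}.
Variable S : harmonicStructure F.
Local Notation T := 'rV[R]_(nfN F).
Local Notation M := (nfM F).
Local Notation K := (nfK F).
Local Notation phi_ := (word_map (nfphi F)).
Local Notation rho := (hs_rho S).
Local Notation BT := (borelRV R (nfN F)).
Implicit Types (f g h : T -> R) (u v w : seq 'I_M) (x y : T).
Variables (n : nat) (e : 'I_n -> T -> R).
Hypothesis he : orthonormal_basis S e.
Hypothesis nd : nondegenerate_structure S.
Variable nu : {measure set (borelRV R (nfN F)) -> \bar R}.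
Hypothesis hnu : kusuoka_measure S e nu.
Local Notation Mw := (Mword S e).

Definition word_gradient f v : 'cV[R]_n :=
  invmx (Mw v) *m coord_tilde S e (Ptilde S (harmonic_extension S (f \o phi_ v))).

Lemma gram_word_gradient f v :
  qform ((Mw v)^T *m Mw v) (word_gradient f v) (word_gradient f v) =
  eform0 S (f \o phi_ v) (f \o phi_ v).
Proof.
rewrite gram_qform /word_gradient mulKVmx ?gradient_coord_sqr //.
exact: Mword_unit.
Qed.

Section on_good_points.
Variable good : set T.
Hypothesis measurable_good : measurable (good : set BT).
Hypothesis good_rcell : good `<=` rcell [::].
Hypothesis good_full : nu (rcell [::] `\` good) = 0%E.
Hypothesis good_cvg : forall x, good x -> forall k l, cvgn (fun m => Z_ S e m x k l).

Lemma nabla_measurable m f k :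
  measurable_fun (good : set BT) (fun x : BT => nabla_ S e m f x k 0).
Proof.
exact: (good_prefix_measurable good_rcell m (fun v => word_gradient f v k 0)).
Qed.

(** The discrete gradient is constant on the cells of its generation, where the
    integral of [Z], the Gram matrix of the word, undoes the inverse in its
    definition. *)
Lemma integral_nabla w j f :
  (\int[nu]_(x in gcell good w)
     (Zdot S e (nabla_ S e (size w + j) f) (nabla_ S e (size w + j) f) x)%:E =
   (rho ^+ size w * eform_ S j (f \o phi_ w) (f \o phi_ w))%:E)%E.
Proof.
rewrite (@integral_gcell_split _ _ nu good measurable_good good_rcell w j); last 2 first.
- by apply: Zdot_measurable => // k; exact: nabla_measurable.
- by move=> x; exact: Zdot_ge0.
transitivity (\sum_(t : j.-tuple 'I_M)
   (rho ^+ size (w ++ t) * eform0 S (f \o phi_ (w ++ t)) (f \o phi_ (w ++ t)))%:E)%E.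
  apply: eq_bigr => t _.
  rewrite -gram_word_gradient.
  rewrite -(integral_Z he hnu measurable_good good_rcell good_full good_cvg).
  apply: eq_integral => x; rewrite inE => /(gcell_rcell good_rcell)/rcell_prefix.
  by rewrite size_cat size_tuple => xE; rewrite Zdot_qform /nabla_ xE.
rewrite sumEFin; congr EFin; rewrite /eform_ !mulr_sumr; apply: eq_bigr => t _.
rewrite size_cat size_tuple exprD -mulrA; congr (_ * (_ * _)).
by apply: eq_eform0 => x _ /=; rewrite word_map_cat.
Qed.

Lemma cell_energy_approx w j f (G : T -> 'cV[R]_n) :
    (forall k, measurable_fun (K : set BT) (fun x : BT => G x k 0)) ->
  ((rho ^+ size w * eform_ S j (f \o phi_ w) (f \o phi_ w))%:E <=
   2%:E * \int[nu]_(x in cell w) (Zdot S e G G x)%:E +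
   2%:E * \int[nu]_(x in K) (Zdot S e (nabla_ S e (size w + j) f \- G)
                                      (nabla_ S e (size w + j) f \- G) x)%:E)%E.
Proof.
move=> mG; set m := (size w + j)%N; set H := nabla_ S e m f.
have mGg k : measurable_fun (good : set BT) (fun x : BT => G x k 0).
  apply: measurable_funS (mG k) => //; first exact: measurable_K.
  by move=> x /good_rcell[]; rewrite cell_nil.
have mHg k : measurable_fun (good : set BT) (fun x : BT => H x k 0) by exact: nabla_measurable.
have mDg k : measurable_fun (good : set BT) (fun x : BT => (H \- G) x k 0).
  have -> : (fun x : BT => (H \- G) x k 0) = fun x : BT => H x k 0 - G x k 0.
    by apply/funext => x; rewrite /= !mxE.
  exact: measurable_funB.
have mg := measurable_gcell measurable_good w.
have mZ (A B : T -> 'cV[R]_n) : (forall k, measurable_fun (good : set BT) (fun x : BT => A x k 0)) ->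
    measurable_fun (gcell good w : set BT) (fun x : BT => (Zdot S e A A x)%:E).
  move=> mA; apply/measurable_EFinP; apply: measurable_funS (Zdot_measurable good_rcell good_cvg mA mA) => //.
  exact: gcell_good.
rewrite -integral_nabla -/m -/H.
have ge0 (A : T -> 'cV[R]_n) x : (0 <= (Zdot S e A A x)%:E)%E by rewrite lee_fin Zdot_ge0.
apply: (@le_trans _ _ (\int[nu]_(x in gcell good w)
   (2%:E * (Zdot S e G G x)%:E + 2%:E * (Zdot S e (H \- G) (H \- G) x)%:E))%E).
  apply: ge0_le_integral => //.
  - exact: mZ.
  - by apply: emeasurable_funD; apply: measurable_funeM; exact: mZ.
  - by move=> x _; rewrite -!EFinM -EFinD lee_fin Zdot_triangle.
rewrite ge0_integralD //; last 4 first.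
- by move=> x _; rewrite mule_ge0.
- by apply: measurable_funeM; exact: mZ.
- by move=> x _; rewrite mule_ge0.
- by apply: measurable_funeM; exact: mZ.
rewrite !ge0_integralZl //; try exact: mZ.
apply: leeD; rewrite lee_pmul2l //; apply: ge0_subset_integral_nomeas => //.
- by move=> x [].
- by move=> x [/cell_sub_K].
Qed.

End on_good_points.

Lemma poweR_half_small (u : nat -> \bar R) (d : R) : 0 < d ->
  (forall m, (0 <= u m)%E) -> (u m `^ 2^-1)%E @[m --> \oo] --> 0%E ->
  exists N, forall m, (N <= m)%N -> (u m <= d%:E)%E.
Proof.
move=> d0 u0 /fine_cvgP[[N1 _ hfin] hcv].
have sd : 0 < Num.sqrt d by rewrite sqrtr_gt0.
have /cvgrPdist_lt/(_ _ sd)[N2 _ hN] := hcv.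
exists (maxn N1 N2) => m; rewrite geq_max => /andP[m1 m2].
have fm : (u m `^ 2^-1)%E \is a fin_num := hfin m m1.
have := hN m m2; rewrite /= sub0r normrN.
have pm : (0 <= u m `^ 2^-1)%E by exact: poweR_ge0.
rewrite ger0_norm ?fine_ge0 // => lt.
have -> : u m = ((u m `^ 2^-1) `^ 2)%E by rewrite -poweRrM mulVf ?pnatr_eq0 // poweRe1.
rewrite -(fineK fm) poweR_EFin lee_fin powR_mulrn ?fine_ge0 //.
rewrite -[leRHS]sqr_sqrtr ?(ltW d0) // ler_pXn2r ?nnegrE ?fine_ge0 ?sqrtr_ge0 //.
exact: ltW.
Qed.

(** The discrete gradients carry the energy at the vertices of all generations
    and converge to the gradient; the factor 2 is that of
    [Zdot_triangle]. *)
Lemma cell_energy_le w f (G : T -> 'cV[R]_n) j : is_gradient S e nu f G ->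
  ((rho ^+ size w * eform_ S j (f \o phi_ w) (f \o phi_ w))%:E <=
   2%:E * \int[nu]_(x in cell w) (Zdot S e G G x)%:E)%E.
Proof.
move=> [mG cvG].
have [good [mgood gr gfull gcvg]] := Z_converges he hnu.
apply/lee_addgt0Pr => d d0.
have d20 : 0 < d / 2 by rewrite divr_gt0.
have [|N hN] := poweR_half_small d20 _ cvG.
  by move=> m; apply: integral_ge0 => x _; rewrite lee_fin Zdot_ge0.
apply: (@le_trans _ _ ((rho ^+ size w * eform_ S (maxn j N) (f \o phi_ w) (f \o phi_ w))%:E)%E).
  by rewrite lee_fin ler_pM2l ?rhoX_gt0 // eform_le // leq_maxl.
apply: le_trans (cell_energy_approx mgood gr gfull gcvg w (maxn j N) f mG) _.
rewrite leeD2l // -[d](divfK (_ : 2 != 0)) ?pnatr_eq0 // mulrC EFinM lee_pmul2l //.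
by apply: hN; rewrite (leq_trans (leq_maxr j N)) // leq_addl.
Qed.

End gradient.

Section mean_oscillation.
Context {R : realType} {F : nestedFractal R}.
Local Notation T := 'rV[R]_(nfN F).
Local Notation K := (nfK F).
Local Notation BT := (borelRV R (nfN F)).
Implicit Types (f : T -> R) (x y : T).

Lemma continuous_on_K_measurable f : {within K, continuous f} ->
  measurable_fun (K : set BT) (f : BT -> R).
Proof.
move=> /continuousP cf.
apply: (measurability _ (RGenOpens.measurableE R)) => _ [_ [a [b ->] <-]].
have /open_subspaceP[V oV VK] := cf _ (@interval_open R (BRight a) (BLeft b) isT isT).
by rewrite setIC -VK; apply: measurableI; [exact: open_borel|exact: measurable_K].
Qed.

Lemma mean_oscillation_le (mu : {measure set (borelRV R (nfN F)) -> \bar R})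
    (D : set T) (b a : R) f :
    measurable (D : set BT) -> D `<=` K -> D !=set0 -> mu D = b%:E -> 0 < b ->
    {within K, continuous f} -> (forall x y, D x -> D y -> `|f x - f y| <= a) ->
  ((mu D)^-1 * \int[mu]_(x in D) (`|f x - mean_value mu D f|)%:E <= a%:E)%E.
Proof.
move=> mD DK [x0 Dx0] muD b0 cf osc.
have mf : measurable_fun (D : set BT) (f : BT -> R).
  apply: measurable_funS (continuous_on_K_measurable cf) => //; exact: measurable_K.
have a0 : 0 <= a by apply: le_trans (normr_ge0 _) (osc x0 x0 Dx0 Dx0).
have finD : (mu D < +oo)%E by rewrite muD ltry.
have intf : mu.-integrable D (EFin \o f).
  apply: measurable_bounded_integrable => //.
  exists (`|f x0| + a); split; first exact: num_real.
  move=> t ht y /= Dy; apply: le_trans (ltW ht).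
  by rewrite -[f y](subrK (f x0)) (le_trans (ler_normD _ _)) // addrC lerD2l osc.
have intc r : mu.-integrable D (EFin \o (fun _ : BT => r)).
  apply: measurable_bounded_integrable => //.
  exists `|r|; split; first exact: num_real.
  by move=> t ht y /= _; exact: ltW.
have mean x : D x -> `|f x - mean_value mu D f| <= a.
  move=> Dx; rewrite /mean_value muD /=.
  have h1 : \int[mu]_(y in D) f y <= \int[mu]_(y in D) (f x + a).
    apply: le_Rintegral => // y Dy.
    by have := osc x y Dx Dy; rewrite ler_norml; lra.
  have h2 : \int[mu]_(y in D) (f x - a) <= \int[mu]_(y in D) f y.
    apply: le_Rintegral => // y Dy.
    by have := osc x y Dx Dy; rewrite ler_norml; lra.
  rewrite !Rintegral_cst // muD /= in h1 h2.
  rewrite -ler_pdivrMr // in h1; rewrite -ler_pdivlMr // in h2.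
  by rewrite ler_norml mulrC; lra.
rewrite muD inver gt_eqF // lee_pdivrMl //.
have mdiff : measurable_fun (D : set BT) (fun x : BT => (`|f x - mean_value mu D f|)%:E).
  apply/measurable_EFinP; apply: measurableT_comp => //.
  by apply: measurable_funB.
apply: (@le_trans _ _ (\int[mu]_(x in D) (cst a%:E) x)%E).
  by apply: ge0_le_integral => // x Dx; rewrite lee_fin ?mean.
by rewrite integral_cst // muD -EFinM mulrC.
Qed.

End mean_oscillation.

Theorem theorem3p1 (R : realType) (F : nestedFractal R) (S : harmonicStructure F) :
  nondegenerate_structure S ->
  exists C C' : R, [/\ 0 < C, C <= C' &
  forall (n : nat) (e : 'I_n -> 'rV[R]_(nfN F) -> R)
    (mu nu : {measure set (borelRV R (nfN F)) -> \bar R}),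
  orthonormal_basis S e -> normalized_hausdorff mu -> kusuoka_measure S e nu ->
  forall (f : 'rV[R]_(nfN F) -> R) (gradf : 'rV[R]_(nfN F) -> 'cV[R]_n),
  energy_dom S f -> is_gradient S e nu f gradf ->
  forall (m : nat) (D : set 'rV[R]_(nfN F)), simplices m D ->
  let d := hdim F in
  let dw := walk_dim S in
  let L := nfL F in
  let I := (\int[nu]_(x in star m D) (Zdot S e gradf gradf x)%:E)%E in
  let rhs := (diam D `^ (dw / 2) * (I / mu (star m D)) `^ 2^-1)%E in
  [/\ ((mu D)^-1 * \int[mu]_(x in D) (`|f x - mean_value mu D f|)%:E <= C%:E * rhs)%E,
      (C%:E * rhs <= C'%:E * (L `^ (- (m%:R * dw / 2)))%:E *
         ((L `^ (- (m%:R * d)) / L `^ (- (2 * m%:R * d)))%:E * I) `^ 2^-1)%E &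
      (C'%:E * (L `^ (- (m%:R * dw / 2)))%:E *
         ((L `^ (- (m%:R * d)) / L `^ (- (2 * m%:R * d)))%:E * I) `^ 2^-1 =
       C'%:E * (L `^ (- (m%:R * dw / 2)))%:E *
         ((L `^ (m%:R * d))%:E * I) `^ 2^-1)%E]].
Proof.
move=> nd.
have [c0 hc0] := cell_packing F.
pose c := c0.+1.
have hc k z : (#|@near_words R F k z k| <= c)%N by apply: leq_trans (hc0 k z) _; exact: leqnSn.
have [C0 C0_gt0 hC0] := oscillation_le S.
have c_gt0 : 0 < c%:R :> R by rewrite ltr0n.
have L0 : 0 < nfL F by rewrite (lt_trans ltr01) ?nfL_gt1.
have M0 := M_gt0 F; have rho0 := rho_gt0 S.
(* 2 is the loss in [cell_energy_le], and [c] the number of cells that may make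
   up a star *)
pose C := C0 * Num.sqrt (2 * c%:R).
have C_gt0 : 0 < C by rewrite mulr_gt0 // sqrtr_gt0 mulr_gt0.
exists C, C; split=> // n e mu nu he hmu hnu f gradf df hgrad m D [w ->] d dw L I rhs.
have Mm0 : 0 < (nfM F)%:R ^+ m :> R by rewrite exprn_gt0.
have Lmd : L `^ (m%:R * d) = (nfM F)%:R ^+ m.
  by rewrite mulrC powRrM /L /d L_powR_ln // powR_mulrn // ltW.
have Ldiv : L `^ (- (m%:R * d)) / L `^ (- (2 * m%:R * d)) = (nfM F)%:R ^+ m.
  rewrite -powRB; last by rewrite (gt_eqF L0) implybT.
  by rewrite -Lmd; congr (_ `^ _); ring.
have diamE : diam (cell w) = (((nfL F)^-1) ^+ m)%:E by rewrite diam_cell size_tuple.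
have diamP : (diam (cell w) `^ (dw / 2) = (L `^ (- (m%:R * dw / 2)))%:E)%E.
  rewrite diamE poweR_EFin; congr EFin.
  rewrite exprVn -(powR_invn _ (ltW L0)) -powRrM; congr (_ `^ _); ring.
have star_ge : (((nfM F)%:R ^+ m)^-1%:E <= mu (star m (cell w)))%E by exact: mu_star_ge.
have star_le : (mu (star m (cell w)) <= (c%:R * ((nfM F)%:R ^+ m)^-1)%:E)%E by exact: mu_star_le.
have I_ge0 : (0 <= I)%E by apply: integral_ge0 => x _; rewrite lee_fin Zdot_ge0.
have fstar : mu (star m (cell w)) \is a fin_num.
  by rewrite ge0_fin_numE //; exact: le_lt_trans star_le (ltry _).
move: star_ge star_le; rewrite -(fineK fstar) !lee_fin.
set s := fine _ => s_ge s_le.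
have s_gt0 : 0 < s by apply: lt_le_trans s_ge; rewrite invr_gt0.
have starE' : mu (star m (cell w)) = s%:E by rewrite -(fineK fstar).
have starV : ((mu (star m (cell w)))^-1 = (s^-1)%:E)%E.
  by rewrite starE' inver gt_eqF.
have pow_le (x y : \bar R) : (0 <= x -> x <= y -> x `^ 2^-1 <= y `^ 2^-1)%E.
  move=> x0 xy; apply: gt0_ler_poweR => //.
  - by rewrite in_itv /= x0 leey.
  - by rewrite in_itv /= (le_trans x0 xy) leey.
split.
- have oscD (r : R) : 0 <= r -> (I <= r%:E)%E -> forall x y, cell w x -> cell w y ->
      `|f x - f y| <= C0 * Num.sqrt ((hs_rho S ^+ m)^-1 * (2 * r)).
    move=> r0 Ir _ _ [x Kx <-] [y Ky <-].
    have dw' := dom_word w df.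
    apply: (hC0 (f \o word_map (nfphi F) w)) => //; first exact: (proj1 dw').
    move=> j; rewrite energyE ler_pdivlMl ?exprn_gt0 // -lee_fin EFinM.
    have := cell_energy_le he nd hnu w j hgrad; rewrite size_tuple => /le_trans; apply.
    rewrite EFinM lee_pmul2l //; apply: le_trans Ir.
    apply: ge0_subset_integral_nomeas; last exact: cell_sub_star.
    by move=> x' _; rewrite lee_fin Zdot_ge0.
  have mD : mu (cell w) = (((nfM F)%:R ^+ m)^-1)%:E by rewrite mu_cell // size_tuple.
  (* an infinite integral makes the right-hand side infinite *)
  rewrite /rhs diamP starV; clear rhs; clearbody I.
  move: I_ge0 oscD; case: I => [r| |] // r_ge0 oscD; last first.
    rewrite gt0_mulye ?lte_fin ?invr_gt0 // poweRyr ?invr_eq0 ?pnatr_eq0 //.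
    by rewrite gt0_muley ?lte_fin ?powR_gt0 // gt0_muley ?lte_fin // leey.
  rewrite lee_fin in r_ge0.
  apply: le_trans (mean_oscillation_le (measurable_cell w) (@cell_sub_K _ _ w)
    (cell_nonempty w) mD _ (proj1 df) (oscD r r_ge0 (lexx _))) _.
    by rewrite invr_gt0.
  have -> : (r%:E * (s^-1)%:E = (r / s)%:E)%E by rewrite EFinM.
  rewrite poweR_EFin -!EFinM lee_fin powR12_sqrt; last by rewrite divr_ge0 // ltW.
  have LE : L `^ (- (m%:R * dw / 2)) = Num.sqrt ((((nfM F)%:R * hs_rho S) ^+ m)^-1).
    rewrite -powR12_sqrt ?invr_ge0 ?exprn_ge0 ?mulr_ge0 ?(ltW rho0) //.
    have -> : (((nfM F)%:R * hs_rho S) ^+ m)^-1 = ((nfL F)^-1 ^+ m) `^ dw.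
      by rewrite ratioX_powR L_powR_ln // mulr_gt0.
    rewrite -powRrM exprVn -(powR_invn _ (ltW L0)) -powRrM; congr (_ `^ _); ring.
  have MR_ge0 : 0 <= (((nfM F)%:R * hs_rho S) ^+ m)^-1.
    by rewrite invr_ge0 exprn_ge0 // mulr_ge0 // ltW.
  rewrite LE /C -mulrA ler_pM2l // -sqrtrM // -sqrtrM; last by rewrite mulr_ge0.
  apply: ler_wsqrtr; rewrite exprMn invfM.
  have Rm0 : 0 < hs_rho S ^+ m by rewrite exprn_gt0.
  have -> : 2 * c%:R * (((nfM F)%:R ^+ m)^-1 * (hs_rho S ^+ m)^-1 * (r / s)) =
      (hs_rho S ^+ m)^-1 * (2 * r) * (c%:R * ((nfM F)%:R ^+ m)^-1 / s).
    by field; rewrite !gt_eqF.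
  rewrite ler_peMr ?mulr_ge0 ?invr_ge0 ?(ltW Rm0) //.
  by rewrite ler_pdivlMr // mul1r.
- rewrite -muleA lee_pmul2l ?lte_fin // /rhs diamP lee_pmul2l ?lte_fin ?powR_gt0 //.
  apply: pow_le; first by rewrite mule_ge0 // inve_ge0.
  rewrite Ldiv muleC lee_wpmul2r // starV lee_fin.
  by rewrite -[leRHS]invrK lef_pV2 ?posrE ?invr_gt0.
- by rewrite Ldiv Lmd.
Qed.
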